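(* Let $f(z)$ be a non-constant entire function with $\rho(f)<1$, let $\eta$ be a nonzero complex number, and let $a$ be a nonzero finite complex number. If $f(z)$ and $\Delta_{\eta}f(z)=f(z+\eta)-f(z)$ share the values $a$ and $-a$ IM, then $f(z)\equiv\Delta_{\eta}f(z)$.
   Context: Two non-constant meromorphic functions $f$ and $g$ share a value $c$ IM if $f-c$ and $g-c$ have the same zeros, ignoring multiplicities. The order of a meromorphic function $f$ is $\rho(f)=\limsup_{r\to\infty}\frac{\log^{+}T(r,f)}{\log r}$, where $T(r,f)$ is the Nevanlinna characteristic function. *)

(* Defs.v *)
(* complex numbers C = R * R, complex derivative
   via Coquelicot's ex_derive over the absolute ring C_AbsRing. *)
From Stdlib Require Import Reals.
From Coquelicot Require Import Coquelicot.
Open Scope R_scope.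

Definition entire (f : C -> C) : Prop := forall z : C, ex_derive f z.

Definition logp (x : R) : R := Rmax 0 (ln x).

Definition prox (f : C -> C) (r : R) : R :=
  / (2 * PI) * RInt (fun t => logp (Cmod (f (r * cos t, r * sin t)%R))) 0 (2 * PI).

(* Nevanlinna characteristic T(r,f) = m(r,f) + N(r,f); for an entire f
   there are no poles, so N(r,f) = 0 and T(r,f) = m(r,f). *)
Definition char_entire (f : C -> C) (r : R) : R := prox f r.

Definition limsup_infty (g : R -> R) : Rbar :=
  Rbar_glb (fun y : Rbar => exists R0 : R,
    y = Lub_Rbar (fun x => exists r, R0 < r /\ x = g r)).

Definition order_entire (f : C -> C) : Rbar :=
  limsup_infty (fun r => logp (char_entire f r) / ln r).

Definition share_IM (f g : C -> C) (c : C) : Prop :=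
  forall z : C, f z = c <-> g z = c.

Definition diff_op (eta : C) (f : C -> C) : C -> C :=
  fun z => (f (z + eta) - f z)%C.

(* Main.v *)
(* Idea: phi = (f - Df) f' / (f^2 - a^2), with D the difference operator, is entire, because f - Df vanishes
   wherever f = a or f = -a and f' takes care of the multiplicities.  As f has order less than 1, the
   logarithmic derivatives of f, f - a and f + a tend to 0 on suitable circles |z| = r -> oo and on
   annuli of width |eta| around them; integrating f'/f along segments bounds f(z + eta)/f(z), hence
   (f - Df)/f, on these circles, and so phi -> 0 there.  By Cauchy's formula phi = 0, that is,
   (f - Df) f' = 0, and f' is not identically zero. *)
Require Import Defs.
From Stdlib Require Import Reals Lra Lia List FinFun ClassicalEpsilon FunctionalExtensionality.
From Coquelicot Require Import Coquelicot.
Import ListNotations.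
Open Scope R_scope.
Local Arguments RInt : simpl never.

(** The bound on the order acts through a count of zeros. By an inequality of Jensen's type each of
    [f], [f - a], [f + a] has [O(S^rho)] zeros at scale [S], with [rho < 1], and its logarithmic
    derivative is at most a multiple of the sum of [1/|z - x|] over these zeros [x], plus
    [O(S^(rho - 1))]. Averaged over radii, the smoothed sum of [1/sqrt((r - |x|)^2 + 1)] is
    [O(S^(rho - 1) ln S)], so it is small for some [r]. Its smallness forces every zero to lie far
    from that circle, and this carries the bound over to an annulus of prescribed width. The
    function theory rests on real Riemann integrals. Complex differentiability comes without
    continuity of the derivative, while deforming a contour under the integral sign requires it.
    Hence Goursat's theorem comes before primitives, and Cauchy's formula is proved for a primitive
    of [f] before it is proved for [f]. Integrals are bounded through their real and imaginary
    parts, which costs factors 2; only orders of magnitude matter in the end. *)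

(** * Limits and derivatives of complex functions *)

Definition clim {T : Type} (F : (T -> Prop) -> Prop) (g : T -> C) (l : C) : Prop :=
  forall e : R, 0 < e -> F (fun x => Cmod (g x - l)%C < e).

(** The limit laws are stated for an arbitrary filter because they serve three kinds of limits: in
    the plane (this filter), along a real parameter ([locally t]), and jointly in two real
    parameters ([locally (u, t)]). *)
Definition cnbhd (z : C) (P : C -> Prop) : Prop :=
  exists d : R, 0 < d /\ forall w : C, Cmod (w - z)%C < d -> P w.

#[global] Instance cnbhd_filter (z : C) : Filter (cnbhd z).
Proof.
  constructor.
  - exists 1. split; [lra | auto].
  - intros P Q (d1 & H1 & HP) (d2 & H2 & HQ).
    exists (Rmin d1 d2). split; [apply Rmin_pos; lra|].
    intros w Hw. pose proof (Rmin_l d1 d2). pose proof (Rmin_r d1 d2).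
    split; [apply HP | apply HQ]; lra.
  - intros P Q HPQ (d & H & HP). exists d. split; auto.
Qed.

Lemma cnbhd_self (z : C) (P : C -> Prop) : cnbhd z P -> P z.
Proof.
  intros (d & Hd & H). apply H.
  replace (z - z)%C with (RtoC 0) by ring. rewrite Cmod_0; lra.
Qed.

Lemma cnbhd_lt (z : C) (R : R) : Cmod z < R -> cnbhd z (fun w => Cmod w < R).
Proof.
  intros H. exists (R - Cmod z). split; [lra|]. intros w Hw.
  replace w with ((w - z) + z)%C by ring.
  eapply Rle_lt_trans; [apply Cmod_triangle | lra].
Qed.

Section Limits.
Context {T : Type} (F : (T -> Prop) -> Prop) {FF : Filter F}.

Lemma clim_ext_loc (g h : T -> C) (l : C) :
  F (fun x => g x = h x) -> clim F g l -> clim F h l.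
Proof.
  intros E H e He. generalize (filter_and (F := F) _ _ E (H e He)).
  apply filter_imp. intros x [E1 E2]. now rewrite <- E1.
Qed.

Lemma clim_ext (g h : T -> C) (l : C) :
  (forall x, g x = h x) -> clim F g l -> clim F h l.
Proof. intros E. apply clim_ext_loc. now apply filter_forall. Qed.

Lemma clim_const (c : C) : clim F (fun _ => c) c.
Proof.
  intros e He. apply filter_forall. intros _.
  replace (c - c)%C with (RtoC 0) by ring. now rewrite Cmod_0.
Qed.

Lemma clim_plus (g h : T -> C) (l m : C) :
  clim F g l -> clim F h m -> clim F (fun x => (g x + h x)%C) (l + m)%C.
Proof.
  intros Hg Hh e He.
  generalize (filter_and (F := F) _ _ (Hg (e/2) ltac:(lra)) (Hh (e/2) ltac:(lra))).
  apply filter_imp. intros x [H1 H2].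
  replace (g x + h x - (l + m))%C with ((g x - l) + (h x - m))%C by ring.
  eapply Rle_lt_trans; [apply Cmod_triangle | lra].
Qed.

Lemma clim_opp (g : T -> C) (l : C) :
  clim F g l -> clim F (fun x => (- g x)%C) (- l)%C.
Proof.
  intros Hg e He. generalize (Hg e He). apply filter_imp. intros x H.
  replace (- g x - - l)%C with (- (g x - l))%C by ring. now rewrite Cmod_opp.
Qed.

Lemma clim_minus (g h : T -> C) (l m : C) :
  clim F g l -> clim F h m -> clim F (fun x => (g x - h x)%C) (l - m)%C.
Proof. intros Hg Hh. apply clim_plus; [assumption | now apply clim_opp]. Qed.

Lemma clim_mult (g h : T -> C) (l m : C) :
  clim F g l -> clim F h m -> clim F (fun x => (g x * h x)%C) (l * m)%C.
Proof.
  intros Hg Hh e He.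
  pose proof (Cmod_ge_0 l). pose proof (Cmod_ge_0 m).
  set (e' := Rmin 1 (e / (1 + Cmod l + Cmod m))).
  assert (P : 0 < e / (1 + Cmod l + Cmod m)) by (apply Rdiv_lt_0_compat; lra).
  assert (He' : 0 < e') by (apply Rmin_pos; lra).
  assert (E1 : e' <= 1) by apply Rmin_l.
  assert (E2 : e' * (1 + Cmod l + Cmod m) <= e).
  { replace e with (e / (1 + Cmod l + Cmod m) * (1 + Cmod l + Cmod m)) by (field; lra).
    apply Rmult_le_compat_r; [lra | apply Rmin_r]. }
  generalize (filter_and (F := F) _ _ (Hg e' He') (Hh e' He')).
  apply filter_imp. intros x [H1 H2].
  replace (g x * h x - l * m)%C
    with ((g x - l) * (h x - m) + ((g x - l) * m + l * (h x - m)))%C by ring.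
  eapply Rle_lt_trans; [apply Cmod_triangle |].
  eapply Rle_lt_trans; [apply Rplus_le_compat_l, Cmod_triangle |].
  rewrite !Cmod_mult.
  pose proof (Cmod_ge_0 (g x - l)). pose proof (Cmod_ge_0 (h x - m)).
  assert (Cmod (g x - l) * Cmod (h x - m) < e' * 1).
  { destruct (Req_dec (Cmod (h x - m)) 0) as [Z|Z]; [rewrite Z; lra|].
    apply Rmult_le_0_lt_compat; lra. }
  assert (Cmod (g x - l) * Cmod m <= e' * Cmod m) by (apply Rmult_le_compat_r; lra).
  assert (Cmod l * Cmod (h x - m) <= Cmod l * e') by (apply Rmult_le_compat_l; lra).
  lra.
Qed.

Lemma clim_inv (g : T -> C) (l : C) :
  l <> 0%C -> clim F g l -> clim F (fun x => (/ g x)%C) (/ l)%C.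
Proof.
  intros Hl Hg e He.
  assert (L : 0 < Cmod l) by now apply Cmod_gt_0.
  set (e' := Rmin (Cmod l / 2) (e * (Cmod l * Cmod l) / 2)).
  assert (P : 0 < e * (Cmod l * Cmod l) / 2).
  { apply Rdiv_lt_0_compat; [|lra]. repeat apply Rmult_lt_0_compat; lra. }
  assert (He' : 0 < e') by (apply Rmin_pos; lra).
  pose proof (Rmin_l (Cmod l / 2) (e * (Cmod l * Cmod l) / 2)) as M1.
  pose proof (Rmin_r (Cmod l / 2) (e * (Cmod l * Cmod l) / 2)) as M2.
  fold e' in M1, M2.
  generalize (Hg e' He'). apply filter_imp. intros x Hx.
  assert (G : Cmod l / 2 < Cmod (g x)).
  { assert (Cmod l <= Cmod (l - g x) + Cmod (g x)).
    { pose proof (Cmod_triangle (l - g x) (g x)) as Q. now replace (l - g x + g x)%C with l in Q by ring. }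
    replace (l - g x)%C with (- (g x - l))%C in H by ring. rewrite Cmod_opp in H. lra. }
  assert (G0 : g x <> 0%C) by (apply Cmod_gt_0; lra).
  replace (/ g x - / l)%C with (- ((g x - l) / (g x * l)))%C by (field; auto).
  rewrite Cmod_opp, Cmod_div, Cmod_mult by (apply Cmult_neq_0; auto).
  apply (Rmult_lt_reg_r (Cmod (g x) * Cmod l)); [apply Rmult_lt_0_compat; lra|].
  unfold Rdiv. rewrite Rmult_assoc, Rinv_l by (apply Rgt_not_eq, Rmult_lt_0_compat; lra).
  assert (e * (Cmod l / 2 * Cmod l) < e * (Cmod (g x) * Cmod l)).
  { apply Rmult_lt_compat_l; auto using Rmult_lt_compat_r. }
  lra.
Qed.

Lemma clim_comp (f : C -> C) (g : T -> C) (l m : C) :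
  clim (cnbhd l) f m -> clim F g l -> clim F (fun x => f (g x)) m.
Proof.
  intros Hf Hg e He. destruct (Hf e He) as (d & Hd & H).
  generalize (Hg d Hd). apply filter_imp. auto.
Qed.

End Limits.

Lemma clim_cnbhd_id (z : C) : clim (cnbhd z) (fun w => w) z.
Proof. intros e He. exists e. auto. Qed.

Definition ccont (f : C -> C) (z : C) : Prop := clim (cnbhd z) f (f z).

(* Carathéodory's form of the derivative: limit laws for the slope [s] yield all the rules. *)
Definition cderiv (f : C -> C) (z d : C) : Prop :=
  exists s : C -> C, (forall w, f w = f z + s w * (w - z))%C /\ clim (cnbhd z) s d.

Lemma cderiv_eps (f : C -> C) (z d : C) :
  cderiv f z d <-> forall e, 0 < e -> exists del, 0 < del /\ forall w, Cmod (w - z)%C < del ->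
    Cmod (f w - f z - d * (w - z))%C <= e * Cmod (w - z)%C.
Proof.
  split.
  - intros (s & Hs & L) e He. destruct (L e He) as (del & Hd & H).
    exists del. split; auto. intros w Hw. rewrite Hs.
    replace (f z + s w * (w - z) - f z - d * (w - z))%C with ((s w - d) * (w - z))%C by ring.
    rewrite Cmod_mult. apply Rmult_le_compat_r; [apply Cmod_ge_0|]. left; auto.
  - intros H.
    assert (Dec : forall w, {w = z} + {w <> z}) by (intros; apply excluded_middle_informative).
    exists (fun w => if Dec w then d else ((f w - f z) / (w - z))%C). split.
    + intros w. destruct (Dec w) as [->|N]; [ring|]. field.
      intro E. apply N. replace w with (w - z + z)%C by ring. rewrite E. ring.
    + intros e He. destruct (H (e/2) ltac:(lra)) as (del & Hd & Hw).
      exists del. split; auto. intros w Hw'. destruct (Dec w) as [->|N].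
      * replace (d - d)%C with (RtoC 0) by ring. rewrite Cmod_0; lra.
      * assert (N' : (w - z)%C <> 0%C).
        { intro E. apply N. replace w with (w - z + z)%C by ring. rewrite E. ring. }
        assert (P : 0 < Cmod (w - z)) by now apply Cmod_gt_0.
        replace ((f w - f z) / (w - z) - d)%C with ((f w - f z - d * (w - z)) / (w - z))%C by (field; auto).
        rewrite Cmod_div by auto. specialize (Hw w Hw').
        apply (Rmult_lt_reg_r (Cmod (w - z))); auto.
        unfold Rdiv. rewrite Rmult_assoc, Rinv_l by lra.
        assert (e / 2 * Cmod (w - z) < e * Cmod (w - z)) by (apply Rmult_lt_compat_r; lra). lra.
Qed.

(** The bridge to the derivative in the definition of [entire]; the calculus itself is done with
    slopes. *)
Lemma is_derive_cderiv (f : C -> C) (z d : C) :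
  @is_derive C_AbsRing C_NormedModule f z d <-> cderiv f z d.
Proof.
  rewrite cderiv_eps. split.
  - intros [_ H] e He.
    assert (L : is_filter_lim (locally (T := AbsRing_UniformSpace C_AbsRing) z) z) by (intros P HP; exact HP).
    specialize (H z L (mkposreal e He)). destruct H as [del Hd].
    exists del. split; [apply cond_pos|]. intros w Hw.
    specialize (Hd w Hw). cbn in Hd.
    replace (d * (w - z))%C with ((w - z) * d)%C by ring. exact Hd.
  - intros H. split; [apply is_linear_scal_l|].
    intros y Hy. pose proof (@is_filter_lim_locally_unique C_AbsRing (AbsRing_NormedModule C_AbsRing) z y Hy) as E. rewrite <- E. intros e.
    destruct (H e (cond_pos e)) as (del & Hd & Hw).
    exists (mkposreal del Hd). intros w Hb. specialize (Hw w Hb).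
    replace (d * (w - z))%C with ((w - z) * d)%C in Hw by ring. exact Hw.
Qed.

Lemma cderiv_cont (f : C -> C) (z d : C) : cderiv f z d -> ccont f z.
Proof.
  intros (s & Hs & L). unfold ccont.
  assert (E : f z = (f z + d * (z - z))%C) by ring.
  rewrite E. clear E.
  apply clim_ext with (fun w => f z + s w * (w - z))%C; [apply cnbhd_filter | intros w; now rewrite <- Hs|].
  apply clim_plus; [apply cnbhd_filter | apply clim_const; apply cnbhd_filter |].
  apply clim_mult; [apply cnbhd_filter | assumption |].
  apply clim_minus; [apply cnbhd_filter | apply clim_cnbhd_id | apply clim_const; apply cnbhd_filter].
Qed.

Lemma cderiv_const (c z : C) : cderiv (fun _ => c) z 0.
Proof. exists (fun _ => 0%C). split; [intros; ring | apply clim_const, _]. Qed.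

Lemma cderiv_id (z : C) : cderiv (fun w => w) z 1.
Proof. exists (fun _ => 1%C). split; [intros; ring | apply clim_const, _]. Qed.

Lemma cderiv_plus (f g : C -> C) (z a b : C) :
  cderiv f z a -> cderiv g z b -> cderiv (fun w => f w + g w)%C z (a + b)%C.
Proof.
  intros (s & Hs & L) (t & Ht & M). exists (fun w => s w + t w)%C. split.
  - intros w. rewrite (Hs w), (Ht w). ring.
  - now apply clim_plus; [apply cnbhd_filter| |].
Qed.

Lemma cderiv_mult (f g : C -> C) (z a b : C) :
  cderiv f z a -> cderiv g z b -> cderiv (fun w => f w * g w)%C z (a * g z + f z * b)%C.
Proof.
  intros Hf Hg. pose proof (cderiv_cont _ _ _ Hg) as Cg.
  destruct Hf as (s & Hs & L), Hg as (t & Ht & M).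
  exists (fun w => s w * g w + f z * t w)%C. split.
  - intros w. rewrite (Hs w), (Ht w). ring.
  - apply clim_plus; [apply cnbhd_filter| |].
    + now apply clim_mult; [apply cnbhd_filter| |].
    + apply clim_mult; [apply cnbhd_filter| |assumption]. apply clim_const, _.
Qed.

Lemma cderiv_ext_loc (f g : C -> C) (z a : C) :
  cnbhd z (fun w => f w = g w) -> cderiv f z a -> cderiv g z a.
Proof.
  rewrite !cderiv_eps. intros E H e He.
  pose proof (cnbhd_self _ _ E) as E0.
  destruct E as (d1 & Hd1 & E), (H e He) as (d2 & Hd2 & Hw).
  exists (Rmin d1 d2). split; [apply Rmin_pos; lra|]. intros w Hm.
  pose proof (Rmin_l d1 d2). pose proof (Rmin_r d1 d2).
  rewrite <- E0, <- E by lra. apply Hw; lra.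
Qed.

Lemma cderiv_ext (f g : C -> C) (z a : C) :
  (forall w, f w = g w) -> cderiv f z a -> cderiv g z a.
Proof. intros E. apply cderiv_ext_loc. now apply filter_forall. Qed.

Lemma cderiv_scal (c : C) (f : C -> C) (z a : C) :
  cderiv f z a -> cderiv (fun w => c * f w)%C z (c * a)%C.
Proof.
  intros H. replace (c * a)%C with (0 * f z + c * a)%C by ring.
  apply (cderiv_mult (fun _ => c)); [apply cderiv_const | assumption].
Qed.

Lemma cderiv_opp (f : C -> C) (z a : C) :
  cderiv f z a -> cderiv (fun w => - f w)%C z (- a)%C.
Proof.
  intros H. replace (- a)%C with (- (1) * a)%C by ring.
  apply cderiv_ext with (fun w => - (1) * f w)%C; [intros; ring|]. now apply cderiv_scal.
Qed.

Lemma cderiv_minus (f g : C -> C) (z a b : C) :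
  cderiv f z a -> cderiv g z b -> cderiv (fun w => f w - g w)%C z (a - b)%C.
Proof. intros. apply cderiv_plus; [assumption | now apply cderiv_opp]. Qed.

Lemma cderiv_inv (f : C -> C) (z a : C) :
  f z <> 0%C -> cderiv f z a -> cderiv (fun w => / f w)%C z (- a / (f z * f z))%C.
Proof.
  intros N Hf. pose proof (cderiv_cont _ _ _ Hf) as Cf.
  assert (NZ : cnbhd z (fun w => f w <> 0%C)).
  { generalize (Cf (Cmod (f z)) (proj1 (Cmod_gt_0 _) N)). apply filter_imp.
    intros w Hw E. rewrite E in Hw. replace (0 - f z)%C with (- f z)%C in Hw by ring.
    rewrite Cmod_opp in Hw. lra. }
  destruct Hf as (s & Hs & L).
  assert (Dec : forall w, {f w = 0%C} + {f w <> 0%C}) by (intros; apply excluded_middle_informative).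
  (* The slope identity is required at every [w]. So [/ f] is changed at the zeros of [f], which
     stay away from [z], to the value that makes the identity hold there. *)
  apply cderiv_ext_loc with (fun w => if Dec w then (/ f z - s w / (f z * f z) * (w - z))%C else (/ f w)%C).
  { revert NZ. apply filter_imp. intros w Hw. now destruct (Dec w). }
  exists (fun w => if Dec w then (- s w / (f z * f z))%C else (- s w / (f w * f z))%C). split.
  - intros w. destruct (Dec z) as [E|_]; [contradiction|].
    destruct (Dec w) as [E|E].
    + field; auto.
    + replace (- s w / (f w * f z) * (w - z))%C with (- (s w * (w - z)) / (f w * f z))%C by (field; auto).
      replace (s w * (w - z))%C with (f w - f z)%C by (rewrite (Hs w); ring). field; auto.
  - apply clim_ext_loc with (fun w => - s w * / (f w * f z))%C; [apply cnbhd_filter| |].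
    { revert NZ. apply filter_imp. intros w Hw. now destruct (Dec w). }
    apply clim_mult; [apply cnbhd_filter| now apply clim_opp; [apply cnbhd_filter|] |].
    apply clim_inv; [apply cnbhd_filter| now apply Cmult_neq_0 |].
    apply clim_mult; [apply cnbhd_filter| assumption | apply clim_const, _].
Qed.

Lemma cderiv_unique (f : C -> C) (z a b : C) : cderiv f z a -> cderiv f z b -> a = b.
Proof.
  intros Ha Hb. apply is_derive_cderiv in Ha, Hb.
  apply is_C_derive_unique in Ha, Hb. congruence.
Qed.

(** * Coordinates, paths, and integrals of complex-valued functions over real intervals *)

Lemma Cmod_le_abs (z : C) : Cmod z <= Rabs (fst z) + Rabs (snd z).
Proof.
  replace z with (RtoC (fst z) + Ci * RtoC (snd z))%C
    by (destruct z; apply injective_projections; cbn; ring).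
  eapply Rle_trans; [apply Cmod_triangle|].
  rewrite Cmod_mult, Cmod_Ci, !Cmod_R. cbn.
  replace (fst z + (0 * snd z - 1 * 0)) with (fst z) by ring.
  replace (0 + (0 * 0 + 1 * snd z)) with (snd z) by ring. lra.
Qed.

Lemma fst_le_Cmod (z : C) : Rabs (fst z) <= Cmod z.
Proof. eapply Rle_trans; [apply Rmax_l | apply Rmax_Cmod]. Qed.

Lemma snd_le_Cmod (z : C) : Rabs (snd z) <= Cmod z.
Proof. eapply Rle_trans; [apply Rmax_r | apply Rmax_Cmod]. Qed.

Lemma clim_pair {T : Type} (F : (T -> Prop) -> Prop) {FF : Filter F} (x y : T -> R) (a b : R) :
  filterlim x F (locally a) -> filterlim y F (locally b) -> clim F (fun t => (x t, y t)) (a, b).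
Proof.
  intros Hx Hy e He.
  assert (E2 : 0 < e / 2) by lra.
  generalize (filter_and (F := F) _ _ (Hx _ (locally_ball a (mkposreal _ E2)))
    (Hy _ (locally_ball b (mkposreal _ E2)))).
  apply filter_imp. intros t [H1 H2].
  eapply Rle_lt_trans; [apply Cmod_le_abs|].
  change (Rabs (x t - a) < e / 2) in H1. change (Rabs (y t - b) < e / 2) in H2.
  cbn. change (Rabs (x t - a) + Rabs (y t - b) < e). lra.
Qed.

Lemma clim_fst {T : Type} (F : (T -> Prop) -> Prop) {FF : Filter F} (g : T -> C) (l : C) :
  clim F g l -> filterlim (fun t => fst (g t)) F (locally (fst l)).
Proof.
  intros H P [e HP]. change (F (fun t => P (fst (g t)))).
  generalize (H e (cond_pos e)). apply filter_imp.
  intros t Ht. apply HP. change (Rabs (fst (g t) - fst l) < e).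
  eapply Rle_lt_trans; [apply (fst_le_Cmod (g t - l)%C) | exact Ht].
Qed.

Lemma clim_snd {T : Type} (F : (T -> Prop) -> Prop) {FF : Filter F} (g : T -> C) (l : C) :
  clim F g l -> filterlim (fun t => snd (g t)) F (locally (snd l)).
Proof.
  intros H P [e HP]. change (F (fun t => P (snd (g t)))).
  generalize (H e (cond_pos e)). apply filter_imp.
  intros t Ht. apply HP. change (Rabs (snd (g t) - snd l) < e).
  eapply Rle_lt_trans; [apply (snd_le_Cmod (g t - l)%C) | exact Ht].
Qed.

Definition rcont (g : R -> C) (t : R) : Prop := clim (locally t) g (g t).

Definition rderiv (g : R -> C) (t : R) (v : C) : Prop :=
  exists s : R -> C, (forall u, g u = g t + s u * RtoC (u - t))%C /\ clim (locally t) s v.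

Lemma rcont_id (t : R) : rcont (fun u => RtoC u) t.
Proof. apply (clim_pair _ (fun u => u) (fun _ => 0)); [apply filterlim_id | apply filterlim_const]. Qed.

Lemma rderiv_eps (g : R -> C) (t : R) (v : C) :
  (forall e, 0 < e -> locally t (fun u => Cmod (g u - g t - v * RtoC (u - t))%C <= e * Rabs (u - t))) ->
  rderiv g t v.
Proof.
  intros H.
  exists (fun u => if Req_EM_T u t then v else ((g u - g t) / RtoC (u - t))%C). split.
  - intros u. destruct (Req_EM_T u t) as [->|N].
    + rewrite Rminus_diag. ring.
    + field. intro E. apply RtoC_inj in E. lra.
  - intros e He. generalize (H (e/2) ltac:(lra)). apply filter_imp. intros u Hu.
    destruct (Req_EM_T u t) as [->|N].
    + replace (v - v)%C with (RtoC 0) by ring. now rewrite Cmod_0.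
    + assert (N' : RtoC (u - t) <> 0%C) by (intro E; apply RtoC_inj in E; lra).
      replace ((g u - g t) / RtoC (u - t) - v)%C
        with ((g u - g t - v * RtoC (u - t)) / RtoC (u - t))%C by (field; auto).
      rewrite Cmod_div, Cmod_R by auto.
      assert (P : 0 < Rabs (u - t)) by (apply Rabs_pos_lt; lra).
      apply (Rmult_lt_reg_r (Rabs (u - t))); auto.
      unfold Rdiv. rewrite Rmult_assoc, Rinv_l by lra.
      assert (e / 2 * Rabs (u - t) < e * Rabs (u - t)) by (apply Rmult_lt_compat_r; lra). lra.
Qed.

Lemma is_derive_R_eps (x : R -> R) (t a : R) :
  is_derive x t a <->
  forall e, 0 < e -> locally t (fun u => Rabs (x u - x t - a * (u - t)) <= e * Rabs (u - t)).
Proof.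
  split.
  - intros [_ H] e He.
    assert (L : is_filter_lim (locally t) t) by (intros P HP; exact HP).
    generalize (H t L (mkposreal e He)). apply filter_imp. intros u Hu.
    change (Rabs (x u - x t - (u - t) * a) <= e * Rabs (u - t)) in Hu.
    now rewrite (Rmult_comm a).
  - intros H. split; [apply is_linear_scal_l|].
    intros y Hy. pose proof (@is_filter_lim_locally_unique R_AbsRing R_NormedModule t y Hy) as E.
    rewrite <- E. intros e. generalize (H e (cond_pos e)). apply filter_imp. intros u Hu.
    change (Rabs (x u - x t - (u - t) * a) <= e * Rabs (u - t)).
    now rewrite (Rmult_comm _ a).
Qed.

Lemma rderiv_pair (x y : R -> R) (t a b : R) :
  is_derive x t a -> is_derive y t b -> rderiv (fun u => (x u, y u)) t (a, b).
Proof.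
  rewrite !is_derive_R_eps. intros Hx Hy. apply rderiv_eps. intros e He.
  generalize (filter_and (F := locally t) _ _ (Hx (e/2) ltac:(lra)) (Hy (e/2) ltac:(lra))).
  apply filter_imp. intros u [H1 H2].
  eapply Rle_trans; [apply Cmod_le_abs|]. cbn.
  replace (x u + - x t + - (a * (u - t) - b * 0)) with (x u - x t - a * (u - t)) by ring.
  replace (y u + - y t + - (a * 0 + b * (u - t))) with (y u - y t - b * (u - t)) by ring.
  lra.
Qed.

Lemma rderiv_fst_snd (g : R -> C) (t : R) (v : C) :
  rderiv g t v -> is_derive (fun u => fst (g u)) t (fst v) /\ is_derive (fun u => snd (g u)) t (snd v).
Proof.
  intros (s & Hs & L). rewrite !is_derive_R_eps.
  assert (E : forall e u, Cmod (s u - v)%C < e ->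
    Cmod (g u - g t - v * RtoC (u - t))%C <= e * Rabs (u - t)).
  { intros e u Hu. rewrite Hs.
    replace (g t + s u * RtoC (u - t) - g t - v * RtoC (u - t))%C with ((s u - v) * RtoC (u - t))%C by ring.
    rewrite Cmod_mult, Cmod_R. apply Rmult_le_compat_r; [apply Rabs_pos | lra]. }
  split; intros e He; generalize (L e He); apply filter_imp; intros u Hu; apply E in Hu;
    (eapply Rle_trans; [|exact Hu]).
  - eapply Rle_trans; [|apply fst_le_Cmod]. cbn. apply Req_le. f_equal. ring.
  - eapply Rle_trans; [|apply snd_le_Cmod]. cbn. apply Req_le. f_equal. ring.
Qed.

Lemma rderiv_cont (g : R -> C) (t : R) (v : C) : rderiv g t v -> rcont g t.
Proof.
  intros (s & Hs & L). unfold rcont.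
  assert (E : g t = (g t + v * (RtoC t - RtoC t))%C) by ring.
  rewrite E. clear E.
  apply clim_ext with (fun u => g t + s u * (RtoC u - RtoC t))%C;
    [apply locally_filter | intros u; now rewrite <- RtoC_minus, <- Hs|].
  apply clim_plus; [apply locally_filter | apply clim_const; apply locally_filter |].
  apply clim_mult; [apply locally_filter | assumption |].
  apply clim_minus; [apply locally_filter | apply rcont_id | apply clim_const; apply locally_filter].
Qed.

Lemma rderiv_affine (z v : C) (t : R) : rderiv (fun u => z + RtoC u * v)%C t v.
Proof.
  exists (fun _ => v). split; [|apply clim_const; apply locally_filter].
  intros u. rewrite RtoC_minus. ring.
Qed.

Lemma rderiv_comp (f : C -> C) (g : R -> C) (t : R) (d v : C) :
  cderiv f (g t) d -> rderiv g t v -> rderiv (fun u => f (g u)) t (d * v)%C.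
Proof.
  intros (s & Hs & L) Hg. pose proof (rderiv_cont _ _ _ Hg) as Cg.
  destruct Hg as (r & Hr & M).
  exists (fun u => s (g u) * r u)%C. split.
  - intros u. rewrite (Hs (g u)). replace (g u - g t)%C with (r u * RtoC (u - t))%C; [ring|].
    rewrite (Hr u). ring.
  - apply clim_mult; [apply locally_filter | | assumption].
    eapply clim_comp; [apply locally_filter | exact L | exact Cg].
Qed.

Lemma rderiv_ext (g h : R -> C) (t : R) (v : C) :
  (forall u, g u = h u) -> rderiv g t v -> rderiv h t v.
Proof. intros E (s & Hs & L). exists s. split; [|assumption]. intros u. rewrite <- !E. apply Hs. Qed.

Lemma rcont_comp (f : C -> C) (g : R -> C) (t : R) :
  ccont f (g t) -> rcont g t -> rcont (fun u => f (g u)) t.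
Proof. intros Hf Hg. eapply clim_comp; [apply locally_filter | exact Hf | exact Hg]. Qed.

(** Integrating by coordinates gives access to the real theorems on [RInt], among them the bounds by
    absolute values and differentiation under the integral sign. *)
Definition CI (f : R -> C) (a b : R) : C :=
  (RInt (fun t => fst (f t)) a b, RInt (fun t => snd (f t)) a b).

Definition exCI (f : R -> C) (a b : R) : Prop :=
  ex_RInt (fun t => fst (f t)) a b /\ ex_RInt (fun t => snd (f t)) a b.

Lemma exCI_cont (f : R -> C) (a b : R) :
  (forall t, Rmin a b <= t <= Rmax a b -> rcont f t) -> exCI f a b.
Proof.
  intros H. split; apply (ex_RInt_continuous (V := R_CompleteNormedModule)); intros t Ht; specialize (H t Ht).
  - exact (clim_fst _ _ _ H).
  - exact (clim_snd _ _ _ H).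
Qed.

Lemma CI_ext (f g : R -> C) (a b : R) :
  (forall t, Rmin a b < t < Rmax a b -> f t = g t) -> CI f a b = CI g a b.
Proof. intros H. unfold CI. f_equal; apply RInt_ext; intros t Ht; now rewrite H. Qed.

Lemma CI_Chasles (f : R -> C) (a b c : R) :
  exCI f a b -> exCI f b c -> (CI f a b + CI f b c)%C = CI f a c.
Proof.
  intros [H1 H2] [H3 H4]. unfold CI. apply injective_projections; cbn.
  - exact (RInt_Chasles _ _ _ _ H1 H3).
  - exact (RInt_Chasles _ _ _ _ H2 H4).
Qed.

Lemma CI_point (f : R -> C) (a : R) : CI f a a = 0%C.
Proof. unfold CI. now rewrite !RInt_point. Qed.

Lemma exCI_swap (f : R -> C) (a b : R) : exCI f a b -> exCI f b a.
Proof. intros [H1 H2]. split; now apply ex_RInt_swap. Qed.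

Lemma CI_swap (f : R -> C) (a b : R) : exCI f a b -> CI f b a = (- CI f a b)%C.
Proof.
  intros H. pose proof (CI_Chasles f a b a H (exCI_swap _ _ _ H)) as E. rewrite CI_point in E.
  replace (CI f b a) with ((CI f a b + CI f b a) - CI f a b)%C by ring. rewrite E. ring.
Qed.

Lemma exCI_plus (f g : R -> C) (a b : R) :
  exCI f a b -> exCI g a b -> exCI (fun t => f t + g t)%C a b.
Proof. intros [H1 H2] [H3 H4]. split; cbn; now apply (@ex_RInt_plus R_NormedModule). Qed.

Lemma CI_plus (f g : R -> C) (a b : R) :
  exCI f a b -> exCI g a b -> CI (fun t => f t + g t)%C a b = (CI f a b + CI g a b)%C.
Proof.
  intros [H1 H2] [H3 H4]. unfold CI. apply injective_projections; cbn; now apply (@RInt_plus R_CompleteNormedModule).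
Qed.

Lemma exCI_scal (c : C) (f : R -> C) (a b : R) :
  exCI f a b -> exCI (fun t => c * f t)%C a b.
Proof.
  intros [H1 H2]. split; cbn.
  - apply (@ex_RInt_minus R_NormedModule); now apply (@ex_RInt_scal R_NormedModule).
  - apply (@ex_RInt_plus R_NormedModule); now apply (@ex_RInt_scal R_NormedModule).
Qed.

Lemma CI_scal (c : C) (f : R -> C) (a b : R) :
  exCI f a b -> CI (fun t => c * f t)%C a b = (c * CI f a b)%C.
Proof.
  intros [H1 H2].
  assert (S : forall k g, ex_RInt g a b -> RInt (fun t => k * g t) a b = k * RInt g a b)
    by (intros k g Hg; exact (RInt_scal g a b k Hg)).
  assert (X : forall k g, ex_RInt g a b -> ex_RInt (fun t => k * g t) a b)
    by (intros k g Hg; exact (@ex_RInt_scal R_NormedModule g a b k Hg)).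
  unfold CI. apply injective_projections; cbn; rewrite <- !S by assumption.
  - apply (@RInt_minus R_CompleteNormedModule); now apply X.
  - apply (@RInt_plus R_CompleteNormedModule); now apply X.
Qed.

Lemma CI_minus (f g : R -> C) (a b : R) :
  exCI f a b -> exCI g a b -> CI (fun t => f t - g t)%C a b = (CI f a b - CI g a b)%C.
Proof.
  intros Hf Hg. replace (CI f a b - CI g a b)%C with (CI f a b + (- (1)) * CI g a b)%C by ring.
  rewrite <- CI_scal, <- CI_plus; auto using exCI_scal.
  apply CI_ext. intros. ring.
Qed.

(** The factor 2 arises from bounding the real and the imaginary part separately. *)
Lemma CI_bound (f : R -> C) (a b M : R) :
  exCI f a b -> (forall t, Rmin a b <= t <= Rmax a b -> Cmod (f t) <= M) ->
  Cmod (CI f a b) <= 2 * M * Rabs (b - a).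
Proof.
  assert (W : forall a b, a <= b -> exCI f a b ->
    (forall t, Rmin a b <= t <= Rmax a b -> Cmod (f t) <= M) ->
    Cmod (CI f a b) <= 2 * M * Rabs (b - a)).
  { clear a b. intros a b Hab [H1 H2] HM.
    rewrite Rmin_left, Rmax_right in HM by lra. rewrite (Rabs_pos_eq (b - a)) by lra.
    eapply Rle_trans; [apply Cmod_le_abs|]. cbn.
    pose proof (abs_RInt_le_const _ a b M Hab H1
      (fun t Ht => Rle_trans _ _ _ (fst_le_Cmod (f t)) (HM t Ht))).
    pose proof (abs_RInt_le_const _ a b M Hab H2
      (fun t Ht => Rle_trans _ _ _ (snd_le_Cmod (f t)) (HM t Ht))). lra. }
  intros H HM. destruct (Rle_dec a b) as [L|L]; [now apply W|].
  rewrite (CI_swap f b a), Cmod_opp by now apply exCI_swap.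
  rewrite Rabs_minus_sym. apply W; [lra | now apply exCI_swap |].
  intros t. rewrite Rmin_comm, Rmax_comm. apply HM.
Qed.

Lemma CI_const (c : C) (a b : R) : CI (fun _ => c) a b = (RtoC (b - a) * c)%C.
Proof.
  unfold CI. rewrite !RInt_const. apply injective_projections; cbn; unfold scal; cbn; unfold mult; cbn; ring.
Qed.

Lemma fst_CI (f : R -> C) (a b : R) : fst (CI f a b) = RInt (fun t => fst (f t)) a b.
Proof. reflexivity. Qed.

Lemma snd_CI (f : R -> C) (a b : R) : snd (CI f a b) = RInt (fun t => snd (f t)) a b.
Proof. reflexivity. Qed.

Lemma exCI_conj (f : R -> C) (a b : R) : exCI f a b -> exCI (fun t => Cconj (f t)) a b.
Proof. intros [H1 H2]. split; cbn; [exact H1 | now apply (@ex_RInt_opp R_NormedModule)]. Qed.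

Lemma CI_conj (f : R -> C) (a b : R) :
  exCI f a b -> CI (fun t => Cconj (f t)) a b = Cconj (CI f a b).
Proof.
  intros [H1 H2]. apply injective_projections; cbn; [reflexivity|].
  exact (@RInt_opp R_CompleteNormedModule (fun t => snd (f t)) a b H2).
Qed.

Lemma CI_norm_le (f : R -> C) (u : R -> R) (a b : R) : a <= b ->
  exCI f a b -> ex_RInt u a b -> (forall t, Cmod (f t) <= u t) ->
  Cmod (CI f a b) <= 2 * RInt u a b.
Proof.
  intros Hab [E1 E2] Hu B.
  eapply Rle_trans; [apply Cmod_le_abs|]. rewrite fst_CI, snd_CI.
  assert (G : forall p : R -> R, ex_RInt p a b -> (forall t, Rabs (p t) <= u t) -> Rabs (RInt p a b) <= RInt u a b).
  { intros p Hp Bp. eapply Rle_trans; [now apply abs_RInt_le|].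
    apply RInt_le; auto. now apply ex_RInt_norm. }
  pose proof (G _ E1 (fun t => Rle_trans _ _ _ (fst_le_Cmod (f t)) (B t))).
  pose proof (G _ E2 (fun t => Rle_trans _ _ _ (snd_le_Cmod (f t)) (B t))). lra.
Qed.

Lemma CI_deriv (g g' : R -> C) (a b : R) :
  (forall t, Rmin a b <= t <= Rmax a b -> rderiv g t (g' t)) ->
  (forall t, Rmin a b <= t <= Rmax a b -> rcont g' t) ->
  CI g' a b = (g b - g a)%C.
Proof.
  intros H Hc. unfold CI. apply injective_projections; cbn; apply is_RInt_unique.
  - apply (is_RInt_derive (fun t => fst (g t))).
    + intros t Ht. now apply rderiv_fst_snd, H.
    + intros t Ht. exact (clim_fst _ _ _ (Hc t Ht)).
  - apply (is_RInt_derive (fun t => snd (g t))).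
    + intros t Ht. now apply rderiv_fst_snd, H.
    + intros t Ht. exact (clim_snd _ _ _ (Hc t Ht)).
Qed.

(* Unification is prone to unfold these integrals down to the completeness of R. *)
Opaque CI exCI.

(** * Goursat's theorem on rectangles *)

Lemma rderiv_horizontal (y t : R) : rderiv (fun u => (u, y)) t 1.
Proof.
  apply rderiv_ext with (fun u => (0, y) + RtoC u * 1)%C; [|apply rderiv_affine].
  intros u. apply injective_projections; cbn; ring.
Qed.

Lemma rderiv_vertical (x t : R) : rderiv (fun u => (x, u)) t Ci.
Proof.
  apply rderiv_ext with (fun u => (x, 0) + RtoC u * Ci)%C; [|apply rderiv_affine].
  intros u. apply injective_projections; cbn; ring.
Qed.

(** The contour integral of [f] over the boundary, counterclockwise when the endpoints are ordered;
    on vertical sides [dz] is [Ci dt]. The order of the endpoints is left free because the primitive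
    below needs rectangles in all four quadrants. *)
Definition rect_integral (f : C -> C) (x1 x2 y1 y2 : R) : C :=
  (CI (fun t => f (t, y1)) x1 x2 + Ci * CI (fun t => f (x2, t)) y1 y2
   - CI (fun t => f (t, y2)) x1 x2 - Ci * CI (fun t => f (x1, t)) y1 y2)%C.

Definition in_rect (x1 x2 y1 y2 : R) (z : C) : Prop :=
  Rmin x1 x2 <= fst z <= Rmax x1 x2 /\ Rmin y1 y2 <= snd z <= Rmax y1 y2.

Lemma exCI_hor (f : C -> C) (x1 x2 y : R) :
  (forall t, Rmin x1 x2 <= t <= Rmax x1 x2 -> ccont f (t, y)) -> exCI (fun t => f (t, y)) x1 x2.
Proof.
  intros H. apply exCI_cont. intros t Ht. apply (rcont_comp f (fun t => (t, y))); auto.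
  eapply rderiv_cont, rderiv_horizontal.
Qed.

Lemma exCI_ver (f : C -> C) (x y1 y2 : R) :
  (forall t, Rmin y1 y2 <= t <= Rmax y1 y2 -> ccont f (x, t)) -> exCI (fun t => f (x, t)) y1 y2.
Proof.
  intros H. apply exCI_cont. intros t Ht. apply (rcont_comp f (fun t => (x, t))); auto.
  eapply rderiv_cont, rderiv_vertical.
Qed.

Lemma CI_hor_deriv (F f : C -> C) (x1 x2 y : R) :
  (forall t, Rmin x1 x2 <= t <= Rmax x1 x2 -> cderiv F (t, y) (f (t, y)) /\ ccont f (t, y)) ->
  CI (fun t => f (t, y)) x1 x2 = (F (x2, y) - F (x1, y))%C.
Proof.
  intros H. apply (CI_deriv (fun t => F (t, y))).
  - intros t Ht. replace (f (t, y)) with (f (t, y) * 1)%C by ring.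
    apply (rderiv_comp F (fun t => (t, y))); [now apply H | apply rderiv_horizontal].
  - intros t Ht. apply (rcont_comp f (fun t => (t, y))); [now apply H|].
    eapply rderiv_cont, rderiv_horizontal.
Qed.

Lemma CI_ver_deriv (F f : C -> C) (x y1 y2 : R) :
  (forall t, Rmin y1 y2 <= t <= Rmax y1 y2 -> cderiv F (x, t) (f (x, t)) /\ ccont f (x, t)) ->
  (Ci * CI (fun t => f (x, t)) y1 y2)%C = (F (x, y2) - F (x, y1))%C.
Proof.
  intros H. rewrite <- CI_scal by (apply exCI_ver; intros; now apply H).
  apply (CI_deriv (fun t => F (x, t))).
  - intros t Ht. replace (Ci * f (x, t))%C with (f (x, t) * Ci)%C by ring.
    apply (rderiv_comp F (fun t => (x, t))); [now apply H | apply rderiv_vertical].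
  - intros t Ht. apply clim_mult; [apply locally_filter | apply clim_const; apply locally_filter|].
    apply (rcont_comp f (fun t => (x, t))); [now apply H|].
    eapply rderiv_cont, rderiv_vertical.
Qed.

Lemma in_rect_corner (x1 x2 y1 y2 : R) (x y : R) :
  (x = x1 \/ x = x2 \/ Rmin x1 x2 <= x <= Rmax x1 x2) ->
  (y = y1 \/ y = y2 \/ Rmin y1 y2 <= y <= Rmax y1 y2) -> in_rect x1 x2 y1 y2 (x, y).
Proof.
  intros Hx Hy. split; cbn; [destruct Hx as [->|[->|Hx]] | destruct Hy as [->|[->|Hy]]]; auto;
    split; auto using Rmin_l, Rmin_r, Rmax_l, Rmax_r.
Qed.

Lemma rect_integral_deriv (F f : C -> C) (x1 x2 y1 y2 : R) :
  (forall z, in_rect x1 x2 y1 y2 z -> cderiv F z (f z) /\ ccont f z) ->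
  rect_integral f x1 x2 y1 y2 = 0%C.
Proof.
  intros H. unfold rect_integral.
  rewrite !(CI_hor_deriv F f), !(CI_ver_deriv F f); [ring| | | |];
    intros; apply H, in_rect_corner; auto.
Qed.

Lemma rect_integral_plus (f g : C -> C) (x1 x2 y1 y2 : R) :
  (forall z, in_rect x1 x2 y1 y2 z -> ccont f z /\ ccont g z) ->
  rect_integral (fun z => f z + g z)%C x1 x2 y1 y2
  = (rect_integral f x1 x2 y1 y2 + rect_integral g x1 x2 y1 y2)%C.
Proof.
  intros H. unfold rect_integral.
  rewrite (CI_plus (fun t => f (t, y1)) (fun t => g (t, y1))), (CI_plus (fun t => f (t, y2)) (fun t => g (t, y2))),
    (CI_plus (fun t => f (x1, t)) (fun t => g (x1, t))), (CI_plus (fun t => f (x2, t)) (fun t => g (x2, t))); [ring|..]; first [apply (exCI_hor f) | apply (exCI_ver f) | apply (exCI_hor g) | apply (exCI_ver g)];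
    intros; apply H, in_rect_corner; auto.
Qed.

Lemma rect_integral_bound (f : C -> C) (x1 x2 y1 y2 M : R) :
  (forall z, in_rect x1 x2 y1 y2 z -> ccont f z /\ Cmod (f z) <= M) ->
  Cmod (rect_integral f x1 x2 y1 y2) <= 4 * M * (Rabs (x2 - x1) + Rabs (y2 - y1)).
Proof.
  intros H. unfold rect_integral, Cminus.
  assert (H1 : forall y, y = y1 \/ y = y2 -> Cmod (CI (fun t => f (t, y)) x1 x2) <= 2 * M * Rabs (x2 - x1)).
  { intros y Hy. apply CI_bound; [apply (exCI_hor f)|]; intros; apply H, in_rect_corner; tauto. }
  assert (H2 : forall x, x = x1 \/ x = x2 -> Cmod (Ci * CI (fun t => f (x, t)) y1 y2)%C <= 2 * M * Rabs (y2 - y1)).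
  { intros x Hx. rewrite Cmod_mult, Cmod_Ci, Rmult_1_l.
    apply CI_bound; [apply (exCI_ver f)|]; intros; apply H, in_rect_corner; tauto. }
  pose proof (H1 y1 ltac:(auto)). pose proof (H1 y2 ltac:(auto)).
  pose proof (H2 x1 ltac:(auto)). pose proof (H2 x2 ltac:(auto)).
  eapply Rle_trans; [apply Cmod_triangle|]. rewrite Cmod_opp.
  eapply Rle_trans; [apply Rplus_le_compat_r, Cmod_triangle|]. rewrite Cmod_opp.
  eapply Rle_trans; [apply Rplus_le_compat_r, Rplus_le_compat_r, Cmod_triangle|]. lra.
Qed.

Lemma rect_integral_split (f : C -> C) (x1 xm x2 y1 ym y2 : R) :
  x1 <= xm <= x2 -> y1 <= ym <= y2 ->
  (forall z, in_rect x1 x2 y1 y2 z -> ccont f z) ->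
  rect_integral f x1 x2 y1 y2 =
  (rect_integral f x1 xm y1 ym + rect_integral f xm x2 y1 ym
   + (rect_integral f x1 xm ym y2 + rect_integral f xm x2 ym y2))%C.
Proof.
  intros Hx Hy H. unfold in_rect in H.
  rewrite Rmin_left, Rmax_right, Rmin_left, Rmax_right in H by lra.
  unfold rect_integral.
  rewrite <- (CI_Chasles (fun t => f (t, y1)) x1 xm x2), <- (CI_Chasles (fun t => f (t, y2)) x1 xm x2),
    <- (CI_Chasles (fun t => f (x1, t)) y1 ym y2), <- (CI_Chasles (fun t => f (x2, t)) y1 ym y2); [ring|..];
    first [apply (exCI_hor f) | apply (exCI_ver f)]; intros t; rewrite Rmin_left, Rmax_right by lra; intros Ht;
    apply H; cbn; lra.
Qed.

(** Goursat's bisection. The integral is the sum of those over the four quarters, so if its modulus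
    exceeds [e] times the squared semi-perimeter, the same holds for some quarter, with the same
    [e]. The bad rectangles shrink to a point, near which [f] is affine up to an error too small for
    that. *)
Lemma goursat_ordered (f : C -> C) (x1 x2 y1 y2 : R) :
  x1 <= x2 -> y1 <= y2 ->
  (forall z, in_rect x1 x2 y1 y2 z -> exists d, cderiv f z d) ->
  rect_integral f x1 x2 y1 y2 = 0%C.
Proof.
  intros Hx Hy D. apply Cmod_eq_0. apply Rle_antisym; [|apply Cmod_ge_0].
  unfold in_rect in D. rewrite Rmin_left, Rmax_right, Rmin_left, Rmax_right in D by lra.
  assert (Cf : forall z, x1 <= fst z <= x2 /\ y1 <= snd z <= y2 -> ccont f z).
  { intros z Hz. destruct (D z Hz) as [d Hd]. eapply cderiv_cont, Hd. }
  set (p := x2 - x1). set (q := y2 - y1).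
  apply Rnot_lt_le. intros Pos.
  (* Any [e] small against the integral will do; the summand 1 in the denominator covers a rectangle
     degenerated to a point. *)
  assert (He : exists e, 0 < e /\ Cmod (rect_integral f x1 x2 y1 y2) > e * (p + q) ^ 2).
  { pose proof (pow2_ge_0 (p + q)).
    exists (Cmod (rect_integral f x1 x2 y1 y2) / (2 * ((p + q) ^ 2 + 1))). split.
    - apply Rdiv_lt_0_compat; lra.
    - set (m := Cmod _) in *. set (s := (p + q) ^ 2) in *.
      apply Rlt_gt, (Rmult_lt_reg_r (2 * (s + 1))); [lra|].
      replace (m / (2 * (s + 1)) * s * (2 * (s + 1))) with (m * s) by (field; lra).
      assert (0 <= m * s) by (apply Rmult_le_pos; lra). nra. }
  destruct He as (e & He & Bad0).
  set (h := fun n : nat => / 2 ^ n).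
  assert (hS : forall n, h (S n) = h n / 2).
  { intros n. unfold h. cbn. field. apply pow_nonzero; lra. }
  assert (hpos : forall n, 0 < h n) by (intros; apply Rinv_0_lt_compat, pow_lt; lra).
  set (sub := fun (n : nat) (c : R * R) => x1 <= fst c /\ fst c + p * h n <= x2 /\ y1 <= snd c /\ snd c + q * h n <= y2).
  set (bad := fun (n : nat) (c : R * R) => sub n c /\
     Cmod (rect_integral f (fst c) (fst c + p * h n) (snd c) (snd c + q * h n)) > e * ((p + q) * h n) ^ 2).
  set (child := fun (n : nat) (c c' : R * R) =>
     fst c <= fst c' /\ fst c' + p * h (S n) <= fst c + p * h n /\
     snd c <= snd c' /\ snd c' + q * h (S n) <= snd c + q * h n).
  (* The hypothesis [bad n c] stands under the existential quantifier, so that the chosen [next] is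
     a total function and the recursion carries no proofs. *)
  assert (step : forall n c, exists c', bad n c -> bad (S n) c' /\ child n c c').
  { intros n [u v]. apply NNPP. intro N.
    assert (B : bad n (u, v)) by (apply NNPP; intro; apply N; exists (u, v); tauto).
    assert (M : forall c', bad (S n) c' -> ~ child n (u, v) c').
    { intros c' H1 H2. apply N. exists c'. auto. }
    destruct B as ((S1 & S2 & S3 & S4) & B). cbn [fst snd] in S1, S2, S3, S4, B.
    pose proof (hpos n). pose proof (hS n).
    assert (0 <= p * h n) by (apply Rmult_le_pos; unfold p; lra).
    assert (0 <= q * h n) by (apply Rmult_le_pos; unfold q; lra).
    assert (P2 : p * h (S n) = p * h n / 2) by (rewrite hS; field).
    assert (Q2 : q * h (S n) = q * h n / 2) by (rewrite hS; field).
    assert (K : forall u' v', (u' = u \/ u' = u + p * h (S n)) -> (v' = v \/ v' = v + q * h (S n)) ->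
       Cmod (rect_integral f u' (u' + p * h (S n)) v' (v' + q * h (S n))) <= e * ((p + q) * h (S n)) ^ 2).
    { intros u' v' Hu Hv. apply Rnot_lt_le. intro L. apply (M (u', v')).
      - split; [|exact L]. unfold sub; cbn. destruct Hu, Hv; subst; repeat split; lra.
      - unfold child; cbn. destruct Hu, Hv; subst; repeat split; lra. }
    rewrite (rect_integral_split f u (u + p * h (S n)) _ v (v + q * h (S n))) in B; try lra.
    2:{ intros [x y] [Hx' Hy']. rewrite Rmin_left, Rmax_right in Hx', Hy' by lra. apply Cf. cbn in *. lra. }
    pose proof (K u v ltac:(auto) ltac:(auto)) as K1.
    pose proof (K (u + p * h (S n)) v ltac:(auto) ltac:(auto)) as K2.
    pose proof (K u (v + q * h (S n)) ltac:(auto) ltac:(auto)) as K3.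
    pose proof (K (u + p * h (S n)) (v + q * h (S n)) ltac:(auto) ltac:(auto)) as K4.
    replace (u + p * h (S n) + p * h (S n)) with (u + p * h n) in * by lra.
    replace (v + q * h (S n) + q * h (S n)) with (v + q * h n) in * by lra.
    set (u' := u + p * h (S n)) in *. set (v' := v + q * h (S n)) in *.
    set (r1 := rect_integral f u u' v v') in *. set (r2 := rect_integral f u' (u + p * h n) v v') in *.
    set (r3 := rect_integral f u u' v' (v + q * h n)) in *. set (r4 := rect_integral f u' (u + p * h n) v' (v + q * h n)) in *.
    pose proof (Cmod_triangle (r1 + r2) (r3 + r4)). pose proof (Cmod_triangle r1 r2).
    pose proof (Cmod_triangle r3 r4).
    replace (e * ((p + q) * h n) ^ 2) with (4 * (e * ((p + q) * h (S n)) ^ 2)) in B by (rewrite hS; field).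
    lra. }
  set (next := fun n c => proj1_sig (constructive_indefinite_description _ (step n c))).
  set (sq := fix sq (n : nat) : R * R := match n with O => (x1, y1) | S n => next n (sq n) end).
  assert (inv : forall n, bad n (sq n) /\ child n (sq n) (sq (S n))).
  { assert (N : forall n, bad n (sq n) -> bad (S n) (sq (S n)) /\ child n (sq n) (sq (S n))).
    { intros n. exact (proj2_sig (constructive_indefinite_description _ (step n (sq n)))). }
    assert (A : forall n, bad n (sq n)).
    { induction n as [|n IH]; [|now apply N]. unfold bad, sub, h; cbn. rewrite Rinv_1, !Rmult_1_r.
      unfold p, q. replace (x1 + (x2 - x1)) with x2 by ring. replace (y1 + (y2 - y1)) with y2 by ring.
      split; [repeat split; lra|]. cbn in Bad0. unfold p, q in Bad0. rewrite Rmult_1_r in Bad0. exact Bad0. }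
    intros n. split; [apply A | now apply N]. }
  assert (mono : forall m n, (m <= n)%nat ->
     fst (sq m) <= fst (sq n) /\ fst (sq n) + p * h n <= fst (sq m) + p * h m /\
     snd (sq m) <= snd (sq n) /\ snd (sq n) + q * h n <= snd (sq m) + q * h m).
  { intros m n. induction 1 as [|n _ IH]; [lra|]. destruct (inv n) as [_ Ch]. unfold child in Ch. lra. }
  assert (pq : 0 <= p /\ 0 <= q) by (unfold p, q; lra).
  assert (ph : forall n, 0 <= p * h n /\ 0 <= q * h n).
  { intros n. pose proof (hpos n). split; apply Rmult_le_pos; lra. }
  assert (cross : forall m n, fst (sq m) <= fst (sq n) + p * h n /\ snd (sq m) <= snd (sq n) + q * h n).
  { intros m n. pose proof (ph m). pose proof (ph n).
    destruct (Nat.le_ge_cases m n) as [L|L]; pose proof (mono _ _ L); lra. }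
  (* The common point of the nested rectangles has the suprema of the lower left corners as
     coordinates. *)
  destruct (completeness (fun x => exists n, x = fst (sq n))) as [u [U1 U2]].
  { exists (fst (sq O) + p * h O). intros x [n ->]. apply cross. }
  { exists (fst (sq O)). now exists O. }
  destruct (completeness (fun x => exists n, x = snd (sq n))) as [v [V1 V2]].
  { exists (snd (sq O) + q * h O). intros x [n ->]. apply cross. }
  { exists (snd (sq O)). now exists O. }
  assert (Lim : forall n, fst (sq n) <= u <= fst (sq n) + p * h n /\ snd (sq n) <= v <= snd (sq n) + q * h n).
  { intros n. repeat split.
    - apply U1. now exists n.
    - apply U2. intros x [m ->]. apply cross.
    - apply V1. now exists n.
    - apply V2. intros x [m ->]. apply cross. }
  assert (Sub : forall n, sub n (sq n)) by (intros n; apply (inv n)).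
  destruct (D (u, v)) as [d Hd].
  { pose proof (Lim O). destruct (Sub O) as (?&?&?&?). cbn. lra. }
  (* The quarter compensates the factor 4 in [rect_integral_bound]. *)
  rewrite cderiv_eps in Hd. destruct (Hd (e / 4) ltac:(lra)) as (del & Hdel & Hw).
  assert (Small : exists n, (p + q) * h n < del).
  { pose proof (is_lim_seq_geom (/2)) as G. rewrite Rabs_pos_eq in G by lra. specialize (G ltac:(lra)).
    assert (0 < del / (p + q + 1)) as P1 by (apply Rdiv_lt_0_compat; lra).
    apply is_lim_seq_spec in G. destruct (G (mkposreal _ P1)) as [N HN]. specialize (HN N (Nat.le_refl N)).
    cbn in HN. exists N. unfold h. rewrite Rminus_0_r, pow_inv in HN.
    pose proof (Rle_abs (/ 2 ^ N)).
    assert (h N * (p + q + 1) < del).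
    { replace del with (del / (p + q + 1) * (p + q + 1)) by (field; lra). apply Rmult_lt_compat_r; [lra|]. unfold h. lra. }
    pose proof (hpos N). unfold h in *. lra. }
  destruct Small as [n Hn].
  destruct (inv n) as [[_ B] _]. specialize (Lim n). specialize (Sub n).
  unfold sub in Sub. destruct (sq n) as [a b]. cbn [fst snd] in *.
  specialize (ph n). pose proof (hpos n).
  set (z := (u, v) : C) in *.
  (* The affine part of [f] at the limit point has a polynomial primitive and integrates to 0; only
     the error term is left. *)
  set (A := fun w : C => (f z + d * (w - z))%C).
  assert (DA : forall w, cderiv A w d).
  { intros w. replace d with (0 + d * (1 - 0))%C by ring.
    apply cderiv_plus; [apply cderiv_const|]. apply cderiv_scal, cderiv_minus; [apply cderiv_id | apply cderiv_const]. }
  assert (CA : forall w, ccont A w) by (intros w; eapply cderiv_cont, DA).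
  assert (DP : forall w, cderiv (fun w => f z * w + d / 2 * ((w - z) * (w - z)))%C w (A w)).
  { intros w. assert (RtoC 2 <> 0)%C by (intro E; apply RtoC_inj in E; lra).
    replace (A w) with (f z * 1 + d / 2 * ((1 - 0) * (w - z) + (w - z) * (1 - 0)))%C by (unfold A; field; auto).
    apply cderiv_plus; [apply cderiv_scal, cderiv_id|]. apply cderiv_scal.
    apply (cderiv_mult (fun w => w - z)%C (fun w => w - z)%C); apply cderiv_minus; apply cderiv_id || apply cderiv_const. }
  assert (In : forall w, in_rect a (a + p * h n) b (b + q * h n) w -> ccont (fun w => f w - A w)%C w /\ Cmod (f w - A w)%C <= e / 4 * ((p + q) * h n)).
  { intros [x y] [I1 I2]. rewrite Rmin_left, Rmax_right in I1, I2 by lra. cbn in I1, I2.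
    split.
    - apply clim_minus; [apply cnbhd_filter | apply Cf; cbn; lra | apply CA].
    - assert (W : Cmod ((x, y) - z)%C <= (p + q) * h n).
      { eapply Rle_trans; [apply Cmod_le_abs|]. cbn.
        assert (Rabs (x + - u) <= p * h n) by (apply Rabs_le; lra).
        assert (Rabs (y + - v) <= q * h n) by (apply Rabs_le; lra). lra. }
      replace (f (x, y) - A (x, y))%C with (f (x, y) - f z - d * ((x, y) - z))%C by (unfold A; ring).
      eapply Rle_trans; [apply Hw; lra|]. apply Rmult_le_compat_l; lra. }
  assert (E : rect_integral f a (a + p * h n) b (b + q * h n) = rect_integral (fun w => f w - A w)%C a (a + p * h n) b (b + q * h n)).
  { transitivity (rect_integral (fun w => A w + (f w - A w))%C a (a + p * h n) b (b + q * h n)).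
    - apply (f_equal (fun g => rect_integral g _ _ _ _)). apply functional_extensionality. intros w. ring.
    - rewrite (rect_integral_plus A (fun w => f w - A w)%C); [|intros w I; split; [apply CA | exact (proj1 (In w I))]].
      rewrite (rect_integral_deriv (fun w => f z * w + d / 2 * ((w - z) * (w - z)))%C A); [ring|].
      intros w _. split; [apply DP | apply CA]. }
  rewrite E in B.
  pose proof (rect_integral_bound (fun w => f w - A w)%C _ _ _ _ _ In) as Bd.
  replace (a + p * h n - a) with (p * h n) in Bd by ring.
  replace (b + q * h n - b) with (q * h n) in Bd by ring.
  rewrite !Rabs_pos_eq in Bd by lra.
  replace (4 * (e / 4 * ((p + q) * h n)) * (p * h n + q * h n)) with (e * ((p + q) * h n) ^ 2) in Bd by field.
  lra.
Qed.

Lemma goursat (f : C -> C) (x1 x2 y1 y2 : R) :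
  (forall z, in_rect x1 x2 y1 y2 z -> exists d, cderiv f z d) ->
  rect_integral f x1 x2 y1 y2 = 0%C.
Proof.
  intros D.
  assert (Cf : forall z, in_rect x1 x2 y1 y2 z -> ccont f z).
  { intros z Hz. destruct (D z Hz) as [d Hd]. eapply cderiv_cont, Hd. }
  assert (Sx : rect_integral f x1 x2 y1 y2 = (- rect_integral f x2 x1 y1 y2)%C).
  { unfold rect_integral.
    rewrite (CI_swap (fun t => f (t, y1)) x1 x2), (CI_swap (fun t => f (t, y2)) x1 x2); [ring| |];
      apply (exCI_hor f); intros; apply Cf, in_rect_corner; auto. }
  assert (Sy : forall a b, in_rect x1 x2 y1 y2 (a, y1) -> in_rect x1 x2 y1 y2 (b, y1) -> rect_integral f a b y1 y2 = (- rect_integral f a b y2 y1)%C).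
  { intros a b [Ha _] [Hb _]. unfold rect_integral.
    rewrite (CI_swap (fun t => f (a, t)) y1 y2), (CI_swap (fun t => f (b, t)) y1 y2); [ring| |];
      apply (exCI_ver f); intros; apply Cf, in_rect_corner; auto. }
  assert (I1 : in_rect x1 x2 y1 y2 (x1, y1)) by (apply in_rect_corner; auto).
  assert (I2 : in_rect x1 x2 y1 y2 (x2, y1)) by (apply in_rect_corner; auto).
  assert (X : forall a b c d, (a = x1 /\ b = x2 \/ a = x2 /\ b = x1) -> (c = y1 /\ d = y2 \/ c = y2 /\ d = y1) ->
    a <= b -> c <= d -> rect_integral f a b c d = 0%C).
  { intros a b c d Hab Hcd L1 L2. apply goursat_ordered; auto. intros z [H1 H2]. apply D. split.
    - destruct Hab as [[-> ->]|[-> ->]]; auto. rewrite Rmin_comm, Rmax_comm. auto.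
    - destruct Hcd as [[-> ->]|[-> ->]]; auto. rewrite Rmin_comm, Rmax_comm. auto. }
  destruct (Rle_dec x1 x2) as [Lx|Lx], (Rle_dec y1 y2) as [Ly|Ly].
  - apply X; auto.
  - rewrite Sy, X; auto; [ring|lra].
  - rewrite Sx, X; auto; [ring|lra].
  - rewrite Sx, Sy, X; auto; [ring|lra|lra].
Qed.

(** * Primitives and Cauchy's formula on a disc centred at 0 *)

Definition holo (R : R) (f : C -> C) : Prop := forall z, Cmod z < R -> exists d, cderiv f z d.

Lemma holo_ccont (R : R) (f : C -> C) (z : C) : holo R f -> Cmod z < R -> ccont f z.
Proof. intros H Hz. destruct (H z Hz) as [d Hd]. eapply cderiv_cont, Hd. Qed.

Lemma Cmod_sqr (z : C) : Cmod z * Cmod z = fst z * fst z + snd z * snd z.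
Proof.
  unfold Cmod. rewrite sqrt_def; [cbn; ring|].
  pose proof (pow2_ge_0 (fst z)). pose proof (pow2_ge_0 (snd z)). lra.
Qed.

Lemma Cmod_le_coord (w z : C) :
  Rabs (fst w) <= Rabs (fst z) -> Rabs (snd w) <= Rabs (snd z) -> Cmod w <= Cmod z.
Proof.
  intros H1 H2. apply Rsqr_incr_0; [|apply Cmod_ge_0|apply Cmod_ge_0].
  unfold Rsqr. rewrite !Cmod_sqr.
  apply Rsqr_le_abs_1 in H1, H2. unfold Rsqr in *. lra.
Qed.

Lemma Rabs_between (a b t : R) : Rmin a b <= t <= Rmax a b -> Rabs t <= Rabs a \/ Rabs t <= Rabs b.
Proof.
  unfold Rmin, Rmax. destruct (Rle_dec a b); unfold Rabs; intros;
    destruct (Rcase_abs t), (Rcase_abs a), (Rcase_abs b); lra.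
Qed.

(** Each point of a rectangle with one side on the real axis is dominated, coordinate by coordinate,
    by one of the two opposite corners. This keeps the rectangles for Goursat's theorem inside the
    disc. *)
Lemma Cmod_in_rect (R x1 x2 y : R) (w : C) :
  Cmod (x1, y) < R -> Cmod (x2, y) < R -> in_rect x1 x2 0 y w -> Cmod w < R.
Proof.
  intros H1 H2 [Hx Hy]. apply Rabs_between in Hx, Hy.
  assert (Y : Rabs (snd w) <= Rabs y).
  { destruct Hy as [Hy|Hy]; auto. rewrite Rabs_R0 in Hy. pose proof (Rabs_pos y). lra. }
  destruct Hx as [Hx|Hx]; eapply Rle_lt_trans; try apply Cmod_le_coord; [| |apply H1| | |apply H2]; assumption.
Qed.

(** The integral of [f] from 0 along the real axis and then vertically to [z], a path that does not
    leave the discs centred at 0 containing [z]. *)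
Definition cprimitive (f : C -> C) (z : C) : C :=
  (CI (fun t => f (t, 0)) 0 (fst z) + Ci * CI (fun t => f (fst z, t)) 0 (snd z))%C.

(** Goursat's theorem for the rectangle between [x0], [x1] and the heights [0], [y1] turns the
    increment from [z] to [w] into an integral along the vertical segment at [x0] followed by the
    horizontal one at [y1]. Both are close to [z], where continuity makes [f] nearly [f z]. *)
Lemma cprimitive_deriv (R : R) (f : C -> C) (z : C) :
  holo R f -> Cmod z < R -> cderiv (cprimitive f) z (f z).
Proof.
  intros H Hz. apply cderiv_eps. intros e He.
  destruct z as [x0 y0].
  assert (Cf : forall w, Cmod w < R -> ccont f w) by (intros; eapply holo_ccont; eauto).
  destruct (cnbhd_lt _ _ Hz) as (d1 & Hd1 & In).
  destruct (Cf _ Hz (e/4) ltac:(lra)) as (d2 & Hd2 & Near).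
  exists (Rmin d1 d2). split; [apply Rmin_pos; lra|]. intros [x1 y1] Hw.
  pose proof (Rmin_l d1 d2). pose proof (Rmin_r d1 d2).
  set (w := (x1, y1) : C) in *. set (z := (x0, y0) : C) in *.
  assert (Hh : forall t, Rmin x0 x1 <= t <= Rmax x0 x1 -> Cmod ((t, y1) - z)%C <= Cmod (w - z)%C).
  { intros t Ht. apply Cmod_le_coord; cbn; [|lra].
    assert (B : Rmin 0 (x1 - x0) <= t - x0 <= Rmax 0 (x1 - x0)).
    { unfold Rmin, Rmax in *. destruct (Rle_dec x0 x1), (Rle_dec 0 (x1 - x0)); lra. }
    apply Rabs_between in B. rewrite Rabs_R0 in B. pose proof (Rabs_pos (x1 - x0)).
    unfold Rminus in *. lra. }
  assert (Hv : forall t, Rmin y0 y1 <= t <= Rmax y0 y1 -> Cmod ((x0, t) - z)%C <= Cmod (w - z)%C).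
  { intros t Ht. apply Cmod_le_coord; cbn.
    - replace (x0 + - x0) with 0 by ring. rewrite Rabs_R0. apply Rabs_pos.
    - assert (B : Rmin 0 (y1 - y0) <= t - y0 <= Rmax 0 (y1 - y0)).
      { unfold Rmin, Rmax in *. destruct (Rle_dec y0 y1), (Rle_dec 0 (y1 - y0)); lra. }
      apply Rabs_between in B. rewrite Rabs_R0 in B. pose proof (Rabs_pos (y1 - y0)).
      unfold Rminus in *. lra. }
  assert (W : Cmod w < R) by (apply In; lra).
  assert (V : Cmod (x0, y1) < R).
  { apply In. eapply Rle_lt_trans; [apply (Hh x0)|lra]. split; [apply Rmin_l | apply Rmax_l]. }
  assert (X : forall y, Cmod (x0, y) < R -> Cmod (x0, 0) < R).
  { intros y Hy. eapply Rle_lt_trans; [|exact Hy]. apply Cmod_le_coord; cbn; [lra|].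
    rewrite Rabs_R0. apply Rabs_pos. }
  assert (G : rect_integral f x0 x1 0 y1 = 0%C).
  { apply goursat. intros u Hu. apply H. exact (Cmod_in_rect R x0 x1 y1 u V W Hu). }
  unfold rect_integral in G.
  assert (P0 : forall x y t, Cmod (x, y) < R -> Rmin 0 x <= t <= Rmax 0 x -> ccont f (t, 0)).
  { intros x y t Hx Ht. apply Cf. eapply Rle_lt_trans; [|exact Hx]. apply Cmod_le_coord; cbn.
    - apply Rabs_between in Ht. rewrite Rabs_R0 in Ht. pose proof (Rabs_pos x). lra.
    - rewrite Rabs_R0. apply Rabs_pos. }
  assert (E1 : exCI (fun t => f (t, 0)) 0 x0) by (apply (exCI_hor f); intros t Ht; eapply (P0 _ _ t); [|exact Ht]; eassumption).
  assert (E2 : exCI (fun t => f (t, 0)) 0 x1) by (apply (exCI_hor f); intros t Ht; eapply (P0 _ _ t); [|exact Ht]; eassumption).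
  assert (E3 : exCI (fun t => f (t, 0)) x0 x1).
  { apply (exCI_hor f). intros t Ht. apply Cf. eapply Cmod_in_rect; [apply V | apply W|].
    split; cbn; auto. split; [apply Rmin_l | apply Rmax_l]. }
  assert (E4 : exCI (fun t => f (x0, t)) 0 y0).
  { apply (exCI_ver f). intros t Ht. apply Cf. eapply Rle_lt_trans; [|exact Hz].
    apply Cmod_le_coord; cbn; [lra|].
    apply Rabs_between in Ht. rewrite Rabs_R0 in Ht. pose proof (Rabs_pos y0). lra. }
  assert (C5 : forall t, Rmin y0 y1 <= t <= Rmax y0 y1 -> ccont f (x0, t)).
  { intros t Ht. apply Cf, In. eapply Rle_lt_trans; [apply Hv, Ht|lra]. }
  assert (E5 : exCI (fun t => f (x0, t)) y0 y1) by now apply (exCI_ver f).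
  assert (C6 : forall t, Rmin x0 x1 <= t <= Rmax x0 x1 -> ccont f (t, y1)).
  { intros t Ht. apply Cf, In. eapply Rle_lt_trans; [apply Hh, Ht|lra]. }
  assert (E6 : exCI (fun t => f (t, y1)) x0 x1) by now apply (exCI_hor f).
  assert (Ec : forall a b, exCI (fun _ => f z) a b).
  { intros. apply exCI_cont. intros. apply clim_const, locally_filter. }
  assert (E : (cprimitive f w - cprimitive f z - f z * (w - z))%C =
    (CI (fun t => f (t, y1) - f z) x0 x1 + Ci * CI (fun t => f (x0, t) - f z) y0 y1)%C).
  { rewrite (CI_minus (fun t => f (t, y1)) (fun _ => f z)), (CI_minus (fun t => f (x0, t)) (fun _ => f z)), !CI_const by auto.
    unfold cprimitive. cbn [fst snd w z].
    rewrite <- (CI_Chasles (fun t => f (t, 0)) 0 x0 x1) by auto.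
    rewrite <- (CI_Chasles (fun t => f (x0, t)) 0 y0 y1) in G by auto.
    replace (w - z)%C with (RtoC (x1 - x0) + Ci * RtoC (y1 - y0))%C
      by (apply injective_projections; cbn; ring).
    set (A := CI (fun t => f (x1, t)) 0 y1) in *.
    replace (Ci * A)%C with (Ci * A - 0)%C by ring. rewrite <- G. ring. }
  rewrite E. eapply Rle_trans; [apply Cmod_triangle|]. rewrite Cmod_mult, Cmod_Ci, Rmult_1_l.
  assert (B1 : Cmod (CI (fun t => f (t, y1) - f z)%C x0 x1) <= 2 * (e/4) * Rabs (x1 - x0)).
  { apply CI_bound.
    - apply exCI_cont. intros t Ht. apply clim_minus; [apply locally_filter| | apply clim_const, locally_filter].
      apply (rcont_comp f (fun t => (t, y1))); [now apply C6|]. eapply rderiv_cont, rderiv_horizontal.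
    - intros t Ht. left. apply Near. eapply Rle_lt_trans; [apply Hh, Ht|lra]. }
  assert (B2 : Cmod (CI (fun t => f (x0, t) - f z)%C y0 y1) <= 2 * (e/4) * Rabs (y1 - y0)).
  { apply CI_bound.
    - apply exCI_cont. intros t Ht. apply clim_minus; [apply locally_filter| | apply clim_const, locally_filter].
      apply (rcont_comp f (fun t => (x0, t))); [now apply C5|]. eapply rderiv_cont, rderiv_vertical.
    - intros t Ht. left. apply Near. eapply Rle_lt_trans; [apply Hv, Ht|lra]. }
  pose proof (fst_le_Cmod (w - z)%C) as F1. pose proof (snd_le_Cmod (w - z)%C) as F2.
  cbn in F1, F2. change (x1 + - x0) with (x1 - x0) in F1. change (y1 + - y0) with (y1 - y0) in F2.
  nra.
Qed.

Definition circ (r t : R) : C := (r * cos t, r * sin t).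

Lemma Cmod_circ (r t : R) : 0 <= r -> Cmod (circ r t) = r.
Proof.
  intros Hr. apply Rsqr_inj; [apply Cmod_ge_0 | assumption |]. unfold Rsqr. rewrite Cmod_sqr. cbn.
  pose proof (sin2_cos2 t) as E. unfold Rsqr in E.
  replace (r * cos t * (r * cos t) + r * sin t * (r * sin t)) with (r * r * (sin t * sin t + cos t * cos t)) by ring.
  rewrite E. ring.
Qed.

Lemma circ_2PI (r : R) : circ r (2 * PI) = circ r 0.
Proof. unfold circ. now rewrite cos_2PI, sin_2PI, cos_0, sin_0. Qed.

Lemma circ_deriv (r t : R) : rderiv (circ r) t (Ci * circ r t)%C.
Proof.
  replace (Ci * circ r t)%C with ((r * - sin t, r * cos t) : C)
    by (apply injective_projections; cbn; ring).
  apply rderiv_pair; auto_derive; auto; ring.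
Qed.

Lemma circ_cont (r t : R) : rcont (circ r) t.
Proof. eapply rderiv_cont, circ_deriv. Qed.

Lemma circ_neq (r t : R) (z : C) : 0 <= r -> Cmod z <> r -> (circ r t - z)%C <> 0%C.
Proof.
  intros Hr Hz E. apply Hz. rewrite <- (Cmod_circ r t Hr). f_equal.
  replace (circ r t) with ((circ r t - z) + z)%C by ring. rewrite E. ring.
Qed.

Lemma circ_dist (r t : R) (z : C) : 0 <= r -> r - Cmod z <= Cmod (circ r t - z)%C.
Proof.
  intros Hr. pose proof (Cmod_triangle (circ r t - z) z) as T.
  replace (circ r t - z + z)%C with (circ r t) in T by ring. rewrite Cmod_circ in T by auto. lra.
Qed.

Lemma circ_conj (r t : R) : (circ r t * Cconj (circ r t))%C = RtoC (r * r).
Proof.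
  pose proof (sin2_cos2 t) as E. unfold Rsqr in E.
  apply injective_projections; cbn; [|ring].
  replace (r * cos t * (r * cos t) - r * sin t * - (r * sin t)) with (r * r * (sin t * sin t + cos t * cos t)) by ring.
  rewrite E. ring.
Qed.

Lemma rderiv_along_line (F : C -> C) (f : C -> C) (z v : C) (t : R) :
  cderiv F (z + RtoC t * v)%C (f (z + RtoC t * v)%C) ->
  rderiv (fun u => F (z + RtoC u * v)%C) t (f (z + RtoC t * v) * v)%C.
Proof. intros H. apply (rderiv_comp F (fun u => z + RtoC u * v)%C); [assumption | apply rderiv_affine]. Qed.

Lemma rderiv_mult_const (g : R -> C) (t : R) (v c : C) :
  rderiv g t v -> rderiv (fun u => g u * c)%C t (v * c)%C.
Proof.
  intros H. replace (v * c)%C with (c * v)%C by ring.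
  apply (rderiv_comp (fun w => w * c)%C g); auto.
  apply cderiv_ext with (fun w => c * w)%C; [intros; ring|].
  pose proof (cderiv_scal c _ _ _ (cderiv_id (g t))) as Q. now rewrite Cmult_1_r in Q.
Qed.

(* Every point of the circle is deformed linearly to [z]; the integral is constant along the deformation. *)
Lemma cauchy_deformation (S r : R) (F f : C -> C) (z : C) :
  (forall w, Cmod w < S -> cderiv F w (f w) /\ ccont f w) ->
  0 < r < S -> Cmod z < r ->
  CI (fun t => F (circ r t) * (circ r t / (circ r t - z)))%C 0 (2 * PI) =
  (F z * CI (fun t => circ r t / (circ r t - z))%C 0 (2 * PI))%C.
Proof.
  intros H Hr Hz.
  set (w := circ r).
  assert (NZ : forall t, (w t - z)%C <> 0%C) by (intros; apply circ_neq; lra).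
  set (k := fun t => (w t / (w t - z))%C).
  assert (Ck : forall t, rcont k t).
  { intros t. apply clim_mult; [apply locally_filter | apply circ_cont|].
    apply clim_inv; [apply locally_filter | apply NZ|].
    apply clim_minus; [apply locally_filter | apply circ_cont | apply clim_const, locally_filter]. }
  set (p := fun u t => (z + RtoC u * (w t - z))%C).
  (* Differentiating in [u] at the ends of [[0, 1]] takes some room on both sides; with this margin
     the deformed points have modulus at most [(1 + 2 d) r = r + (S - r) / 2 < S]. *)
  set (d := (S - r) / (4 * r)).
  assert (Hd : 0 < d) by (apply Rdiv_lt_0_compat; lra).
  assert (Hdr : d * r = (S - r) / 4) by (unfold d; field; lra).
  assert (In : forall u t, - d < u < 1 + d -> Cmod (p u t) < S).
  { intros u t Hu. unfold p.
    replace (z + RtoC u * (w t - z))%C with (RtoC (1 - u) * z + RtoC u * w t)%C by (rewrite RtoC_minus; ring).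
    eapply Rle_lt_trans; [apply Cmod_triangle|]. rewrite !Cmod_mult, !Cmod_R. unfold w. rewrite Cmod_circ by lra.
    pose proof (Cmod_ge_0 z).
    assert (Rabs (1 - u) * Cmod z <= Rabs (1 - u) * r) by (apply Rmult_le_compat_l; [apply Rabs_pos|lra]).
    assert (Rabs (1 - u) + Rabs u <= 1 + 2 * d) by (unfold Rabs; destruct (Rcase_abs (1 - u)), (Rcase_abs u); lra).
    assert ((Rabs (1 - u) + Rabs u) * r <= (1 + 2 * d) * r) by (apply Rmult_le_compat_r; lra). lra. }
  set (G := fun u t => (F (p u t) * k t)%C).
  set (G' := fun u t => (f (p u t) * w t)%C).
  assert (DG : forall u t, - d < u < 1 + d -> rderiv (fun v => G v t) u (G' u t)).
  { intros u t Hu. unfold G'.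
    replace (f (p u t) * w t)%C with ((f (p u t) * (w t - z)) * k t)%C by (unfold k; field; apply NZ).
    apply rderiv_mult_const, rderiv_along_line. now apply H, In. }
  assert (CG : forall u t, - d < u < 1 + d -> rcont (G u) t).
  { intros u t Hu. apply clim_mult; [apply locally_filter | | apply Ck].
    apply (rcont_comp F (p u)); [eapply cderiv_cont, H, In, Hu|].
    apply clim_plus; [apply locally_filter | apply clim_const, locally_filter|].
    apply clim_mult; [apply locally_filter | apply clim_const, locally_filter|].
    apply clim_minus; [apply locally_filter | apply circ_cont | apply clim_const, locally_filter]. }
  assert (CG2 : forall u t, - d < u < 1 + d ->
     clim (locally (u, t)) (fun q => G' (fst q) (snd q)) (G' u t)).
  { intros u t Hu.
    assert (Cw : clim (locally (u, t)) (fun q => w (snd q)) (w t)).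
    { intros e He. apply (continuous_snd (U := R_UniformSpace) (V := R_UniformSpace) u t _ (circ_cont r t e He)). }
    assert (Cu : clim (locally (u, t)) (fun q => RtoC (fst q)) (RtoC u)).
    { intros e He. apply (continuous_fst (U := R_UniformSpace) (V := R_UniformSpace) u t _ (rcont_id u e He)). }
    apply clim_mult; [apply locally_filter | | assumption].
    eapply clim_comp; [apply locally_filter | apply H, In, Hu |].
    apply clim_plus; [apply locally_filter | apply clim_const, locally_filter|].
    apply clim_mult; [apply locally_filter | assumption |].
    apply clim_minus; [apply locally_filter | assumption | apply clim_const, locally_filter]. }
  assert (CG1 : forall u t, - d < u < 1 + d -> rcont (G' u) t).
  { intros u t Hu. apply clim_mult; [apply locally_filter | | apply circ_cont].
    apply (rcont_comp f (p u)); [apply H, In, Hu|].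
    apply clim_plus; [apply locally_filter | apply clim_const, locally_filter|].
    apply clim_mult; [apply locally_filter | apply clim_const, locally_filter|].
    apply clim_minus; [apply locally_filter | apply circ_cont | apply clim_const, locally_filter]. }
  (* For [u <> 0], the function [u Ci (G' u)] is the derivative in [t] of [F (p u t)], which is
     periodic. For [u = 0] the factor [f (p u t)] is the constant [f z], and the circle itself
     integrates to 0. *)
  assert (Z : forall u, - d < u < 1 + d -> CI (G' u) 0 (2 * PI) = 0%C).
  { intros u Hu. destruct (Req_dec u 0) as [->|N].
    - assert (E : CI (fun t => Ci * w t)%C 0 (2 * PI) = 0%C).
      { rewrite (CI_deriv w (fun t => Ci * w t)%C).
        - unfold w. rewrite circ_2PI. ring.
        - intros. apply circ_deriv.
        - intros. apply clim_mult; [apply locally_filter | apply clim_const, locally_filter | apply circ_cont]. }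
      rewrite CI_scal in E by (apply exCI_cont; intros; apply circ_cont).
      assert (E' : CI w 0 (2 * PI) = 0%C).
      { replace (CI w 0 (2 * PI)) with (- (Ci * (Ci * CI w 0 (2 * PI))))%C by (apply injective_projections; cbn; ring).
        rewrite E. ring. }
      transitivity (CI (fun t => f z * w t)%C 0 (2 * PI)).
      + apply CI_ext. intros t _. unfold G', p. f_equal. f_equal. ring.
      + rewrite CI_scal by (apply exCI_cont; intros; apply circ_cont). rewrite E'. ring.
    - assert (E : CI (fun t => (RtoC u * Ci) * G' u t)%C 0 (2 * PI) = 0%C).
      { rewrite (CI_deriv (fun t => F (p u t)) (fun t => (RtoC u * Ci) * G' u t)%C).
        - unfold p, w. rewrite circ_2PI. ring.
        - intros t _. unfold G'.
          replace (RtoC u * Ci * (f (p u t) * w t))%C with (f (p u t) * (RtoC u * (Ci * w t)))%C by ring.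
          apply (rderiv_comp F (p u)); [now apply H, In|].
          apply (rderiv_comp (fun v => z + RtoC u * (v - z))%C w); [|apply circ_deriv].
          replace (RtoC u) with (0 + RtoC u * (1 - 0))%C by ring.
          apply cderiv_ext with (fun v => z + RtoC u * (v - z))%C; [intros; ring|].
          apply cderiv_plus; [apply cderiv_const|].
          apply cderiv_scal, cderiv_minus; [apply cderiv_id | apply cderiv_const].
        - intros t _. apply clim_mult; [apply locally_filter | apply clim_const, locally_filter | now apply CG1]. }
      rewrite CI_scal in E by (apply exCI_cont; intros; now apply CG1).
      assert (NU : RtoC u <> 0%C) by (intro E0; apply RtoC_inj in E0; lra).
      assert (NI : Ci <> 0%C) by (intro E0; apply (f_equal snd) in E0; cbn in E0; lra).
      replace (CI (G' u) 0 (2 * PI)) with ((RtoC u * Ci) * CI (G' u) 0 (2 * PI) / (RtoC u * Ci))%C by (field; auto).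
      rewrite E. unfold Cdiv. ring. }
  assert (Near : forall u, - d < u < 1 + d -> locally u (fun v => - d < v < 1 + d)).
  { intros u Hu. assert (Q : 0 < Rmin (u + d) (1 + d - u)) by (apply Rmin_pos; lra).
    exists (mkposreal _ Q). intros v Hv. change (Rabs (v - u) < Rmin (u + d) (1 + d - u)) in Hv.
    pose proof (Rmin_l (u + d) (1 + d - u)). pose proof (Rmin_r (u + d) (1 + d - u)).
    apply Rabs_def2 in Hv. lra. }
  (* Differentiation under the integral sign is available for real functions, so it is done for an
     abstract coordinate [pr] and then used with [fst] and with [snd]. *)
  assert (Param : forall (pr : C -> R),
     (forall g t v, rderiv g t v -> is_derive (fun u => pr (g u)) t (pr v)) ->
     (forall T (K : (T -> Prop) -> Prop), Filter K -> forall g l, clim K g l -> filterlim (fun t => pr (g t)) K (locally (pr l))) ->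
     (forall u, - d < u < 1 + d -> RInt (fun t => pr (G' u t)) 0 (2 * PI) = 0) ->
     RInt (fun t => pr (G 0 t)) 0 (2 * PI) = RInt (fun t => pr (G 1 t)) 0 (2 * PI)).
  { intros pr Dpr Cpr Zpr.
    apply (eq_is_derive (V := R_NormedModule) (fun u => RInt (fun t => pr (G u t)) 0 (2 * PI)) 0 1); [|lra].
    intros u Hu. assert (Hu' : - d < u < 1 + d) by lra.
    assert (ED : forall v t, - d < v < 1 + d -> Derive (fun s => pr (G s t)) v = pr (G' v t)).
    { intros v t Hv. apply is_derive_unique, Dpr, DG, Hv. }
    assert (E0 : RInt (fun t => Derive (fun v => pr (G v t)) u) 0 (2 * PI) = 0).
    { etransitivity; [|exact (Zpr u Hu')]. apply RInt_ext. intros t _. now apply ED. }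
    refine (eq_ind _ (fun l => is_derive (fun u => RInt (fun t => pr (G u t)) 0 (2 * PI)) u l) _ _ E0).
    apply (is_derive_RInt_param (fun u t => pr (G u t))).
    - generalize (Near u Hu'). apply filter_imp. intros v Hv t _. eexists. apply Dpr, DG, Hv.
    - intros t _. apply continuity_2d_pt_ext_loc with (fun v s => pr (G' v s)).
      + destruct (Near u Hu') as [e He]. exists e. intros v s Hv _. symmetry. apply ED, He, Hv.
      + apply continuity_2d_pt_filterlim, Cpr; [apply locally_filter | now apply CG2].
    - generalize (Near u Hu'). apply filter_imp. intros v Hv.
      apply (ex_RInt_continuous (V := R_CompleteNormedModule)). intros t _.
      apply Cpr; [apply locally_filter | now apply CG]. }
  assert (E01 : CI (G 0) 0 (2 * PI) = CI (G 1) 0 (2 * PI)).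
  { apply injective_projections; rewrite ?fst_CI, ?snd_CI.
    - apply (Param fst).
      + intros. now apply rderiv_fst_snd.
      + intros. now apply clim_fst.
      + intros u Hu. now rewrite <- (fst_CI (G' u)), Z.
    - apply (Param snd).
      + intros. now apply rderiv_fst_snd.
      + intros. now apply clim_snd.
      + intros u Hu. now rewrite <- (snd_CI (G' u)), Z. }
  transitivity (CI (G 1) 0 (2 * PI)).
  - apply CI_ext. intros t _. unfold G, p, k, w. f_equal. f_equal. ring.
  - rewrite <- E01. rewrite <- CI_scal by (apply exCI_cont; intros; apply Ck).
    apply CI_ext. intros t _. unfold G, p, k. f_equal. f_equal. ring.
Qed.

Ltac lims := repeat first
  [ apply clim_plus; [apply locally_filter| |]
  | apply clim_minus; [apply locally_filter| |]
  | apply clim_mult; [apply locally_filter| |]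
  | apply clim_opp; [apply locally_filter|]
  | apply clim_inv; [apply locally_filter| |]
  | apply circ_cont
  | apply (clim_const (locally _)) ].

Lemma exCI_rcont (f : R -> C) (a b : R) : (forall t, rcont f t) -> exCI f a b.
Proof. intros H. apply exCI_cont. auto. Qed.

Lemma cderiv_moebius (a b c z : C) :
  (b - c * z)%C <> 0%C -> cderiv (fun w => a * w / (b - c * w))%C z (a * b / ((b - c * z) * (b - c * z)))%C.
Proof.
  intros N.
  replace (a * b / ((b - c * z) * (b - c * z)))%C
    with (a * 1 * / (b - c * z) + a * z * (- (0 - c * 1) / ((b - c * z) * (b - c * z))))%C by (field; auto).
  apply (cderiv_mult (fun w => a * w)%C (fun w => / (b - c * w))%C); [apply cderiv_scal, cderiv_id|].
  apply (cderiv_inv (fun w => b - c * w)%C); auto.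
  apply cderiv_minus; [apply cderiv_const | apply cderiv_scal, cderiv_id].
Qed.

(** A radius strictly between [r] and [r^2/|z|], the modulus of the zero of [r^2 - conj z w]; unlike
    [r^2/|z|] it makes sense at [z = 0] too. *)
Definition reflect_radius (r : R) (z : C) : R := 2 * (r * r) / (r + Cmod z).

Lemma reflect_radius_spec (r : R) (z : C) : Cmod z < r ->
  r < reflect_radius r z /\
  forall w, Cmod w < reflect_radius r z -> (RtoC (r * r) - Cconj z * w)%C <> 0%C.
Proof.
  intros Hz. pose proof (Cmod_ge_0 z). unfold reflect_radius. split.
  - apply (Rmult_lt_reg_r (r + Cmod z)); [lra|].
    replace (2 * (r * r) / (r + Cmod z) * (r + Cmod z)) with (2 * (r * r)) by (field; lra). nra.
  - intros w Hw E.
    assert (E' : RtoC (r * r) = (Cconj z * w)%C).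
    { replace (Cconj z * w)%C with (RtoC (r * r) - (RtoC (r * r) - Cconj z * w))%C by ring. rewrite E. ring. }
    apply (f_equal Cmod) in E'. rewrite Cmod_mult, Cmod_conj, Cmod_R, Rabs_pos_eq in E' by nra.
    assert (Cmod w * (r + Cmod z) < 2 * (r * r)).
    { replace (2 * (r * r)) with (2 * (r * r) / (r + Cmod z) * (r + Cmod z)) by (field; lra).
      apply Rmult_lt_compat_r; lra. }
    pose proof (Cmod_ge_0 w).
    assert (Cmod z * Cmod w <= r * Cmod w) by (apply Rmult_le_compat_r; lra). nra.
Qed.

Lemma conj_kernel (r t : R) (z : C) : 0 < r -> Cmod z < r ->
  Cconj (Cconj z * circ r t / (RtoC (r * r) - Cconj z * circ r t))%C = (z / (circ r t - z))%C.
Proof.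
  intros Hr Hz. set (w := circ r t).
  assert (N1 : (w - z)%C <> 0%C) by (apply circ_neq; lra).
  assert (Nw : w <> 0%C).
  { apply Cmod_gt_0. unfold w. rewrite Cmod_circ; lra. }
  assert (Nc : Cconj w <> 0%C) by (apply Cmod_gt_0; rewrite Cmod_conj; now apply Cmod_gt_0).
  assert (N2 : (RtoC (r * r) - Cconj z * w)%C <> 0%C).
  { apply (reflect_radius_spec r z Hz). unfold w. rewrite Cmod_circ by lra. now apply reflect_radius_spec. }
  rewrite Cdiv_conj, Cminus_conj, !Cmult_conj, Cconj_conj by assumption.
  replace (Cconj (RtoC (r * r))) with (w * Cconj w)%C.
  2:{ unfold w. rewrite circ_conj. apply injective_projections; cbn; ring. }
  field. split; [assumption|].
  replace (w * Cconj w - z * Cconj w)%C with ((w - z) * Cconj w)%C by ring.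
  now apply Cmult_neq_0.
Qed.

(** The kernel is [1 + z / (w - z)]. On the circle [conj w = r^2 / w], so the second term is the
    conjugate of [conj z w / (r^2 - conj z w)], which is holomorphic on a larger disc and vanishes
    at 0; its mean is therefore 0. *)
Lemma cauchy_kernel_integral (r : R) (z : C) : 0 < r -> Cmod z < r ->
  CI (fun t => circ r t / (circ r t - z))%C 0 (2 * PI) = RtoC (2 * PI).
Proof.
  intros Hr Hz. destruct (reflect_radius_spec r z Hz) as [Hrr NZ].
  set (H := fun w => (Cconj z * w / (RtoC (r * r) - Cconj z * w))%C).
  set (H' := fun w => (Cconj z * RtoC (r * r) / ((RtoC (r * r) - Cconj z * w) * (RtoC (r * r) - Cconj z * w)))%C).
  assert (DH : forall w, Cmod w < reflect_radius r z -> cderiv H w (H' w)).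
  { intros w Hw. now apply cderiv_moebius, NZ. }
  assert (CH : forall t, rcont (fun t => H (circ r t)) t).
  { intros t. apply (rcont_comp H (circ r)); [|apply circ_cont].
    eapply cderiv_cont, DH. rewrite Cmod_circ; lra. }
  assert (M : CI (fun t => H (circ r t)) 0 (2 * PI) = 0%C).
  (* The mean value property of [H] is the deformation lemma with centre 0, whose kernel is 1. *)
  { transitivity (H 0%C * CI (fun t => circ r t / (circ r t - 0)) 0 (2 * PI))%C.
    - rewrite <- (cauchy_deformation (reflect_radius r z) r H H').
      + apply CI_ext. intros t _. field. replace (circ r t - 0)%C with (circ r t) by ring.
        apply Cmod_gt_0. rewrite Cmod_circ; lra.
      + intros w Hw. split; [now apply DH|].
        assert (N := NZ w Hw).
        assert (D1 : cderiv (fun w => RtoC (r * r) - Cconj z * w)%C w (0 - Cconj z * 1)%C).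
        { apply cderiv_minus; [apply cderiv_const | apply cderiv_scal, cderiv_id]. }
        apply (cderiv_cont _ _ _ (cderiv_scal (Cconj z * RtoC (r * r)) _ _ _ (cderiv_inv (fun w => (RtoC (r * r) - Cconj z * w) * (RtoC (r * r) - Cconj z * w))%C _ _ (Cmult_neq_0 _ _ N N) (cderiv_mult _ _ _ _ _ D1 D1)))).
      + lra.
      + rewrite Cmod_0. lra.
    - unfold H. unfold Cdiv. ring. }
  transitivity (CI (fun t => 1 + Cconj (H (circ r t)))%C 0 (2 * PI)).
  - apply CI_ext. intros t _. unfold H. rewrite conj_kernel by assumption. field. apply circ_neq; lra.
  - rewrite CI_plus, CI_conj, CI_const, M.
    + apply injective_projections; cbn; ring.
    + now apply exCI_rcont.
    + apply exCI_rcont. intros. apply (clim_const (locally _)).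
    + now apply exCI_conj, exCI_rcont.
Qed.

Lemma clim_Cmod {T : Type} (F : (T -> Prop) -> Prop) {FF : Filter F} (g : T -> C) (l : C) :
  clim F g l -> filterlim (fun t => Cmod (g t)) F (locally (Cmod l)).
Proof.
  intros H P [e HP]. change (F (fun t => P (Cmod (g t)))).
  generalize (H e (cond_pos e)). apply filter_imp.
  intros t Ht. apply HP. change (Rabs (Cmod (g t) - Cmod l) < e).
  eapply Rle_lt_trans; [|exact Ht].
  pose proof (Cmod_triangle (g t - l) l) as T1. pose proof (Cmod_triangle (l - g t) (g t)) as T2.
  replace (g t - l + l)%C with (g t) in T1 by ring. replace (l - g t + g t)%C with l in T2 by ring.
  replace (l - g t)%C with (- (g t - l))%C in T2 by ring. rewrite Cmod_opp in T2.
  apply Rabs_le. lra.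
Qed.

Lemma rcont_bounded (f : R -> C) (a b : R) : a <= b -> (forall t, rcont f t) ->
  exists M, 0 <= M /\ forall t, a <= t <= b -> Cmod (f t) <= M.
Proof.
  intros Hab H. destruct (continuity_ab_maj (fun t => Cmod (f t)) a b Hab) as (m & Hm & _).
  - intros t _. apply continuity_pt_filterlim, clim_Cmod; [apply locally_filter | apply H].
  - exists (Cmod (f m)). split; [apply Cmod_ge_0 | exact Hm].
Qed.

(** Both Cauchy kernels below have explicit remainders, quadratic in [w - z] uniformly in [t], so
    this elementary form of differentiation under the integral suffices. *)
Lemma CI_param_deriv (A : C -> R -> C) (A' : R -> C) (z : C) (a b M del : R) :
  0 < del -> 0 <= M ->
  (forall w, Cmod (w - z)%C < del -> exCI (A w) a b) -> exCI A' a b ->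
  (forall w t, Cmod (w - z)%C < del -> Rmin a b <= t <= Rmax a b ->
     Cmod (A w t - A z t - A' t * (w - z))%C <= M * (Cmod (w - z)%C * Cmod (w - z)%C)) ->
  cderiv (fun w => CI (A w) a b) z (CI A' a b).
Proof.
  intros Hd HM HA HA' B. apply cderiv_eps. intros e He.
  set (L := 2 * M * Rabs (b - a) + 1).
  assert (HL : 0 < L).
  { unfold L. pose proof (Rabs_pos (b - a)). pose proof (Rmult_le_pos _ _ HM H). lra. }
  assert (P : 0 < e / L) by (apply Rdiv_lt_0_compat; lra).
  exists (Rmin del (e / L)). split; [apply Rmin_pos; lra|]. intros w Hw.
  pose proof (Rmin_l del (e / L)). pose proof (Rmin_r del (e / L)).
  assert (Z : exCI (A z) a b).
  { apply HA. replace (z - z)%C with (RtoC 0) by ring. now rewrite Cmod_0. }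
  assert (W : exCI (A w) a b) by (apply HA; lra).
  assert (E : (CI (A w) a b - CI (A z) a b - CI A' a b * (w - z))%C =
     CI (fun t => (A w t + (- (1)) * A z t) + (- (w - z)) * A' t)%C a b).
  { rewrite CI_plus, CI_plus, !CI_scal; auto using exCI_plus, exCI_scal. ring. }
  rewrite E. clear E.
  eapply Rle_trans.
  { apply CI_bound with (M := M * (Cmod (w - z)%C * Cmod (w - z)%C)); [auto using exCI_plus, exCI_scal|].
    intros t Ht. replace (A w t + (- (1)) * A z t + (- (w - z)) * A' t)%C with (A w t - A z t - A' t * (w - z))%C by ring.
    apply B; [lra | exact Ht]. }
  pose proof (Cmod_ge_0 (w - z)) as C0. set (k := Cmod (w - z)%C) in *.
  replace (2 * (M * (k * k)) * Rabs (b - a)) with ((2 * M * Rabs (b - a)) * k * k) by ring.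
  apply Rmult_le_compat_r; auto.
  apply Rle_trans with (L * k); [apply Rmult_le_compat_r; unfold L; lra|].
  replace e with (L * (e / L)) by (field; lra). apply Rmult_le_compat_l; lra.
Qed.

Section CauchyTransform.
Context (r : R) (psi : R -> C) (Hr : 0 < r) (Cpsi : forall t, rcont psi t).

Lemma cauchy_transform_gap (z w : C) (t : R) : Cmod z < r -> Cmod (w - z)%C < (r - Cmod z) / 2 ->
  (r - Cmod z) / 2 <= Cmod (circ r t - w)%C /\ (r - Cmod z) / 2 <= Cmod (circ r t - z)%C.
Proof.
  intros Hz Hw. pose proof (circ_dist r t z ltac:(lra)). pose proof (circ_dist r t w ltac:(lra)).
  pose proof (Cmod_triangle (w - z) z) as T. replace (w - z + z)%C with w in T by ring. lra.
Qed.

Lemma cauchy_transform_cont (w : C) (t : R) : Cmod w < r -> rcont (fun t => psi t / (circ r t - w))%C t.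
Proof. intros Hw. lims; [apply Cpsi | apply circ_neq; lra]. Qed.

Lemma cauchy_transform2_cont (w : C) (t : R) : Cmod w < r ->
  rcont (fun t => psi t / ((circ r t - w) * (circ r t - w)))%C t.
Proof. intros Hw. lims; [apply Cpsi | apply Cmult_neq_0; apply circ_neq; lra]. Qed.

Lemma cauchy_transform_near (z w : C) : Cmod z < r -> Cmod (w - z)%C < (r - Cmod z) / 2 -> Cmod w < r.
Proof.
  intros Hz Hw. pose proof (Cmod_triangle (w - z) z) as T. replace (w - z + z)%C with w in T by ring. lra.
Qed.

Lemma cauchy_transform_deriv (z : C) : Cmod z < r ->
  cderiv (fun z => CI (fun t => psi t / (circ r t - z))%C 0 (2 * PI)) z
         (CI (fun t => psi t / ((circ r t - z) * (circ r t - z)))%C 0 (2 * PI)).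
Proof.
  intros Hz. pose proof PI_RGT_0.
  destruct (rcont_bounded psi 0 (2 * PI) ltac:(lra) Cpsi) as (B & HB & Bd).
  set (g := (r - Cmod z) / 2). assert (Hg : 0 < g) by (unfold g; lra).
  apply (CI_param_deriv (fun z t => psi t / (circ r t - z))%C _ z 0 (2 * PI) (B * / (g * g * g)) g Hg).
  - apply Rmult_le_pos; auto. left. apply Rinv_0_lt_compat. repeat apply Rmult_lt_0_compat; lra.
  - intros w Hw. apply exCI_rcont. intros t. now apply cauchy_transform_cont, (cauchy_transform_near z).
  - apply exCI_rcont. intros t. now apply cauchy_transform2_cont.
  - intros w t Hw Ht. rewrite Rmin_left, Rmax_right in Ht by lra.
    destruct (cauchy_transform_gap z w t Hz Hw) as [G1 G2]. fold g in G1, G2.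
    assert (N1 : (circ r t - w)%C <> 0%C) by (apply Cmod_gt_0; lra).
    assert (N2 : (circ r t - z)%C <> 0%C) by (apply Cmod_gt_0; lra).
    set (u := (circ r t - w)%C) in *. set (v := (circ r t - z)%C) in *.
    assert (Ek : (w - z)%C = (v - u)%C) by (unfold u, v; ring).
    (* With [u], [v] the distances to [w], [z] as complex numbers, the remainder is exactly
       [psi (w - z)^2 / (u v^2)], and both moduli are at least [g]. *)
    replace (psi t / u - psi t / v - psi t / (v * v) * (w - z))%C
      with (psi t * (/ (u * v * v) * ((w - z) * (w - z))))%C by (rewrite Ek; field; auto).
    rewrite !Cmod_mult, Cmod_inv, !Cmod_mult by (repeat apply Cmult_neq_0; auto).
    rewrite <- Rmult_assoc. apply Rmult_le_compat_r; [apply Rmult_le_pos; apply Cmod_ge_0|].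
    apply Rmult_le_compat; [apply Cmod_ge_0 | | apply Bd, Ht |].
    + left. apply Rinv_0_lt_compat. repeat apply Rmult_lt_0_compat; lra.
    + apply Rinv_le_contravar; [repeat apply Rmult_lt_0_compat; lra|].
      repeat apply Rmult_le_compat; try lra. apply Rmult_le_pos; lra.
Qed.

Lemma cauchy_transform2_deriv (z : C) : Cmod z < r ->
  cderiv (fun z => CI (fun t => psi t / ((circ r t - z) * (circ r t - z)))%C 0 (2 * PI)) z
         (CI (fun t => 2 * psi t / ((circ r t - z) * (circ r t - z) * (circ r t - z)))%C 0 (2 * PI)).
Proof.
  intros Hz. pose proof PI_RGT_0.
  destruct (rcont_bounded psi 0 (2 * PI) ltac:(lra) Cpsi) as (B & HB & Bd).
  set (g := (r - Cmod z) / 2). assert (Hg : 0 < g) by (unfold g; lra).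
  (* The remainder is [psi (v + 2 u) (w - z)^2 / (u^2 v^3)]. Here [|u|] and [|v|] are at most [2 r],
     which gives [6 r], and at least [g], which gives the fifth power. *)
  apply (CI_param_deriv (fun z t => psi t / ((circ r t - z) * (circ r t - z)))%C _ z 0 (2 * PI) (B * (6 * r * / (g * g * g * g * g))) g Hg).
  - apply Rmult_le_pos; auto. apply Rmult_le_pos; [lra|].
    left. apply Rinv_0_lt_compat. repeat apply Rmult_lt_0_compat; lra.
  - intros w Hw. apply exCI_rcont. intros t. now apply cauchy_transform2_cont, (cauchy_transform_near z).
  - apply exCI_rcont. intros t. lims; [apply Cpsi | repeat apply Cmult_neq_0; apply circ_neq; lra].
  - intros w t Hw Ht. rewrite Rmin_left, Rmax_right in Ht by lra.
    destruct (cauchy_transform_gap z w t Hz Hw) as [G1 G2]. fold g in G1, G2.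
    assert (N1 : (circ r t - w)%C <> 0%C) by (apply Cmod_gt_0; lra).
    assert (N2 : (circ r t - z)%C <> 0%C) by (apply Cmod_gt_0; lra).
    assert (U : forall y, Cmod y < r -> Cmod (circ r t - y)%C <= 2 * r).
    { intros y Hy. eapply Rle_trans; [apply Cmod_triangle|]. rewrite Cmod_opp, Cmod_circ; lra. }
    pose proof (U z Hz) as U1. pose proof (U w (cauchy_transform_near _ _ Hz Hw)) as U2.
    set (u := (circ r t - w)%C) in *. set (v := (circ r t - z)%C) in *.
    assert (Ek : (w - z)%C = (v - u)%C) by (unfold u, v; ring).
    replace (psi t / (u * u) - psi t / (v * v) - 2 * psi t / (v * v * v) * (w - z))%C
      with (psi t * ((v + 2 * u) * / (u * u * v * v * v) * ((w - z) * (w - z))))%C by (rewrite Ek; field; auto).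
    rewrite Cmod_mult, Cmod_mult, !Cmod_mult, Cmod_inv, !Cmod_mult by (repeat apply Cmult_neq_0; auto).
    rewrite <- Rmult_assoc. apply Rmult_le_compat_r; [apply Rmult_le_pos; apply Cmod_ge_0|].
    assert (I : 0 < / (Cmod u * Cmod u * Cmod v * Cmod v * Cmod v)).
    { apply Rinv_0_lt_compat. repeat apply Rmult_lt_0_compat; lra. }
    apply Rmult_le_compat; [apply Cmod_ge_0 | | apply Bd, Ht |].
    + apply Rmult_le_pos; [apply Cmod_ge_0|lra].
    + apply Rmult_le_compat; [apply Cmod_ge_0 | lra | |].
      * eapply Rle_trans; [apply Cmod_triangle|]. rewrite Cmod_mult, Cmod_R, Rabs_pos_eq by lra. lra.
      * apply Rinv_le_contravar; [repeat apply Rmult_lt_0_compat; lra|].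
        repeat apply Rmult_le_compat; try lra; repeat apply Rmult_le_pos; lra.
Qed.

End CauchyTransform.

Lemma cauchy_formula_primitive (S r : R) (f : C -> C) (z : C) :
  holo S f -> 0 < r < S -> Cmod z < r ->
  CI (fun t => cprimitive f (circ r t) * circ r t / (circ r t - z))%C 0 (2 * PI)
  = (RtoC (2 * PI) * cprimitive f z)%C.
Proof.
  intros Hf Hr Hz. rewrite <- (cauchy_kernel_integral r z) by lra.
  rewrite (Cmult_comm _ (cprimitive f z)).
  rewrite <- (cauchy_deformation S r (cprimitive f) f); auto.
  - apply CI_ext. intros t _. unfold Cdiv. ring.
  - intros w Hw. split; [eapply cprimitive_deriv; eauto | eapply holo_ccont; eauto].
Qed.

Lemma circ_comp_cont (S r : R) (f : C -> C) (t : R) : holo S f -> 0 < r < S -> rcont (fun t => f (circ r t)) t.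
Proof.
  intros Hf Hr. apply (rcont_comp f (circ r)); [|apply circ_cont].
  eapply holo_ccont; [exact Hf|]. rewrite Cmod_circ; lra.
Qed.

(** The deformation needs a continuous derivative, which [holo] does not provide for [f]; but it
    does apply to a primitive [F], whose derivative [f] is continuous. Differentiating the formula
    for [F] in [z] gives [f z] as an integral of [F] against the squared kernel, and an integration
    by parts on the circle moves the derivative onto [F]. *)
Theorem cauchy_formula (S r : R) (f : C -> C) (z : C) :
  holo S f -> 0 < r < S -> Cmod z < r ->
  CI (fun t => f (circ r t) * circ r t / (circ r t - z))%C 0 (2 * PI) = (RtoC (2 * PI) * f z)%C.
Proof.
  intros Hf Hr Hz.
  set (F := cprimitive f).
  assert (DF : forall w, Cmod w < S -> cderiv F w (f w)) by (intros; eapply cprimitive_deriv; eauto).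
  assert (CFF : forall w, Cmod w < r -> CI (fun t => F (circ r t) * circ r t / (circ r t - w))%C 0 (2 * PI) = (RtoC (2 * PI) * F w)%C).
  { intros w Hw. apply (cauchy_formula_primitive S r f w); auto. }
  clearbody F.
  assert (HF : holo S F) by (intros w Hw; eexists; eauto).
  assert (CF : forall t, rcont (fun t => F (circ r t)) t) by (intros; eapply circ_comp_cont; eauto).
  assert (Cf : forall t, rcont (fun t => f (circ r t)) t) by (intros; eapply circ_comp_cont; eauto).
  set (psi := fun t => (F (circ r t) * circ r t)%C).
  assert (Cpsi : forall t, rcont psi t) by (intros; unfold psi; lims; apply CF).
  transitivity (CI (fun t => psi t / ((circ r t - z) * (circ r t - z)))%C 0 (2 * PI)).
  - assert (NZ : forall t, (circ r t - z)%C <> 0%C) by (intros; apply circ_neq; lra).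
    set (k1 := fun t => (f (circ r t) * circ r t / (circ r t - z))%C).
    set (k2 := fun t => (psi t / ((circ r t - z) * (circ r t - z)))%C).
    assert (C1 : forall t, rcont k1 t) by (intros; unfold k1; lims; auto; apply Cf).
    assert (C2 : forall t, rcont k2 t) by (intros; apply cauchy_transform2_cont; auto; lra).
    (* The integration by parts: the integrand is the derivative of [F w / (w - z)] along the closed
       circle. *)
    assert (E : CI (fun t => Ci * (k1 t - k2 t))%C 0 (2 * PI) = 0%C).
    { rewrite (CI_deriv (fun t => F (circ r t) * / (circ r t - z))%C).
      - rewrite circ_2PI. ring.
      - intros t _. unfold k1, k2, psi.
        replace (Ci * (f (circ r t) * circ r t / (circ r t - z) - F (circ r t) * circ r t / ((circ r t - z) * (circ r t - z))))%C
          with ((f (circ r t) * / (circ r t - z) + F (circ r t) * (- (1 - 0) / ((circ r t - z) * (circ r t - z)))) * (Ci * circ r t))%C by (field; apply NZ).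
        apply (rderiv_comp (fun w => F w * / (w - z))%C (circ r)); [|apply circ_deriv].
        apply (cderiv_mult F (fun w => / (w - z))%C); [apply DF; rewrite Cmod_circ; lra|].
        apply (cderiv_inv (fun w => w - z)%C); [apply NZ|].
        apply cderiv_minus; [apply cderiv_id | apply cderiv_const].
      - intros t _. apply clim_mult; [apply locally_filter | apply (clim_const (locally _)) |].
        apply clim_minus; [apply locally_filter | apply C1 | apply C2]. }
    rewrite CI_scal, CI_minus in E; try (apply exCI_rcont; auto).
    2:{ intros t. apply clim_minus; [apply locally_filter | apply C1 | apply C2]. }
    change (CI k1 0 (2 * PI) = CI k2 0 (2 * PI)).
    replace (CI k1 0 (2 * PI)) with (- (Ci * (Ci * (CI k1 0 (2 * PI) - CI k2 0 (2 * PI)))) + CI k2 0 (2 * PI))%C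
      by (apply injective_projections; cbn; ring).
    rewrite E. ring.
  - apply (cderiv_unique (fun z => CI (fun t => psi t / (circ r t - z))%C 0 (2 * PI)) z).
    + now apply cauchy_transform_deriv; try lra.
    + apply cderiv_ext_loc with (fun z => RtoC (2 * PI) * F z)%C.
      * generalize (cnbhd_lt _ _ Hz). apply filter_imp. intros w Hw. symmetry.
        apply (CFF w Hw).
      * apply cderiv_scal, DF. lra.
Qed.

(** A total derivative, so that it can be differentiated and divided like any function; its value is
    arbitrary where [f] has no derivative. *)
Definition cd (f : C -> C) (z : C) : C := epsilon (inhabits (RtoC 0)) (fun d : C => cderiv f z d).

Lemma cd_spec (f : C -> C) (z : C) : (exists d, cderiv f z d) -> cderiv f z (cd f z).
Proof. exact (epsilon_spec (inhabits (RtoC 0)) (fun d : C => cderiv f z d)). Qed.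

Lemma cd_eq (f : C -> C) (z d : C) : cderiv f z d -> cd f z = d.
Proof. intros H. apply (cderiv_unique f z); [|exact H]. apply cd_spec. eauto. Qed.

Lemma cauchy_formula_cd (S r : R) (f : C -> C) (z : C) :
  holo S f -> 0 < r < S -> Cmod z < r ->
  CI (fun t => f (circ r t) * circ r t / ((circ r t - z) * (circ r t - z)))%C 0 (2 * PI) = (RtoC (2 * PI) * cd f z)%C.
Proof.
  intros Hf Hr Hz.
  apply (cderiv_unique (fun z => CI (fun t => f (circ r t) * circ r t / (circ r t - z))%C 0 (2 * PI)) z).
  - apply (cauchy_transform_deriv r (fun t => f (circ r t) * circ r t)%C); [lra| |assumption].
    intros t. lims. apply (circ_comp_cont S r f); auto.
  - apply cderiv_ext_loc with (fun z => RtoC (2 * PI) * f z)%C.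
    + generalize (cnbhd_lt _ _ Hz). apply filter_imp. intros w Hw. symmetry.
      apply (cauchy_formula S); auto.
    + apply cderiv_scal, cd_spec, Hf. lra.
Qed.

Lemma RtoC_2PI_neq : RtoC (2 * PI) <> 0%C.
Proof. intro E. apply RtoC_inj in E. pose proof PI_RGT_0. lra. Qed.

(** Inside a circle the derivative is itself an integral against the squared Cauchy kernel, and this
    integral may be differentiated once more. *)
Lemma holo_cd (S : R) (f : C -> C) : holo S f -> holo S (cd f).
Proof.
  intros Hf z Hz. pose proof (Cmod_ge_0 z).
  set (r := (Cmod z + S) / 2).
  assert (Hr : 0 < r < S) by (unfold r; lra). assert (Hzr : Cmod z < r) by (unfold r; lra).
  set (psi := fun t => (f (circ r t) * circ r t)%C).
  exists (/ RtoC (2 * PI) * CI (fun t => 2 * psi t / ((circ r t - z) * (circ r t - z) * (circ r t - z)))%C 0 (2 * PI))%C.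
  apply cderiv_ext_loc with (fun z => / RtoC (2 * PI) * CI (fun t => psi t / ((circ r t - z) * (circ r t - z)))%C 0 (2 * PI))%C.
  - generalize (cnbhd_lt _ _ Hzr). apply filter_imp. intros w Hw. unfold psi.
    rewrite (cauchy_formula_cd S) by auto. field. apply RtoC_2PI_neq.
  - apply cderiv_scal, cauchy_transform2_deriv; [lra| |assumption].
    intros t. unfold psi. lims. apply (circ_comp_cont S r f); auto.
Qed.

Lemma entire_cderiv (f : C -> C) : entire f <-> forall z, exists d, cderiv f z d.
Proof.
  split.
  - intros H z. destruct (H z) as [d Hd]. exists d. now apply is_derive_cderiv.
  - intros H z. destruct (H z) as [d Hd]. exists d. now apply is_derive_cderiv.
Qed.

Lemma entire_holo (f : C -> C) (S : R) : entire f -> holo S f.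
Proof. intros H z _. now apply entire_cderiv. Qed.

Lemma entire_cd (f : C -> C) (z : C) : entire f -> cderiv f z (cd f z).
Proof. intros H. apply cd_spec. now apply entire_cderiv. Qed.

Lemma entire_holo_all (f : C -> C) : (forall S, holo S f) -> entire f.
Proof. intros H. apply entire_cderiv. intros z. apply (H (Cmod z + 1)). lra. Qed.

(** A weak substitute for the maximum principle: Cauchy's integral estimated directly, with the
    factor 2 of [CI_bound]. *)
Lemma cauchy_sup_bound (S r M : R) (f : C -> C) (z : C) :
  holo S f -> 0 < r < S -> Cmod z < r -> (forall t, 0 <= t <= 2 * PI -> Cmod (f (circ r t)) <= M) ->
  Cmod (f z) <= 2 * M * r / (r - Cmod z).
Proof.
  intros Hf Hr Hz HM. pose proof PI_RGT_0.
  pose proof (cauchy_formula S r f z Hf Hr Hz) as E. apply (f_equal Cmod) in E.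
  rewrite Cmod_mult, Cmod_R, Rabs_pos_eq in E by lra.
  assert (B : Cmod (CI (fun t => f (circ r t) * circ r t / (circ r t - z))%C 0 (2 * PI))
    <= 2 * (M * r * / (r - Cmod z)) * Rabs (2 * PI - 0)).
  { apply CI_bound.
    - apply exCI_rcont. intros t. lims; [apply (circ_comp_cont S r f); auto | apply circ_neq; lra].
    - intros t Ht. rewrite Rmin_left, Rmax_right in Ht by lra.
      rewrite Cmod_div by (apply circ_neq; lra). rewrite Cmod_mult, Cmod_circ by lra.
      apply Rmult_le_compat.
      + apply Rmult_le_pos; [apply Cmod_ge_0|lra].
      + left. apply Rinv_0_lt_compat, Cmod_gt_0, circ_neq; lra.
      + apply Rmult_le_compat_r; [lra | now apply HM].
      + apply Rinv_le_contravar; [lra | apply circ_dist; lra]. }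
  rewrite E, Rminus_0_r, (Rabs_pos_eq (2 * PI)) in B by lra.
  apply (Rmult_le_reg_l (2 * PI)); [lra|]. unfold Rdiv. lra.
Qed.

(** * Zeros of entire functions *)

(** Away from [x] the quotient is [f z / (z - x)]. Near [x] it is the Cauchy transform [K] of
    [f w / (w - x)]: since [(z - x) / ((w - z) (w - x)) = 1 / (w - z) - 1 / (w - x)], Cauchy's
    formula gives [(z - x) K z = f z - f x], and [f x = 0]. *)
Lemma entire_factor (f : C -> C) (x : C) : entire f -> f x = 0%C ->
  exists q, entire q /\ forall z, f z = ((z - x) * q z)%C.
Proof.
  intros Hf Hx.
  set (r := Cmod x + 1). assert (Hr : 0 < r) by (pose proof (Cmod_ge_0 x); unfold r; lra).
  assert (Hxr : Cmod x < r) by (unfold r; lra).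
  assert (Hhf : holo (r + 1) f) by now apply entire_holo.
  assert (NZ : forall t z, Cmod z < r -> (circ r t - z)%C <> 0%C) by (intros; apply circ_neq; lra).
  set (psi := fun t => (f (circ r t) * circ r t / (circ r t - x))%C).
  assert (Cpsi : forall t, rcont psi t).
  { intros t. unfold psi. lims; [apply (circ_comp_cont (r + 1) r f); auto; lra | now apply NZ]. }
  set (K := fun z => (/ RtoC (2 * PI) * CI (fun t => psi t / (circ r t - z)) 0 (2 * PI))%C).
  assert (Dec : forall z, {z = x} + {z <> x}) by (intros; apply excluded_middle_informative).
  set (q := fun z => if Dec z then K x else (f z / (z - x))%C).
  assert (E : forall z, z <> x -> (z - x)%C <> 0%C).
  { intros z N E. apply N. replace z with (z - x + x)%C by ring. rewrite E. ring. }
  assert (KE : forall z, Cmod z < r -> f z = ((z - x) * K z)%C).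
  { intros z Hz.
    pose proof (cauchy_formula (r + 1) r f z Hhf ltac:(lra) Hz) as F1.
    pose proof (cauchy_formula (r + 1) r f x Hhf ltac:(lra) Hxr) as F2. rewrite Hx in F2.
    assert (F3 : ((z - x) * CI (fun t => psi t / (circ r t - z)) 0 (2 * PI) = RtoC (2 * PI) * f z)%C).
    { rewrite <- CI_scal by (apply exCI_rcont; intros; apply cauchy_transform_cont; auto).
      replace (RtoC (2 * PI) * f z)%C with (RtoC (2 * PI) * f z - RtoC (2 * PI) * 0)%C by ring.
      rewrite <- F1, <- F2, <- CI_minus.
      - apply CI_ext. intros t _. unfold psi. field. split; now apply NZ.
      - apply exCI_rcont. intros t. lims; [apply (circ_comp_cont (r + 1) r f); auto; lra | now apply NZ].
      - apply exCI_rcont. exact Cpsi. }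
    unfold K. replace ((z - x) * (/ RtoC (2 * PI) * CI (fun t => psi t / (circ r t - z)) 0 (2 * PI)))%C
      with (/ RtoC (2 * PI) * ((z - x) * CI (fun t => psi t / (circ r t - z)) 0 (2 * PI)))%C by ring.
    rewrite F3. field. apply RtoC_2PI_neq. }
  exists q. split.
  - apply entire_cderiv. intros z. destruct (Dec z) as [->|N].
    + eexists. apply cderiv_ext_loc with K.
      * generalize (cnbhd_lt x r Hxr). apply filter_imp. intros w Hw. unfold q.
        destruct (Dec w) as [->|N]; [reflexivity|]. rewrite KE by assumption. field. now apply E.
      * apply cderiv_scal, cauchy_transform_deriv; auto.
    + destruct (proj1 (entire_cderiv f) Hf z) as [d Hd].
      eexists. apply cderiv_ext_loc with (fun w => f w * / (w - x))%C.
      * exists (Cmod (z - x)). split; [apply Cmod_gt_0; now apply E|]. intros w Hw. unfold q.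
        destruct (Dec w) as [->|N']; [|reflexivity]. exfalso.
        replace (x - z)%C with (- (z - x))%C in Hw by ring. rewrite Cmod_opp in Hw. lra.
      * apply cderiv_mult; [exact Hd|]. apply (cderiv_inv (fun w => w - x)%C); [now apply E|].
        apply cderiv_minus; [apply cderiv_id | apply cderiv_const].
  - intros z. unfold q. destruct (Dec z) as [->|N].
    + rewrite Hx. ring.
    + field. now apply E.
Qed.

(** A multiple zero is repeated in the list. *)
Definition prod_roots (L : list C) (z : C) : C := fold_right (fun x p => (z - x) * p)%C 1%C L.

Lemma prod_roots_ge (L : list C) (z : C) (a : R) : 0 <= a ->
  (forall x, In x L -> a <= Cmod (z - x)%C) -> a ^ length L <= Cmod (prod_roots L z).
Proof.
  intros Ha. induction L as [|x L IH]; intros H; cbn.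
  - rewrite Cmod_1. lra.
  - rewrite Cmod_mult. apply Rmult_le_compat; [lra | now apply pow_le | apply H; now left |].
    apply IH. intros; apply H; now right.
Qed.

Lemma prod_roots_le (L : list C) (z : C) (b : R) :
  (forall x, In x L -> Cmod (z - x)%C <= b) -> Cmod (prod_roots L z) <= b ^ length L.
Proof.
  induction L as [|x L IH]; intros H; cbn.
  - rewrite Cmod_1. lra.
  - rewrite Cmod_mult. apply Rmult_le_compat; [apply Cmod_ge_0 | apply Cmod_ge_0 | apply H; now left |].
    apply IH. intros; apply H; now right.
Qed.

Lemma prod_roots_neq (L : list C) (z : C) : (forall x, In x L -> z <> x) -> prod_roots L z <> 0%C.
Proof.
  induction L as [|x L IH]; intros H; cbn.
  - intro E. apply RtoC_inj in E. lra.
  - apply Cmult_neq_0; [|apply IH; intros; apply H; now right].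
    intro E. apply (H x); [now left|]. replace z with (z - x + x)%C by ring. rewrite E. ring.
Qed.

Lemma prod_roots_root (L : list C) (z : C) : In z L -> prod_roots L z = 0%C.
Proof.
  induction L as [|x L IH]; cbn [In]; [tauto|].
  change (prod_roots (x :: L) z) with ((z - x) * prod_roots L z)%C.
  intros [->|H]; [ring|]. rewrite IH by assumption. ring.
Qed.

Lemma INR_le_pow2 (n : nat) : INR n <= 2 ^ n.
Proof.
  induction n as [|n IH]; [cbn; lra|]. rewrite S_INR. cbn.
  pose proof (pow_R1_Rle 2 n ltac:(lra)). lra.
Qed.

(** On a large circle every factor [z - x] is at least [s] in modulus, at [z0] it is at most
    [s / 2]. So each zero split off halves the resulting upper bound for [|f z0|], a fixed positive
    number. *)
Lemma zero_count_bounded (f : C -> C) (z0 : C) (R : R) : entire f -> f z0 <> 0%C -> 0 <= R ->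
  exists N : nat, forall L h, entire h -> (forall z, f z = prod_roots L z * h z)%C ->
    (forall x, In x L -> Cmod x <= R) -> (length L <= N)%nat.
Proof.
  intros Hf Hz0 HR. pose proof (Cmod_ge_0 z0). pose proof PI_RGT_0.
  (* Chosen so that [s = r - R] satisfies [|z0| + R <= s / 2]. *)
  set (r := 2 * Cmod z0 + 3 * R + 1). set (s := r - R).
  assert (Hs : 0 < s) by (unfold s, r; lra).
  destruct (rcont_bounded (fun t => f (circ r t)) 0 (2 * PI) ltac:(lra)) as (M & HM & Bd).
  { intros t. apply (circ_comp_cont (r + 1)); [now apply entire_holo | unfold r; lra]. }
  assert (Bd' : forall t, 0 <= t <= 2 * PI -> Cmod (f (circ r t)) <= M) by exact Bd.
  assert (P0 : 0 < Cmod (f z0)) by now apply Cmod_gt_0.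
  set (K := 2 * M * r / ((r - Cmod z0) * Cmod (f z0))).
  destruct (INR_unbounded K) as [N HN].
  exists N. intros L h Hh Fac HL. apply INR_le. left. apply Rle_lt_trans with K; [|exact HN].
  apply Rle_trans with (2 ^ length L); [apply INR_le_pow2|].
  set (n := length L).
  assert (Hsn : 0 < s ^ n) by now apply pow_lt.
  assert (Hw : forall t, 0 <= t <= 2 * PI -> Cmod (h (circ r t)) <= M / s ^ n).
  { intros t Ht. apply (Rmult_le_reg_r (s ^ n)); auto.
    unfold Rdiv. rewrite Rmult_assoc, Rinv_l, Rmult_1_r by lra.
    eapply Rle_trans; [|apply (Bd' t Ht)]. rewrite Fac, Cmod_mult, Rmult_comm.
    apply Rmult_le_compat_r; [apply Cmod_ge_0|]. apply prod_roots_ge; [lra|].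
    intros x Hx. pose proof (HL x Hx). pose proof (circ_dist r t x ltac:(unfold r; lra)). unfold s. lra. }
  assert (Bh : Cmod (h z0) <= 2 * (M / s ^ n) * r / (r - Cmod z0)).
  { apply (cauchy_sup_bound (r + 1)); [now apply entire_holo | unfold r; lra | unfold r; lra | exact Hw]. }
  assert (F0 : Cmod (f z0) <= (s / 2) ^ n * (2 * (M / s ^ n) * r / (r - Cmod z0))).
  { rewrite Fac, Cmod_mult. apply Rmult_le_compat; [apply Cmod_ge_0 | apply Cmod_ge_0 | | exact Bh].
    apply prod_roots_le. intros x Hx. pose proof (HL x Hx).
    eapply Rle_trans; [apply Cmod_triangle|]. rewrite Cmod_opp. unfold s, r. lra. }
  assert (Hrz : 0 < r - Cmod z0) by (unfold r; lra).
  assert (P2 : 0 < 2 ^ n) by (apply pow_lt; lra).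
  replace ((s / 2) ^ n * (2 * (M / s ^ n) * r / (r - Cmod z0))) with (2 * M * r / (r - Cmod z0) / 2 ^ n) in F0.
  2:{ replace ((s / 2) ^ n) with (s ^ n / 2 ^ n) by (unfold Rdiv; now rewrite Rpow_mult_distr, pow_inv). field. repeat split; lra. }
  unfold K. apply (Rmult_le_reg_r (Cmod (f z0) / 2 ^ n)); [now apply Rdiv_lt_0_compat|].
  replace (2 ^ n * (Cmod (f z0) / 2 ^ n)) with (Cmod (f z0)) by (field; lra).
  replace (2 * M * r / ((r - Cmod z0) * Cmod (f z0)) * (Cmod (f z0) / 2 ^ n)) with (2 * M * r / (r - Cmod z0) / 2 ^ n) by (field; repeat split; lra).
  exact F0.
Qed.

(** If the cofactor always kept a zero in the closed disc, zeros could be split off forever, against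
    [zero_count_bounded]. *)
Lemma zero_factorization (f : C -> C) (z0 : C) (R : R) : entire f -> f z0 <> 0%C -> 0 <= R ->
  exists L h, entire h /\ (forall z, f z = prod_roots L z * h z)%C /\
    (forall x, In x L -> Cmod x <= R) /\ (forall z, Cmod z <= R -> h z <> 0%C).
Proof.
  intros Hf Hz0 HR. apply NNPP. intro N.
  destruct (zero_count_bounded f z0 R Hf Hz0 HR) as [n Hn].
  assert (A : forall m, exists L h, length L = m /\ entire h /\ (forall z, f z = prod_roots L z * h z)%C /\
    (forall x, In x L -> Cmod x <= R)).
  { induction m as [|m (L & h & Hm & Hh & Fac & HL)].
    - exists [], f. repeat split; auto; [|cbn; tauto]. intros z. cbn. ring.
    - assert (Ex : exists x, Cmod x <= R /\ h x = 0%C).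
      { apply NNPP. intro Ne. apply N. exists L, h. repeat split; auto.
        intros z Hz E. apply Ne. eauto. }
      destruct Ex as (x & Hx & E). destruct (entire_factor h x Hh E) as (q & Hq & Fq).
      exists (x :: L), q. repeat split; auto.
      + cbn. congruence.
      + intros z. rewrite Fac, Fq. change (prod_roots (x :: L) z) with ((z - x) * prod_roots L z)%C. ring.
      + intros y [<-|Hy]; auto. }
  destruct (A (Datatypes.S n)) as (L & h & Hm & Hh & Fac & HL). specialize (Hn L h Hh Fac HL). lia.
Qed.

(** * Holomorphic logarithms and the Poisson-Jensen estimates *)

Lemma is_derive_ln_hypot (x y : R -> R) (t a b : R) :
  is_derive x t a -> is_derive y t b -> 0 < x t ^ 2 + y t ^ 2 ->
  is_derive (fun u => ln (sqrt (x u ^ 2 + y u ^ 2))) t ((a * x t + b * y t) / (x t ^ 2 + y t ^ 2)).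
Proof.
  intros Hx Hy P.
  pose proof (sqrt_lt_R0 _ P) as Q. pose proof (sqrt_sqrt _ (Rlt_le _ _ P)) as SS.
  assert (D : is_derive (fun u => x u ^ 2 + y u ^ 2) t (2 * (a * x t + b * y t))).
  { pose proof (is_derive_plus _ _ _ _ _ (is_derive_pow x 2 t a Hx) (is_derive_pow y 2 t b Hy)) as D.
    refine (eq_ind _ (fun l => is_derive (fun u => x u ^ 2 + y u ^ 2) t l) D _ _). unfold plus. cbn. ring. }
  assert (E : is_derive (fun v => ln (sqrt v)) (x t ^ 2 + y t ^ 2) (/ (2 * (x t ^ 2 + y t ^ 2)))).
  { auto_derive; [auto|]. set (q := sqrt _) in *. rewrite <- SS. field. lra. }
  pose proof (is_derive_comp (fun v => ln (sqrt v)) (fun u => x u ^ 2 + y u ^ 2) t _ _ E D) as F.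
  refine (eq_ind _ (fun l => is_derive _ t l) F _ _). unfold scal. cbn. unfold mult. cbn. field. cbn in P. lra.
Qed.

Lemma ln_Cmod_deriv (g : R -> C) (t : R) (v : C) : g t <> 0%C -> rderiv g t v ->
  is_derive (fun u => ln (Cmod (g u))) t (fst (v / g t)%C).
Proof.
  intros N H. apply rderiv_fst_snd in H. destruct H as [Hx Hy].
  assert (P : 0 < fst (g t) ^ 2 + snd (g t) ^ 2).
  { apply Cmod_gt_0 in N. pose proof (Cmod_sqr (g t)). nra. }
  replace (fst (v / g t)%C) with ((fst v * fst (g t) + snd v * snd (g t)) / (fst (g t) ^ 2 + snd (g t) ^ 2)).
  2:{ cbn. field. cbn in P. lra. }
  exact (is_derive_ln_hypot (fun u => fst (g u)) (fun u => snd (g u)) t _ _ Hx Hy P).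
Qed.

Lemma segment_lt (S s : R) (z : C) : Cmod z < S -> 0 <= s <= 1 -> Cmod (0 + RtoC s * z)%C < S.
Proof.
  intros Hz Hs. rewrite Cplus_0_l, Cmod_mult, Cmod_R, Rabs_pos_eq by lra.
  pose proof (Cmod_ge_0 z). assert (s * Cmod z <= 1 * Cmod z) by (apply Rmult_le_compat_r; lra). lra.
Qed.

(** [g] is a primitive of [k' / k]. Its real part and [ln |k|] have the same derivative along the
    segment from 0 to [z], so they agree once they agree at 0. Only the real part of the logarithm
    is identified, which is what the Schwarz formula takes as input. *)
Lemma holo_log (S : R) (k : C -> C) :
  holo S k -> (forall z, Cmod z < S -> k z <> 0%C) ->
  exists g, holo S g /\ (forall z, Cmod z < S -> cderiv g z (cd k z / k z)%C) /\
    forall z, Cmod z < S -> fst (g z) = ln (Cmod (k z)).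
Proof.
  intros Hk NZ.
  assert (Hq : holo S (fun z => cd k z / k z)%C).
  { intros z Hz. destruct (holo_cd S k Hk z Hz) as [d Hd].
    eexists. apply cderiv_mult; [exact Hd|]. apply cderiv_inv; [now apply NZ | apply cd_spec, Hk, Hz]. }
  set (q := fun z => (cd k z / k z)%C) in *.
  (* The constant that makes the real part right at 0. *)
  set (c := ln (Cmod (k 0%C)) - fst (cprimitive q 0%C)).
  assert (D : forall z, Cmod z < S -> cderiv (fun z => cprimitive q z + RtoC c)%C z (q z)).
  { intros z Hz. replace (q z) with (q z + 0)%C by ring.
    apply cderiv_plus; [eapply cprimitive_deriv; eauto | apply cderiv_const]. }
  exists (fun z => cprimitive q z + RtoC c)%C. split; [intros z Hz; eauto|]. split; [exact D|].
  intros z Hz.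
  set (phi := fun s => fst (cprimitive q (0 + RtoC s * z)%C) - ln (Cmod (k (0 + RtoC s * z)%C))).
  assert (E : phi 0 = phi 1).
  { apply (eq_is_derive (V := R_NormedModule) phi 0 1); [|lra]. intros s Hs.
    pose proof (segment_lt S s z Hz Hs) as In.
    assert (D1 : is_derive (fun s => fst (cprimitive q (0 + RtoC s * z)%C)) s (fst (q (0 + RtoC s * z) * z)%C)).
    { apply (rderiv_fst_snd (fun s => cprimitive q (0 + RtoC s * z)%C)).
      apply rderiv_along_line. eapply cprimitive_deriv; eauto. }
    assert (D2 : is_derive (fun s => ln (Cmod (k (0 + RtoC s * z)%C))) s (fst (cd k (0 + RtoC s * z) * z / k (0 + RtoC s * z))%C)).
    { apply (ln_Cmod_deriv (fun s => k (0 + RtoC s * z)%C)); [now apply NZ|].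
      apply rderiv_along_line. apply cd_spec, Hk, In. }
    pose proof (is_derive_minus _ _ _ _ _ D1 D2) as Q.
    refine (eq_ind _ (fun l => is_derive phi s l) Q _ _).
    change (fst (q (0 + RtoC s * z) * z)%C - fst (cd k (0 + RtoC s * z) * z / k (0 + RtoC s * z))%C = 0).
    replace (cd k (0 + RtoC s * z) * z / k (0 + RtoC s * z))%C with (q (0 + RtoC s * z) * z)%C; [ring|].
    unfold q. field. now apply NZ. }
  unfold phi in E. replace (0 + RtoC 0 * z)%C with (RtoC 0) in E by ring.
  replace (0 + RtoC 1 * z)%C with z in E by ring.
  change (fst (cprimitive q z) + c = ln (Cmod (k z))). unfold c. lra.
Qed.

Lemma cauchy_mean_value (S r : R) (f : C -> C) : holo S f -> 0 < r < S ->
  CI (fun t => f (circ r t)) 0 (2 * PI) = (RtoC (2 * PI) * f 0)%C.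
Proof.
  intros Hf Hr. rewrite <- (cauchy_formula S r f 0%C) by (auto; rewrite Cmod_0; lra).
  apply CI_ext. intros t _. field. replace (circ r t - 0)%C with (circ r t) by ring.
  apply Cmod_gt_0. rewrite Cmod_circ; lra.
Qed.

(* The conjugate of [g] contributes nothing to Cauchy's formula for [g'], since on the circle
   [conj w = r^2 / w] turns its kernel into the conjugate of a function holomorphic on the disc. *)
Lemma schwarz_derivative (S r : R) (g : C -> C) (z : C) : holo S g -> 0 < r < S -> Cmod z < r ->
  CI (fun t => RtoC (2 * fst (g (circ r t))) * circ r t / ((circ r t - z) * (circ r t - z)))%C 0 (2 * PI)
  = (RtoC (2 * PI) * cd g z)%C.
Proof.
  intros Hg Hr Hz. destruct (reflect_radius_spec r z Hz) as [Hrr NZ].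
  assert (NC : forall t, (circ r t - z)%C <> 0%C) by (intros; apply circ_neq; lra).
  set (D := fun w => (RtoC (r * r) - Cconj z * w)%C) in *.
  set (Q := fun w => (w * g w * (RtoC (r * r) / (D w * D w)))%C).
  set (S' := Rmin S (reflect_radius r z)).
  assert (HS' : r < S') by (apply Rmin_glb_lt; lra).
  assert (HQ : holo S' Q).
  { intros w Hw. assert (W1 : Cmod w < S) by (eapply Rlt_le_trans; [exact Hw | apply Rmin_l]).
    assert (W2 : Cmod w < reflect_radius r z) by (eapply Rlt_le_trans; [exact Hw | apply Rmin_r]).
    destruct (Hg w W1) as [d Hd].
    assert (D1 : cderiv D w (0 - Cconj z * 1)%C).
    { apply cderiv_minus; [apply cderiv_const | apply cderiv_scal, cderiv_id]. }
    eexists. apply cderiv_mult; [apply cderiv_mult; [apply cderiv_id | exact Hd]|].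
    apply cderiv_scal. apply (cderiv_inv (fun w => D w * D w)%C); [apply Cmult_neq_0; now apply NZ|].
    apply cderiv_mult; exact D1. }
  pose proof (cauchy_mean_value S' r Q HQ ltac:(lra)) as M.
  assert (CQ : forall t, rcont (fun t => Q (circ r t)) t) by (intros; apply (circ_comp_cont S'); [assumption|lra]).
  assert (M' : CI (fun t => Cconj (Q (circ r t))) 0 (2 * PI) = 0%C).
  { rewrite CI_conj, M by now apply exCI_rcont. unfold Q. apply injective_projections; cbn; ring. }
  assert (Cg : forall t, rcont (fun t => g (circ r t)) t) by (intros; eapply circ_comp_cont; eauto).
  rewrite <- (cauchy_formula_cd S r g z) by auto.
  match goal with |- _ = ?X => replace X with (X + 0)%C by ring end.
  rewrite <- M', <- CI_plus.
  - apply CI_ext. intros t _. unfold Q.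
    assert (Nw : circ r t <> 0%C) by (apply Cmod_gt_0; rewrite Cmod_circ; lra).
    assert (Nc : Cconj (circ r t) <> 0%C) by (apply Cmod_gt_0; rewrite Cmod_conj; now apply Cmod_gt_0).
    assert (ND : D (circ r t) <> 0%C) by (apply NZ; rewrite Cmod_circ; lra).
    assert (CD : Cconj (D (circ r t)) = ((circ r t - z) * Cconj (circ r t))%C).
    { unfold D. rewrite Cminus_conj, Cmult_conj, Cconj_conj.
      replace (Cconj (RtoC (r * r))) with (RtoC (r * r)) by (apply injective_projections; cbn; ring).
      rewrite <- (circ_conj r t). ring. }
    assert (E2 : RtoC (2 * fst (g (circ r t))) = (g (circ r t) + Cconj (g (circ r t)))%C).
    { apply injective_projections; cbn; ring. }
    rewrite E2, !Cmult_conj, Cdiv_conj, Cmult_conj, CD by now apply Cmult_neq_0.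
    replace (Cconj (RtoC (r * r))) with (RtoC (r * r)) by (apply injective_projections; cbn; ring).
    rewrite <- (circ_conj r t). field. auto.
  - apply exCI_rcont. intros t. lims; [apply Cg | now apply Cmult_neq_0].
  - now apply exCI_conj, exCI_rcont.
Qed.

Lemma ln_le_logp (x : R) : ln x <= logp x.
Proof. apply Rmax_r. Qed.

Lemma abs_ln_logp (x : R) : Rabs (ln x) = 2 * logp x - ln x.
Proof. unfold logp, Rmax, Rabs. destruct (Rle_dec 0 (ln x)), (Rcase_abs (ln x)); lra. Qed.

Lemma ln_Cmod_circ_cont (S r t : R) (k : C -> C) :
  holo S k -> (forall z, Cmod z < S -> k z <> 0%C) -> 0 < r < S ->
  continuous (fun t => ln (Cmod (k (circ r t)))) t.
Proof.
  intros Hk NZ Hr. apply continuous_comp with (g := ln).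
  - apply (clim_Cmod (locally t)). eapply circ_comp_cont; eauto.
  - apply continuity_pt_filterlim, derivable_continuous_pt.
    eexists. apply derivable_pt_lim_ln, Cmod_gt_0, NZ. rewrite Cmod_circ; lra.
Qed.

Lemma continuous_logp_of_ln (u : R -> R) (t : R) :
  continuous (fun t => ln (u t)) t -> continuous (fun t => logp (u t)) t.
Proof.
  intros H. unfold logp.
  apply (continuous_ext (fun t => (ln (u t) + Rabs (ln (u t))) / 2)).
  { intros s. unfold Rmax, Rabs. destruct (Rle_dec 0 (ln (u s))), (Rcase_abs (ln (u s))); lra. }
  apply (continuous_comp (fun t => ln (u t)) (fun x => (x + Rabs x) / 2)); [exact H|].
  apply continuity_pt_filterlim. reg.
Qed.

(** The mean of [ln |k|] over the circle is [ln |k 0|], because [ln |k|] is the real part of a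
    holomorphic function; hence the mean of its absolute value is [2 prox k r - ln |k 0|]. In the
    Schwarz formula for [k' / k] the kernel [r / |w - z|^2] is at most [4 / r]; a factor 2 from the
    formula and another from [CI_norm_le] make 16. *)
Lemma nonvanishing_log_derivative (S r : R) (k : C -> C) :
  holo S k -> (forall z, Cmod z < S -> k z <> 0%C) -> 0 < r < S ->
  ln (Cmod (k 0%C)) <= prox k r /\
  forall z, Cmod z <= r / 2 -> Cmod (cd k z / k z)%C <= 16 * (2 * prox k r - ln (Cmod (k 0%C))) / r.
Proof.
  intros Hk NZ Hr. pose proof PI_RGT_0.
  destruct (holo_log S k Hk NZ) as (g & Hg & Dg & Rg).
  assert (In : forall t, Cmod (circ r t) < S) by (intros; rewrite Cmod_circ; lra).
  set (u := fun t => ln (Cmod (k (circ r t)))).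
  set (p := fun t => logp (Cmod (k (circ r t)))).
  assert (Cu : forall t, continuous u t) by (intros; eapply ln_Cmod_circ_cont; eauto).
  assert (Cp : forall t, continuous p t) by (intros; apply continuous_logp_of_ln, Cu).
  assert (Iu : ex_RInt u 0 (2 * PI)) by (apply (ex_RInt_continuous (V := R_CompleteNormedModule)); auto).
  assert (Ip : ex_RInt p 0 (2 * PI)) by (apply (ex_RInt_continuous (V := R_CompleteNormedModule)); auto).
  assert (Pp : RInt p 0 (2 * PI) = 2 * PI * prox k r).
  { change (RInt p 0 (2 * PI) = 2 * PI * (/ (2 * PI) * RInt p 0 (2 * PI))).
    symmetry. rewrite <- Rmult_assoc, Rinv_r by lra. apply Rmult_1_l. }
  assert (Pu : RInt u 0 (2 * PI) = 2 * PI * ln (Cmod (k 0%C))).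
  { pose proof (cauchy_mean_value S r g Hg Hr) as M. apply (f_equal fst) in M.
    rewrite fst_CI in M.
    rewrite <- Rg by (rewrite Cmod_0; lra).
    transitivity (RInt (fun t => fst (g (circ r t))) 0 (2 * PI)).
    - apply RInt_ext. intros t _. unfold u. now rewrite Rg.
    - rewrite M. cbn. ring. }
  split.
  - apply (Rmult_le_reg_l (2 * PI)); [lra|]. rewrite <- Pu, <- Pp.
    apply RInt_le; auto; [lra|]. intros t _. apply ln_le_logp.
  - intros z Hz. pose proof (Cmod_ge_0 z). assert (Hzr : Cmod z < r) by lra.
    assert (Ia : RInt (fun t => Rabs (u t)) 0 (2 * PI) = 2 * PI * (2 * prox k r - ln (Cmod (k 0%C)))).
    { transitivity (RInt (fun t => 2 * p t - u t) 0 (2 * PI)).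
      - apply RInt_ext. intros t _. apply abs_ln_logp.
      - transitivity (2 * RInt p 0 (2 * PI) - RInt u 0 (2 * PI)).
        + assert (Sc : RInt (fun t => 2 * p t) 0 (2 * PI) = 2 * RInt p 0 (2 * PI))
            by (exact (RInt_scal (V := R_CompleteNormedModule) p 0 (2 * PI) 2 Ip)).
          rewrite <- Sc.
          apply (RInt_minus (V := R_CompleteNormedModule) (fun t => 2 * p t) u); auto.
          now apply (@ex_RInt_scal R_NormedModule).
        + rewrite Pp, Pu. match goal with |- @eq _ ?x ?y => change (@eq R x y) end. ring. }
    assert (Iab : ex_RInt (fun t => Rabs (u t)) 0 (2 * PI)) by now apply ex_RInt_norm.
    assert (Hcd : cd g z = (cd k z / k z)%C) by (apply cd_eq, Dg; lra).
    rewrite <- Hcd.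
    pose proof (schwarz_derivative S r g z Hg Hr Hzr) as E. apply (f_equal Cmod) in E.
    rewrite Cmod_mult, Cmod_R, Rabs_pos_eq in E by lra.
    assert (NC : forall t, (circ r t - z)%C <> 0%C) by (intros; apply circ_neq; lra).
    assert (B : 2 * PI * Cmod (cd g z) <= 2 * RInt (fun t => 8 / r * Rabs (u t)) 0 (2 * PI)).
    { rewrite <- E. apply CI_norm_le; [lra | | now apply (@ex_RInt_scal R_NormedModule) |].
      - apply exCI_rcont. intros t. lims; [|now apply Cmult_neq_0].
        apply (clim_pair _ (fun t => 2 * fst (g (circ r t))) (fun _ => 0)); [|apply filterlim_const].
        apply (continuous_scal_r (K := R_AbsRing) (V := R_NormedModule) 2 (fun t => fst (g (circ r t)))).
        apply (clim_fst _ (fun t => g (circ r t))). eapply circ_comp_cont; eauto.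
      - intros t. rewrite Cmod_div, !Cmod_mult, Cmod_R, Cmod_circ by (try apply Cmult_neq_0; auto; lra).
        rewrite Rg by apply In. fold (u t). rewrite Rabs_mult, (Rabs_pos_eq 2) by lra.
        pose proof (circ_dist r t z ltac:(lra)) as Dd. set (m := Cmod (circ r t - z)) in *.
        assert (r / 2 <= m) by lra. pose proof (Rabs_pos (u t)).
        assert (r / 2 * (r / 2) <= m * m) by (apply Rmult_le_compat; lra).
        apply (Rmult_le_reg_r (m * m)); [nra|].
        unfold Rdiv at 1. rewrite Rmult_assoc, Rinv_l by nra.
        replace (2 * Rabs (u t) * r * 1) with (8 / r * Rabs (u t) * (r / 2 * (r / 2))) by (field; lra).
        apply Rmult_le_compat_l; [|assumption]. apply Rmult_le_pos; auto.
        left. apply Rdiv_lt_0_compat; lra. }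
    assert (Es : RInt (fun t => 8 / r * Rabs (u t)) 0 (2 * PI) = 8 / r * RInt (fun t => Rabs (u t)) 0 (2 * PI))
      by (exact (RInt_scal (V := R_CompleteNormedModule) (fun t => Rabs (u t)) 0 (2 * PI) (8 / r) Iab)).
    rewrite Es, Ia in B.
    apply (Rmult_le_reg_l (2 * PI)); [lra|].
    replace (2 * PI * (16 * (2 * prox k r - ln (Cmod (k 0%C))) / r))
      with (2 * (8 / r * (2 * PI * (2 * prox k r - ln (Cmod (k 0%C)))))) by (field; lra).
    exact B.
Qed.

(** * Sums over zeros and Blaschke factors *)

Definition lsum (F : C -> R) (L : list C) : R := fold_right (fun x s => F x + s) 0 L.

Lemma lsum_cons (F : C -> R) (x : C) (L : list C) : lsum F (x :: L) = F x + lsum F L.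
Proof. reflexivity. Qed.

Lemma lsum_app (F : C -> R) (L M : list C) : lsum F (L ++ M) = lsum F L + lsum F M.
Proof. induction L as [|x L IH]; [change (lsum F M = 0 + lsum F M); ring|]. cbn [app]. rewrite !lsum_cons, IH. ring. Qed.

Lemma lsum_le (F G : C -> R) (L : list C) : (forall x, In x L -> F x <= G x) -> lsum F L <= lsum G L.
Proof.
  induction L as [|x L IH]; intros H; [cbn; lra|]. rewrite !lsum_cons.
  pose proof (H x (or_introl eq_refl)). pose proof (IH (fun y Hy => H y (or_intror Hy))). lra.
Qed.

Lemma lsum_scal (c : R) (F : C -> R) (L : list C) : lsum (fun x => c * F x) L = c * lsum F L.
Proof. induction L as [|x L IH]; [cbn; ring|]. rewrite !lsum_cons, IH. ring. Qed.

Lemma lsum_const (c : R) (L : list C) : lsum (fun _ => c) L = INR (length L) * c.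
Proof.
  induction L as [|x L IH]; [cbn; ring|]. rewrite lsum_cons, IH. cbn [length]. rewrite S_INR. ring.
Qed.

Lemma lsum_nonneg (F : C -> R) (L : list C) : (forall x, In x L -> 0 <= F x) -> 0 <= lsum F L.
Proof.
  intros H. replace 0 with (lsum (fun _ => 0) L) by (rewrite lsum_const; ring). now apply lsum_le.
Qed.

Lemma lsum_term_le (F : C -> R) (L : list C) (x : C) :
  (forall x, In x L -> 0 <= F x) -> In x L -> F x <= lsum F L.
Proof.
  induction L as [|y L IH]; intros H; cbn [In]; [tauto|]. rewrite lsum_cons. intros [<-|Hx].
  - pose proof (lsum_nonneg F L (fun y Hy => H y (or_intror Hy))). lra.
  - pose proof (H y (or_introl eq_refl)). pose proof (IH (fun y Hy => H y (or_intror Hy)) Hx). lra.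
Qed.

Lemma ln_le_minus1 (y : R) : 0 < y -> ln y <= y - 1.
Proof. intros Hy. pose proof (exp_ineq1_le (ln y)) as E. rewrite exp_ln in E by assumption. lra. Qed.

Lemma cd_mult (f g : C -> C) (z : C) : entire f -> entire g ->
  cd (fun w => f w * g w)%C z = (cd f z * g z + f z * cd g z)%C.
Proof. intros Hf Hg. apply cd_eq, cderiv_mult; now apply entire_cd. Qed.

Lemma entire_mult (f g : C -> C) : entire f -> entire g -> entire (fun z => f z * g z)%C.
Proof.
  intros Hf Hg. apply entire_cderiv. intros z. eexists. apply cderiv_mult; now apply entire_cd.
Qed.

Lemma entire_linear (a b : C) : entire (fun z => a + b * z)%C.
Proof.
  apply entire_cderiv. intros z. eexists.
  apply cderiv_plus; [apply cderiv_const | apply cderiv_scal, cderiv_id].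
Qed.

Lemma cd_linear (a b z : C) : cd (fun z => a + b * z)%C z = b.
Proof.
  transitivity (0 + b * 1)%C; [|ring]. apply cd_eq.
  apply cderiv_plus; [apply cderiv_const | apply cderiv_scal, cderiv_id].
Qed.

Lemma log_derivative_mult (a b : C) (g : C -> C) (z : C) :
  entire g -> (a + b * z)%C <> 0%C -> g z <> 0%C ->
  (cd (fun z => (a + b * z) * g z) z / ((a + b * z) * g z) = b / (a + b * z) + cd g z / g z)%C.
Proof.
  intros Hg N1 N2. rewrite (cd_mult (fun z => a + b * z)%C g z (entire_linear a b) Hg), cd_linear.
  field. auto.
Qed.

Lemma entire_prod_roots (L : list C) (h : C -> C) : entire h -> entire (fun z => prod_roots L z * h z)%C.
Proof.
  intros Hh. apply entire_mult; [|exact Hh]. induction L as [|x L IH].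
  - apply entire_cderiv. intros z. eexists. apply (cderiv_const 1%C).
  - change (entire (fun z => (z - x) * prod_roots L z)%C). apply entire_mult; [|exact IH].
    replace (fun z : C => z - x)%C with (fun z : C => - x + 1 * z)%C
      by (apply functional_extensionality; intros; ring).
    apply entire_linear.
Qed.

Lemma Cmult_neq_0_l (x y : C) : (x * y)%C <> 0%C -> x <> 0%C.
Proof. intros H ->. apply H. ring. Qed.

Lemma Cmult_neq_0_r (x y : C) : (x * y)%C <> 0%C -> y <> 0%C.
Proof. intros H ->. apply H. ring. Qed.

Lemma Cminus_neq_0 (x y : C) : x <> y -> (x - y)%C <> 0%C.
Proof. intros N E. apply N. replace x with (x - y + y)%C by ring. rewrite E. ring. Qed.

(** An elementary lower bound for [ln (r / |x|)], the contribution of a zero [x] to Jensen's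
    formula; it vanishes for zeros outside the circle. *)
Definition blaschke_weight (r : R) (x : C) : R := Rmax 0 (1 - Cmod x / r).

Lemma blaschke_denominator (r S : R) (x z : C) : 0 < r < S -> Cmod x * S < r * r -> Cmod z < S ->
  (RtoC (r * r) - Cconj x * z)%C <> 0%C.
Proof.
  intros Hr Hx Hz E.
  assert (E' : RtoC (r * r) = (Cconj x * z)%C).
  { replace (Cconj x * z)%C with (RtoC (r * r) - (RtoC (r * r) - Cconj x * z))%C by ring. rewrite E. ring. }
  apply (f_equal Cmod) in E'. rewrite Cmod_mult, Cmod_conj, Cmod_R, Rabs_pos_eq in E' by nra.
  pose proof (Cmod_ge_0 x). pose proof (Cmod_ge_0 z). nra.
Qed.

(** The left side compares the logarithmic derivative of [z - x] with that of
    [(r^2 - conj x z) / r], the factor put in its place below. With [D = r^2 - conj x z] the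
    difference is [(r^2 - |x|^2) / ((z - x) D)], where [|D| >= r^2 / 2] and [r^2 - |x|^2] is at most
    [2 r^2] times the weight. *)
Lemma blaschke_term_bound (r : R) (x z : C) : 0 < r -> Cmod x < r -> Cmod z <= r / 2 -> z <> x ->
  Cmod (1 / (z - x) - (- Cconj x / RtoC r) / ((RtoC (r * r) - Cconj x * z) / RtoC r))%C
  <= 4 * (blaschke_weight r x / Cmod (z - x)%C).
Proof.
  intros Hr Hx Hz N. pose proof (Cmod_ge_0 x). pose proof (Cmod_ge_0 z).
  assert (N1 : (z - x)%C <> 0%C) by now apply Cminus_neq_0.
  assert (Nr : RtoC r <> 0%C) by (intro E; apply RtoC_inj in E; lra).
  set (D := (RtoC (r * r) - Cconj x * z)%C).
  assert (BD : r * r / 2 <= Cmod D).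
  { pose proof (Cmod_triangle D (Cconj x * z)) as T. unfold D in T at 1.
    replace (RtoC (r * r) - Cconj x * z + Cconj x * z)%C with (RtoC (r * r)) in T by ring.
    rewrite Cmod_mult, Cmod_conj, Cmod_R, Rabs_pos_eq in T by nra.
    assert (Cmod x * Cmod z <= r * (r / 2)) by (apply Rmult_le_compat; lra). lra. }
  assert (ND : D <> 0%C) by (apply Cmod_gt_0; nra).
  replace (1 / (z - x) - - Cconj x / RtoC r / (D / RtoC r))%C
    with (RtoC (r * r - Cmod x ^ 2) / ((z - x) * D))%C.
  2:{ replace (RtoC (r * r - Cmod x ^ 2)) with (D + Cconj x * (z - x))%C.
      - field. auto.
      - rewrite RtoC_minus, Cmod2_conj. unfold D. ring. }
  rewrite Cmod_div, Cmod_mult, Cmod_R by now apply Cmult_neq_0.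
  assert (E : r * r - Cmod x ^ 2 = r * (1 - Cmod x / r) * (r + Cmod x)) by (field; lra).
  assert (W : blaschke_weight r x = 1 - Cmod x / r).
  { apply Rmax_right. apply Rmult_le_reg_r with r; [lra|]. replace ((1 - Cmod x / r) * r) with (r - Cmod x) by (field; lra). lra. }
  assert (W0 : 0 <= blaschke_weight r x) by apply Rmax_l.
  rewrite <- W in E. set (lam := blaschke_weight r x) in *.
  assert (P : 0 < Cmod (z - x)) by now apply Cmod_gt_0.
  rewrite E, Rabs_pos_eq by (apply Rmult_le_pos; [apply Rmult_le_pos|]; lra).
  apply (Rmult_le_reg_r (Cmod (z - x) * Cmod D)); [apply Rmult_lt_0_compat; nra|].
  replace (r * lam * (r + Cmod x) / (Cmod (z - x) * Cmod D) * (Cmod (z - x) * Cmod D)) with (r * lam * (r + Cmod x)) by (field; split; nra).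
  replace (4 * (lam / Cmod (z - x)) * (Cmod (z - x) * Cmod D)) with (lam * (4 * Cmod D)) by (field; lra).
  replace (r * lam * (r + Cmod x)) with (lam * (r * (r + Cmod x))) by ring.
  apply Rmult_le_compat_l; nra.
Qed.

(* [k] is [f] divided by the Blaschke factors of its zeros inside the circle of radius [r]. *)
Lemma blaschke_quotient (r S : R) (h : C -> C) (L : list C) : 0 < r < S -> entire h ->
  (forall z, Cmod z < S -> h z <> 0%C) ->
  (forall x, In x L -> Cmod x * S < r * r \/ S <= Cmod x) ->
  (prod_roots L 0 * h 0)%C <> 0%C ->
  exists k, entire k /\ (forall z, Cmod z < S -> k z <> 0%C) /\
    (forall t, Cmod (k (circ r t)) = Cmod (prod_roots L (circ r t) * h (circ r t))%C) /\
    ln (Cmod (prod_roots L 0 * h 0)%C) + lsum (blaschke_weight r) L <= ln (Cmod (k 0%C)) /\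
    forall z, Cmod z <= r / 2 -> (forall x, In x L -> z <> x) ->
      Cmod (cd (fun z => prod_roots L z * h z) z / (prod_roots L z * h z) - cd k z / k z)%C
      <= 4 * lsum (fun x => blaschke_weight r x / Cmod (z - x)%C) L.
Proof.
  intros Hr Hh NZ. induction L as [|x L IH]; intros HL N0.
  - exists h. repeat split; auto.
    + intros t. cbn. f_equal. ring.
    + cbn. rewrite Rplus_0_r. apply Req_le. do 2 f_equal. ring.
    + intros z Hz _.
      replace (fun z => prod_roots [] z * h z)%C with h by (apply functional_extensionality; intros; cbn; ring).
      replace (cd h z / (prod_roots [] z * h z) - cd h z / h z)%C with (RtoC 0).
      * rewrite Cmod_0. cbn. lra.
      * assert (h z <> 0%C) by (apply NZ; lra). change (prod_roots [] z) with (RtoC 1). field. assumption.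
  - set (f1 := fun z => (prod_roots L z * h z)%C).
    assert (E0 : forall z, (prod_roots (x :: L) z * h z)%C = ((- x + 1 * z) * f1 z)%C).
    { intros z. change (prod_roots (x :: L) z) with ((z - x) * prod_roots L z)%C. unfold f1. ring. }
    assert (Ef : (fun z => prod_roots (x :: L) z * h z)%C = (fun z => (- x + 1 * z) * f1 z)%C)
      by (apply functional_extensionality; exact E0).
    rewrite E0 in N0.
    assert (N01 := Cmult_neq_0_l _ _ N0). assert (N02 := Cmult_neq_0_r _ _ N0).
    replace (- x + 1 * 0)%C with (- x)%C in N01 by ring.
    assert (Px : 0 < Cmod x) by (rewrite <- Cmod_opp; now apply Cmod_gt_0).
    destruct IH as (k1 & Hk1 & NZ1 & Bd1 & Ln1 & Dl1); [intros; apply HL; now right | exact N02|].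
    assert (Hf1 : entire f1) by now apply entire_prod_roots.
    assert (F0 : ln (Cmod (prod_roots (x :: L) 0 * h 0)%C) = ln (Cmod x) + ln (Cmod (f1 0%C))).
    { rewrite E0, Cmod_mult. replace (- x + 1 * 0)%C with (- x)%C by ring. rewrite Cmod_opp.
      apply ln_mult; auto. now apply Cmod_gt_0. }
    assert (Dz : forall z, Cmod z <= r / 2 -> (forall y, In y (x :: L) -> z <> y) ->
      (cd (fun z => prod_roots (x :: L) z * h z) z / (prod_roots (x :: L) z * h z) = 1 / (z - x) + cd f1 z / f1 z)%C).
    { intros z Hz Hne. rewrite Ef, E0.
      rewrite log_derivative_mult; auto.
      - replace (- x + 1 * z)%C with (z - x)%C by ring. reflexivity.
      - replace (- x + 1 * z)%C with (z - x)%C by ring. apply Cminus_neq_0, Hne. now left.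
      - apply Cmult_neq_0; [|apply NZ; lra]. apply prod_roots_neq. intros; apply Hne; now right. }
    destruct (HL x (or_introl eq_refl)) as [Hx|Hx].
    + assert (Nr : RtoC r <> 0%C) by (intro E; apply RtoC_inj in E; lra).
      assert (Hxr : Cmod x < r) by nra.
      (* The factor [z - x] is replaced by [A + B z = (r^2 - conj x z) / r], of equal modulus on the
         circle and without zeros where [|z| < S]. At 0 its modulus is [r] instead of [|x|], so
         [ln |k 0|] gains [ln (r / |x|)], at least the weight of [x]. *)
      set (A := RtoC r). set (B := (- Cconj x / RtoC r)%C).
      assert (EAB : forall z, (A + B * z)%C = ((RtoC (r * r) - Cconj x * z) / RtoC r)%C).
      { intros z. unfold A, B. rewrite RtoC_mult. field. assumption. }
      assert (NAB : forall z, Cmod z < S -> (A + B * z)%C <> 0%C).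
      { intros z Hz E. apply (blaschke_denominator r S x z); auto.
        replace (RtoC (r * r) - Cconj x * z)%C with (RtoC r * (A + B * z))%C by (rewrite EAB; field; auto).
        rewrite E. ring. }
      exists (fun z => (A + B * z) * k1 z)%C. repeat split.
      * apply entire_mult; [apply entire_linear | exact Hk1].
      * intros z Hz. apply Cmult_neq_0; auto.
      * intros t. rewrite E0, !Cmod_mult, Bd1. f_equal. rewrite EAB.
        replace (RtoC (r * r) - Cconj x * circ r t)%C with (circ r t * Cconj (circ r t - x))%C.
        2:{ rewrite Cminus_conj, <- (circ_conj r t). ring. }
        rewrite Cmod_div, Cmod_mult, Cmod_conj, Cmod_circ, Cmod_R, Rabs_pos_eq by (auto; lra).
        replace (- x + 1 * circ r t)%C with (circ r t - x)%C by ring. field. lra.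
      * rewrite F0, lsum_cons, Cmod_mult, ln_mult.
        2:{ apply Cmod_gt_0, NAB. rewrite Cmod_0. lra. }
        2:{ apply Cmod_gt_0, NZ1. rewrite Cmod_0. lra. }
        replace (A + B * 0)%C with (RtoC r) by (unfold A; ring). rewrite Cmod_R, Rabs_pos_eq by lra.
        change (ln (Cmod (f1 0%C)) + lsum (blaschke_weight r) L <= ln (Cmod (k1 0%C))) in Ln1.
        assert (Q : 0 < Cmod x / r) by (apply Rdiv_lt_0_compat; lra).
        pose proof (ln_le_minus1 _ Q) as LQ. rewrite ln_div in LQ by lra.
        assert (W : blaschke_weight r x <= ln r - ln (Cmod x)).
        { apply Rmax_lub; [|lra]. pose proof (ln_increasing _ _ Px Hxr). lra. }
        lra.
      * intros z Hz Hne. rewrite (Dz z Hz Hne), lsum_cons.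
        rewrite (log_derivative_mult A B k1 z Hk1); [|apply NAB; lra|apply NZ1; lra].
        replace (1 / (z - x) + cd f1 z / f1 z - (B / (A + B * z) + cd k1 z / k1 z))%C
          with ((1 / (z - x) - B / (A + B * z)) + (cd f1 z / f1 z - cd k1 z / k1 z))%C by ring.
        eapply Rle_trans; [apply Cmod_triangle|]. rewrite Rmult_plus_distr_l.
        apply Rplus_le_compat.
        -- rewrite EAB. unfold B. apply blaschke_term_bound; auto; [lra|]. apply Hne. now left.
        -- apply (Dl1 z Hz). intros; apply Hne; now right.
    (* A zero with [|x| >= S] does not disturb the open disc of radius [S]: its factor stays, and
       its weight is 0. *)
    + exists (fun z => (- x + 1 * z) * k1 z)%C.
      assert (W0 : blaschke_weight r x = 0).
      { apply Rmax_left. apply Rmult_le_reg_r with r; [lra|].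
        replace ((1 - Cmod x / r) * r) with (r - Cmod x) by (field; lra). lra. }
      assert (Nx : forall z, Cmod z < S -> (- x + 1 * z)%C <> 0%C).
      { intros z Hz. replace (- x + 1 * z)%C with (z - x)%C by ring. apply Cminus_neq_0. intros ->. lra. }
      repeat split.
      * apply entire_mult; [apply entire_linear | exact Hk1].
      * intros z Hz. apply Cmult_neq_0; auto.
      * intros t. rewrite E0, !Cmod_mult, Bd1. reflexivity.
      * rewrite F0, lsum_cons, W0, Cmod_mult, ln_mult.
        2:{ apply Cmod_gt_0, Nx. rewrite Cmod_0. lra. }
        2:{ apply Cmod_gt_0, NZ1. rewrite Cmod_0. lra. }
        replace (- x + 1 * 0)%C with (- x)%C by ring. rewrite Cmod_opp.
        change (ln (Cmod (f1 0%C)) + lsum (blaschke_weight r) L <= ln (Cmod (k1 0%C))) in Ln1. lra.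
      * intros z Hz Hne. rewrite (Dz z Hz Hne), lsum_cons, W0.
        rewrite (log_derivative_mult (- x) 1 k1 z Hk1); [|apply Nx; lra|apply NZ1; lra].
        replace (1 / (z - x) + cd f1 z / f1 z - (1 / (- x + 1 * z) + cd k1 z / k1 z))%C
          with (cd f1 z / f1 z - cd k1 z / k1 z)%C.
        2:{ replace (- x + 1 * z)%C with (z - x)%C by ring. ring. }
        unfold Rdiv at 1. rewrite Rmult_0_l, Rplus_0_l. apply (Dl1 z Hz). intros; apply Hne; now right.
Qed.

(** For the finitely many zeros with [|x| < S], the reflected zero of modulus [r^2/|x|] must fall
    outside the disc of radius [S]. This holds for [r] close to [S]; already [s = (|x| + S) / 2]
    gives [s^2 > |x| S], by the inequality of the means. *)
Lemma radius_between (S : R) (L : list C) : 0 < S ->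
  exists r, S / 2 < r < S /\ forall x, In x L -> Cmod x * S < r * r \/ S <= Cmod x.
Proof.
  intros HS. induction L as [|x L (r & Hr & HL)].
  - exists (3 / 4 * S). split; [lra|]. cbn. tauto.
  - destruct (Rle_dec S (Cmod x)) as [Hx|Hx].
    + exists r. split; auto. intros y [<-|Hy]; auto.
    + pose proof (Cmod_ge_0 x). set (s := (Cmod x + S) / 2).
      pose proof (Rmax_l r s). pose proof (Rmax_r r s).
      exists (Rmax r s). split; [split; [lra|apply Rmax_lub_lt; unfold s; lra]|].
      intros y [<-|Hy].
      * left. apply Rlt_le_trans with (s * s).
        -- unfold s. assert (0 < (S - Cmod x) * (S - Cmod x)) by (apply Rmult_lt_0_compat; lra). nra.
        -- apply Rmult_le_compat; unfold s in *; lra.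
      * destruct (HL y Hy) as [Hy'|Hy']; [left|now right].
        eapply Rlt_le_trans; [exact Hy'|]. apply Rmult_le_compat; lra.
Qed.

(** In this form the positive logarithm of [|f|] is visibly continuous at the zeros of [f] too. For
    nonpositive [x] the equation relies on the default value [ln x = 0]. *)
Lemma logp_ln_max (x : R) : logp x = ln (Rmax 1 x).
Proof.
  unfold logp. destruct (Rle_dec x 1) as [H|H].
  - rewrite (Rmax_left 1 x) by lra. rewrite ln_1. apply Rmax_left.
    destruct (Rlt_dec 0 x) as [P|P].
    + rewrite <- ln_1. apply ln_le; lra.
    + unfold ln. destruct (Rlt_dec 0 x); [contradiction | lra].
  - rewrite (Rmax_right 1 x) by lra. apply Rmax_right. rewrite <- ln_1. apply ln_le; lra.
Qed.

Lemma logp_le (x y : R) : x <= y -> logp x <= logp y.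
Proof.
  intros H. rewrite !logp_ln_max. apply ln_le; [pose proof (Rmax_l 1 x); lra|].
  apply Rle_max_compat_l. exact H.
Qed.

Lemma prox_integrable (f : C -> C) (r : R) : entire f -> 0 < r ->
  ex_RInt (fun t => logp (Cmod (f (circ r t)))) 0 (2 * PI).
Proof.
  intros Hf Hr. apply (ex_RInt_continuous (V := R_CompleteNormedModule)). intros t _.
  apply (continuous_ext (fun t => ln (Rmax 1 (Cmod (f (circ r t)))))).
  { intros s. symmetry. apply logp_ln_max. }
  apply (continuous_comp (fun t => Cmod (f (circ r t))) (fun x => ln (Rmax 1 x))).
  - apply (clim_Cmod (locally t)). apply (circ_comp_cont (r + 1)); [now apply entire_holo | lra].
  - apply (continuous_comp (fun x => Rmax 1 x) ln).
    + apply (continuous_ext (fun x => (1 + x + Rabs (x - 1)) / 2)).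
      { intros x. unfold Rmax, Rabs. destruct (Rle_dec 1 x), (Rcase_abs (x - 1)); lra. }
      apply continuity_pt_filterlim. reg.
    + apply continuity_pt_filterlim, derivable_continuous_pt. eexists. apply derivable_pt_lim_ln.
      pose proof (Rmax_l 1 (Cmod (f (circ r t)))). lra.
Qed.

Lemma prox_le (f g : C -> C) (r c : R) : entire f -> entire g -> 0 < r ->
  (forall t, logp (Cmod (f (circ r t))) <= logp (Cmod (g (circ r t))) + c) -> prox f r <= prox g r + c.
Proof.
  intros Hf Hg Hr H. pose proof PI_RGT_0. unfold prox.
  change (/ (2 * PI) * RInt (fun t => logp (Cmod (f (circ r t)))) 0 (2 * PI)
    <= / (2 * PI) * RInt (fun t => logp (Cmod (g (circ r t)))) 0 (2 * PI) + c).
  pose proof (prox_integrable f r Hf Hr) as If. pose proof (prox_integrable g r Hg Hr) as Ig.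
  assert (E : RInt (fun t => logp (Cmod (g (circ r t))) + c) 0 (2 * PI)
     = RInt (fun t => logp (Cmod (g (circ r t)))) 0 (2 * PI) + 2 * PI * c).
  { pose proof (RInt_plus (V := R_CompleteNormedModule) (fun t => logp (Cmod (g (circ r t)))) (fun _ => c) 0 (2 * PI) Ig
      (@ex_RInt_const R_NormedModule 0 (2 * PI) c)) as E.
    rewrite RInt_const in E. unfold plus, scal in E. cbn in E. unfold mult in E. cbn in E.
    rewrite Rminus_0_r in E. exact E. }
  assert (I : RInt (fun t => logp (Cmod (f (circ r t)))) 0 (2 * PI) <= RInt (fun t => logp (Cmod (g (circ r t))) + c) 0 (2 * PI)).
  { apply RInt_le; auto; [lra|].
    apply (@ex_RInt_plus R_NormedModule); [exact Ig | apply (@ex_RInt_const R_NormedModule)]. }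
  rewrite E in I. apply (Rmult_le_reg_l (2 * PI)); [lra|].
  rewrite Rmult_plus_distr_l, <- !Rmult_assoc, Rinv_r, !Rmult_1_l by lra. exact I.
Qed.

Lemma prox_ext_circ (f g : C -> C) (r : R) :
  (forall t, Cmod (f (circ r t)) = Cmod (g (circ r t))) -> prox f r = prox g r.
Proof.
  intros H. unfold prox. f_equal. apply RInt_ext. intros t _.
  change (logp (Cmod (f (circ r t))) = logp (Cmod (g (circ r t)))). now rewrite H.
Qed.

Definition near_zeros (r : R) (L : list C) : list C :=
  filter (fun x => if Rlt_dec (Cmod x) (r / 2) then true else false) L.

Lemma near_zeros_count (r : R) (L : list C) : 0 < r ->
  INR (length (near_zeros r L)) <= 2 * lsum (blaschke_weight r) L.
Proof.
  intros Hr. induction L as [|x L IH]; [cbn; lra|]. unfold near_zeros in *. cbn [filter].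
  rewrite lsum_cons. pose proof (Rmax_l 0 (1 - Cmod x / r)) as W0. fold (blaschke_weight r x) in W0.
  destruct (Rlt_dec (Cmod x) (r / 2)); [|lra]. cbn [length]. rewrite S_INR.
  assert (W : 1 / 2 <= blaschke_weight r x).
  { eapply Rle_trans; [|apply Rmax_r]. apply Rmult_le_reg_r with r; [lra|].
    replace ((1 - Cmod x / r) * r) with (r - Cmod x) by (field; lra). lra. }
  lra.
Qed.

(** A zero with [|x| >= r / 2] has distance at least [r / 4] from [z], so it costs only [4 / r]
    times its weight. A nearer one has weight at most 1 and stays in the sum. *)
Lemma near_zeros_sum (r : R) (L : list C) (z : C) : 0 < r -> Cmod z <= r / 4 ->
  (forall x, In x L -> z <> x) ->
  lsum (fun x => blaschke_weight r x / Cmod (z - x)%C) L <=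
  lsum (fun x => / Cmod (z - x)%C) (near_zeros r L) + 4 / r * lsum (blaschke_weight r) L.
Proof.
  intros Hr Hz. induction L as [|x L IH]; intros Hne; [cbn; lra|].
  specialize (IH (fun y Hy => Hne y (or_intror Hy))). unfold near_zeros in *. cbn [filter].
  rewrite !lsum_cons. pose proof (Rmax_l 0 (1 - Cmod x / r)) as W0. fold (blaschke_weight r x) in W0.
  pose proof (Cmod_ge_0 x).
  assert (P : 0 < Cmod (z - x)%C) by (apply Cmod_gt_0, Cminus_neq_0, Hne; now left).
  assert (R0 : 0 < 4 / r) by (apply Rdiv_lt_0_compat; lra).
  pose proof (Rmult_le_pos _ _ (Rlt_le _ _ R0) W0).
  destruct (Rlt_dec (Cmod x) (r / 2)) as [N|N].
  - rewrite lsum_cons. pose proof (Rinv_0_lt_compat _ P) as I.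
    assert (W : blaschke_weight r x <= 1).
    { apply Rmax_lub; [lra|]. assert (0 <= Cmod x / r) by (apply Rdiv_le_0_compat; lra). lra. }
    assert (blaschke_weight r x / Cmod (z - x)%C <= 1 * / Cmod (z - x)%C) by (apply Rmult_le_compat_r; lra). lra.
  - assert (D : r / 4 <= Cmod (z - x)%C).
    { pose proof (Cmod_triangle (z - x) (- z)) as T. replace (z - x + - z)%C with (- x)%C in T by ring.
      rewrite !Cmod_opp in T. lra. }
    assert (blaschke_weight r x / Cmod (z - x)%C <= 4 / r * blaschke_weight r x).
    { unfold Rdiv at 1. rewrite Rmult_comm. apply Rmult_le_compat_r; auto.
      replace (4 / r) with (/ (r / 4)) by (field; lra). apply Rinv_le_contravar; lra. }
    lra.
Qed.

(** The Blaschke quotient [k] has the modulus of [f] on the circle, hence the same [prox], and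
    Jensen's inequality [ln |f 0| + W <= ln |k 0| <= T] bounds the total weight [W] of the zeros.
    That in turn bounds the number of near zeros, each of weight at least [1 / 2], and the
    contribution of the others. Since [r > S / 2], the disc [|z| <= S / 8] lies within
    [|z| <= r / 4]. *)
Lemma log_derivative_estimate (f : C -> C) (S T : R) : entire f -> f 0%C <> 0%C -> 0 < S -> 0 <= T ->
  (forall r, S / 2 < r < S -> prox f r <= T) ->
  exists L, INR (length L) <= 2 * (2 * T - ln (Cmod (f 0%C))) /\
    (forall x, In x L -> Cmod x <= S) /\
    forall z, Cmod z <= S / 8 -> (forall x, In x L -> z <> x) ->
      f z <> 0%C /\
      Cmod (cd f z / f z)%C <= 4 * lsum (fun x => / Cmod (z - x)%C) L + 64 * (2 * T - ln (Cmod (f 0%C))) / S.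
Proof.
  intros Hf N0 HS HT HP.
  destruct (zero_factorization f 0%C S Hf N0 ltac:(lra)) as (L & h & Hh & Fac & HL & NZ).
  destruct (radius_between S L HS) as (r & Hr & HLr).
  assert (Ef : f = fun z => (prod_roots L z * h z)%C) by (apply functional_extensionality; exact Fac).
  destruct (blaschke_quotient r S h L) as (k & Hk & NZk & Bd & Ln & Dl); auto; try lra.
  { intros; apply NZ; lra. }
  { now rewrite <- Fac. }
  rewrite <- Fac in Ln.
  destruct (nonvanishing_log_derivative S r k (entire_holo _ _ Hk) NZk ltac:(lra)) as [Lk Dk].
  assert (Pk : prox k r = prox f r).
  { apply prox_ext_circ. intros t. rewrite Bd. now rewrite <- Fac. }
  pose proof (HP r Hr) as Tr. rewrite Pk in *.
  set (W := lsum (blaschke_weight r) L) in *. set (l0 := ln (Cmod (f 0%C))) in *.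
  assert (W0 : 0 <= W) by (apply lsum_nonneg; intros; apply Rmax_l).
  exists (near_zeros r L). split; [|split].
  - eapply Rle_trans; [apply near_zeros_count; lra|]. fold W. lra.
  - intros x Hx. apply filter_In in Hx. now apply HL.
  - intros z Hz Hne.
    assert (Hne' : forall x, In x L -> z <> x).
    { intros x Hx E. subst x. apply (Hne z); auto. apply filter_In. split; auto.
      destruct (Rlt_dec (Cmod z) (r / 2)); [reflexivity | lra]. }
    split.
    { rewrite Fac. apply Cmult_neq_0; [now apply prod_roots_neq | apply NZ; lra]. }
    specialize (Dl z ltac:(lra) Hne'). specialize (Dk z ltac:(lra)).
    rewrite <- Fac, <- Ef in Dl.
    pose proof (near_zeros_sum r L z ltac:(lra) ltac:(lra) Hne') as Sm. fold W in Sm.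
    pose proof (Cmod_triangle (cd f z / f z - cd k z / k z) (cd k z / k z)) as Tri.
    replace (cd f z / f z - cd k z / k z + cd k z / k z)%C with (cd f z / f z)%C in Tri by ring.
    assert (B1 : 16 * (4 / r * W) <= 4 * (32 * (2 * T - l0) / S)).
    { assert (I : / r <= / (S / 2)) by (apply Rinv_le_contravar; lra).
      replace (/ (S / 2)) with (2 / S) in I by (field; lra).
      replace (16 * (4 / r * W)) with (/ r * (64 * W)) by (field; lra).
      replace (4 * (32 * (2 * T - l0) / S)) with (2 / S * (64 * (2 * T - l0))) by (field; lra).
      apply Rmult_le_compat; try lra. left. apply Rinv_0_lt_compat. lra. }
    assert (B2 : 16 * (2 * prox f r - ln (Cmod (k 0%C))) / r <= 32 * (2 * T - l0) / S).
    { assert (I : / r <= / (S / 2)) by (apply Rinv_le_contravar; lra).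
      replace (/ (S / 2)) with (2 / S) in I by (field; lra).
      replace (32 * (2 * T - l0) / S) with (16 * (2 * T - l0) * (2 / S)) by (field; lra).
      apply Rle_trans with (16 * (2 * T - l0) * / r).
      - apply Rmult_le_compat_r; [left; apply Rinv_0_lt_compat; lra | lra].
      - apply Rmult_le_compat_l; lra. }
    assert (B3 : 4 * (4 / r * W) <= 32 * (2 * T - l0) / S) by lra.
    replace (64 * (2 * T - l0) / S) with (32 * (2 * T - l0) / S + 32 * (2 * T - l0) / S) by (field; lra).
    lra.
Qed.

(** * Small logarithmic derivatives on circles *)

(** One list of exceptional points serves all functions of [Fs], so that a single circle can be good
    for all of them at once. *)
Definition sparse_log_derivatives (rho : R) (Fs : list (C -> C)) : Prop :=
  exists K S0 : R, 0 <= K /\ 1 <= S0 /\ forall S, S0 < S ->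
    exists L : list C, INR (length L) <= K * Rpower S rho /\ (forall x, In x L -> Cmod x <= S) /\
      forall z, Cmod z <= S / 8 -> (forall x, In x L -> z <> x) -> forall F, In F Fs ->
        F z <> 0%C /\
        Cmod (cd F z / F z)%C <= 4 * lsum (fun x => / Cmod (z - x)%C) L + K * Rpower S rho / S.

Lemma lsum_inv_nonneg (L : list C) (z : C) : (forall x, In x L -> z <> x) ->
  0 <= lsum (fun x => / Cmod (z - x)%C) L.
Proof.
  intros H. apply lsum_nonneg. intros x Hx. left. apply Rinv_0_lt_compat, Cmod_gt_0, Cminus_neq_0. auto.
Qed.

Lemma sparse_cons (rho : R) (F : C -> C) (Fs : list (C -> C)) :
  sparse_log_derivatives rho [F] -> sparse_log_derivatives rho Fs -> sparse_log_derivatives rho (F :: Fs).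
Proof.
  intros (K1 & S1 & HK1 & HS1 & H1) (K2 & S2 & HK2 & HS2 & H2).
  exists (K1 + K2), (Rmax S1 S2). pose proof (Rmax_l S1 S2). pose proof (Rmax_r S1 S2).
  split; [lra|]. split; [lra|]. intros S HS.
  destruct (H1 S ltac:(lra)) as (L1 & N1 & B1 & D1). destruct (H2 S ltac:(lra)) as (L2 & N2 & B2 & D2).
  exists (L1 ++ L2). split; [|split].
  - rewrite length_app, plus_INR. lra.
  - intros x Hx. apply in_app_or in Hx. destruct Hx; auto.
  - intros z Hz Hne.
    assert (E1 : forall x, In x L1 -> z <> x) by (intros; apply Hne, in_or_app; auto).
    assert (E2 : forall x, In x L2 -> z <> x) by (intros; apply Hne, in_or_app; auto).
    pose proof (lsum_inv_nonneg L1 z E1). pose proof (lsum_inv_nonneg L2 z E2).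
    assert (P : 0 < Rpower S rho / S) by (apply Rdiv_lt_0_compat; [apply exp_pos | lra]).
    pose proof (Rmult_le_pos _ _ HK1 (Rlt_le _ _ P)). pose proof (Rmult_le_pos _ _ HK2 (Rlt_le _ _ P)).
    rewrite lsum_app. intros G [<-|HG].
    + destruct (D1 z Hz E1 F (or_introl eq_refl)) as [Nz Bd]. split; auto. unfold Rdiv in *. lra.
    + destruct (D2 z Hz E2 G HG) as [Nz Bd]. split; auto. unfold Rdiv in *. lra.
Qed.

Lemma log_derivative_prod_roots (L : list C) (h : C -> C) (z : C) : entire h -> h z <> 0%C ->
  (forall x, In x L -> z <> x) ->
  Cmod (cd (fun z => prod_roots L z * h z) z / (prod_roots L z * h z))%C
  <= lsum (fun x => / Cmod (z - x)%C) L + Cmod (cd h z / h z)%C.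
Proof.
  intros Hh Nh. induction L as [|x L IH]; intros Hne.
  - replace (fun z => prod_roots [] z * h z)%C with h by (apply functional_extensionality; intros; cbn; ring).
    replace (prod_roots [] z * h z)%C with (h z) by (cbn; ring). cbn [lsum fold_right]. unfold lsum. cbn. lra.
  - specialize (IH (fun y Hy => Hne y (or_intror Hy))).
    set (f1 := fun z => (prod_roots L z * h z)%C) in *.
    assert (E0 : forall z, (prod_roots (x :: L) z * h z)%C = ((- x + 1 * z) * f1 z)%C).
    { intros w. change (prod_roots (x :: L) w) with ((w - x) * prod_roots L w)%C. unfold f1. ring. }
    assert (Ef : (fun z => prod_roots (x :: L) z * h z)%C = (fun z => (- x + 1 * z) * f1 z)%C)
      by (apply functional_extensionality; exact E0).
    assert (Nx : (z - x)%C <> 0%C) by (apply Cminus_neq_0, Hne; now left).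
    rewrite Ef, E0, log_derivative_mult.
    + replace (- x + 1 * z)%C with (z - x)%C by ring. rewrite lsum_cons.
      eapply Rle_trans; [apply Cmod_triangle|].
      replace (1 / (z - x))%C with (/ (z - x))%C by (unfold Cdiv; ring). rewrite Cmod_inv by assumption.
      change (prod_roots L z * h z)%C with (f1 z) in IH. lra.
    + now apply entire_prod_roots.
    + now replace (- x + 1 * z)%C with (z - x)%C by ring.
    + apply Cmult_neq_0; auto. apply prod_roots_neq. intros; apply Hne; now right.
Qed.

Lemma Rpower_ge_1 (S rho : R) : 1 <= S -> 0 <= rho -> 1 <= Rpower S rho.
Proof. intros HS Hrho. rewrite <- (Rpower_O S) by lra. apply Rle_Rpower; lra. Qed.

(** The estimate above requires a nonzero value at 0, where [F] may vanish. Factoring over the disc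
    of radius 0 splits off exactly the zeros at 0; on circles of radius at least 1 this does not
    increase [prox], and the zeros removed rejoin the exceptional list. *)
Lemma sparse_of_growth (F : C -> C) (z0 : C) (rho c R0 : R) :
  entire F -> F z0 <> 0%C -> 0 < rho < 1 -> 0 <= c ->
  (forall r, R0 < r -> prox F r <= Rpower r rho + c) -> sparse_log_derivatives rho [F].
Proof.
  intros HF N0 Hrho Hc HP.
  destruct (zero_factorization F z0 0 HF N0 ltac:(lra)) as (L0 & h & Hh & Fac & HL0 & NZ).
  assert (EF : F = fun z => (prod_roots L0 z * h z)%C) by (apply functional_extensionality; exact Fac).
  assert (Nh : h 0%C <> 0%C) by (apply NZ; rewrite Cmod_0; lra).
  set (l0 := ln (Cmod (h 0%C))). set (k := 2 + Rabs (2 * c - l0)).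
  assert (Hk : 0 <= k) by (pose proof (Rabs_pos (2 * c - l0)); unfold k; lra).
  (* For [S] beyond this threshold every [r > S / 2] exceeds both 1 and [R0]. The number [k] is such
     that [2 T - l0 <= k S^rho], thanks to [S^rho >= 1]. *)
  exists (INR (length L0) + 64 * k), (Rmax 2 (2 * R0)).
  pose proof (Rmax_l 2 (2 * R0)). pose proof (Rmax_r 2 (2 * R0)). pose proof (pos_INR (length L0)).
  split; [lra|]. split; [lra|]. intros S HS.
  set (T := Rpower S rho + c). set (P := Rpower S rho).
  assert (HP1 : 1 <= P) by (apply Rpower_ge_1; lra).
  assert (HT : 0 <= T) by (unfold T; fold P; lra).
  destruct (log_derivative_estimate h S T Hh Nh ltac:(lra) HT) as (L & NL & BL & DL).
  { intros r Hr. apply Rle_trans with (prox F r).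
    - rewrite <- (Rplus_0_r (prox F r)). apply prox_le; auto; [lra|].
      intros t. rewrite Rplus_0_r. apply logp_le. rewrite Fac, Cmod_mult.
      rewrite <- (Rmult_1_l (Cmod (h (circ r t)))) at 1.
      apply Rmult_le_compat_r; [apply Cmod_ge_0|].
      rewrite <- (pow1 (length L0)). apply prod_roots_ge; [lra|].
      intros x Hx. pose proof (HL0 x Hx). pose proof (circ_dist r t x ltac:(lra)). lra.
    - eapply Rle_trans; [apply HP; lra|]. unfold T. apply Rplus_le_compat_r.
      apply Rle_Rpower_l; lra. }
  fold l0 in NL, DL.
  assert (KT : 2 * T - l0 <= k * P).
  { unfold T, k. fold P. pose proof (Rle_abs (2 * c - l0)). pose proof (Rabs_pos (2 * c - l0)). nra. }
  assert (NP : INR (length L0) <= INR (length L0) * P) by nra.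
  exists (L0 ++ L). split; [|split].
  - rewrite length_app, plus_INR. fold P. nra.
  - intros x Hx. apply in_app_or in Hx. destruct Hx as [Hx|Hx]; auto. pose proof (HL0 x Hx). lra.
  - intros z Hz Hne G [<-|[]].
    assert (E1 : forall x, In x L0 -> z <> x) by (intros; apply Hne, in_or_app; auto).
    assert (E2 : forall x, In x L -> z <> x) by (intros; apply Hne, in_or_app; auto).
    destruct (DL z Hz E2) as [Nz Bd]. split.
    { rewrite Fac. apply Cmult_neq_0; auto. now apply prod_roots_neq. }
    pose proof (lsum_inv_nonneg L0 z E1). rewrite lsum_app.
    pose proof (log_derivative_prod_roots L0 h z Hh Nz E1) as Lg. rewrite <- Fac, <- EF in Lg.
    fold P.
    assert (64 * (2 * T - l0) / S <= (INR (length L0) + 64 * k) * P / S).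
    { unfold Rdiv. apply Rmult_le_compat_r; [left; apply Rinv_0_lt_compat; lra|]. nra. }
    lra.
Qed.

Lemma exp_le_compat (x y : R) : x <= y -> exp x <= exp y.
Proof. intros [H | ->]; [left; now apply exp_increasing | lra]. Qed.

(** The upper limit is an infimum of suprema over tails; as it lies below 1, so does the supremum
    over some tail. *)
Lemma growth_of_order (f : C -> C) : Rbar_lt (order_entire f) (Finite 1) ->
  exists rho R0, 0 < rho < 1 /\ forall r, R0 < r -> prox f r <= Rpower r rho.
Proof.
  intros H. unfold order_entire, limsup_infty in H.
  set (E := fun y => _) in H.
  assert (Ex : exists y, E y /\ Rbar_lt y (Finite 1)).
  { apply NNPP. intro N. apply (Rbar_lt_not_le _ _ H).
    apply (proj2 (proj2_sig (Rbar_ex_glb E))). intros y Hy. apply Rbar_not_lt_le. intro L. apply N. eauto. }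
  destruct Ex as (y & (R0 & Ey) & Hy).
  pose proof (proj1 (Lub_Rbar_correct (fun x => exists r, R0 < r /\ x = logp (char_entire f r) / ln r))) as UB.
  rewrite <- Ey in UB.
  assert (Q : exists rho, 0 < rho < 1 /\ forall r, R0 < r -> logp (char_entire f r) / ln r <= rho).
  { destruct y as [y| |]; cbn in Hy; try contradiction.
    (* The supremum may be 0; raising the exponent to at least [1 / 2] keeps it positive and below
       1. *)
    - exists (Rmax y (1/2)). split.
      + split; [pose proof (Rmax_r y (1/2)); lra | apply Rmax_lub_lt; lra].
      + intros r Hr. apply Rle_trans with y; [|apply Rmax_l]. apply (UB _ (ex_intro _ r (conj Hr eq_refl))).
    - exists (1/2). split; [lra|]. intros r Hr. destruct (UB _ (ex_intro _ r (conj Hr eq_refl))). }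
  destruct Q as (rho & Hrho & B).
  exists rho, (Rmax R0 1). split; auto. intros r Hr.
  pose proof (Rmax_l R0 1). pose proof (Rmax_r R0 1). specialize (B r ltac:(lra)).
  unfold char_entire in B. set (T := prox f r) in *.
  assert (Lr : 0 < ln r) by (rewrite <- ln_1; apply ln_increasing; lra).
  destruct (Rle_dec T 0) as [N|N].
  - eapply Rle_trans; [exact N|]. left. apply exp_pos.
  - rewrite <- (exp_ln T) by lra. unfold Rpower. apply exp_le_compat.
    eapply Rle_trans; [apply ln_le_logp|].
    replace (logp T) with (logp T / ln r * ln r) by (field; lra). apply Rmult_le_compat_r; lra.
Qed.

(** Pointwise, [max(1, |w - c|) <= max(1, |w|) (1 + |c|)]. *)
Lemma prox_shift (f : C -> C) (c : C) (r : R) : entire f -> 0 < r ->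
  prox (fun z => f z - c)%C r <= prox f r + ln (1 + Cmod c).
Proof.
  intros Hf Hr. pose proof (Cmod_ge_0 c). apply prox_le; auto.
  - apply entire_cderiv. intros z. eexists. apply cderiv_minus; [now apply entire_cd | apply cderiv_const].
  - intros t. rewrite !logp_ln_max. set (w := f (circ r t)).
    pose proof (Rmax_l 1 (Cmod w)). pose proof (Rmax_r 1 (Cmod w)).
    rewrite <- ln_mult by lra. apply ln_le; [pose proof (Rmax_l 1 (Cmod (w - c)%C)); lra|].
    pose proof (Cmod_triangle w (- c)) as T. rewrite Cmod_opp in T. apply Rmax_lub; [nra|].
    unfold Cminus. nra.
Qed.

Lemma arcsinh_le_ln (S : R) : 1 <= S -> arcsinh S <= ln (3 * S).
Proof.
  intros HS. unfold arcsinh. apply ln_le.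
  - pose proof (sqrt_pos (S ^ 2 + 1)). lra.
  - assert (sqrt (S ^ 2 + 1) <= sqrt ((S + 1) ^ 2)) by (apply sqrt_le_1_alt; nra).
    rewrite sqrt_pow2 in H by lra. lra.
Qed.

Lemma arcsinh_opp (x : R) : arcsinh (- x) = - arcsinh x.
Proof.
  rewrite <- (sinh_arcsinh x) at 1.
  replace (- sinh (arcsinh x)) with (sinh (- arcsinh x)).
  - apply arcsinh_sinh.
  - unfold sinh. rewrite Ropp_involutive. field.
Qed.

(** The mean value theorem for the sum of [arcsinh (r - |x|)]. Its derivative is a smoothed version
    of the sum of [1/|r - |x||], finite at every radius, while the function itself grows only
    logarithmically with [S]. *)
Lemma radius_selection (L : list C) (a b S : R) : 0 < a < b -> b <= S ->
  (forall x, In x L -> Cmod x <= S) ->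
  exists r, a < r < b /\
    lsum (fun x => / sqrt ((r - Cmod x) ^ 2 + 1)) L * (b - a) <= INR (length L) * (2 * arcsinh S).
Proof.
  intros Hab HS HL.
  destruct (MVT_cor2 (fun r => lsum (fun x => arcsinh (r - Cmod x)) L)
    (fun r => lsum (fun x => / sqrt ((r - Cmod x) ^ 2 + 1)) L) a b ltac:(lra)) as (r & E & Hr).
  - intros r _. clear HL. induction L as [|x L IH].
    + apply (derivable_pt_lim_const 0).
    + change (derivable_pt_lim ((fun r => arcsinh (r - Cmod x)) + (fun r => lsum (fun x => arcsinh (r - Cmod x)) L))%F r
        (/ sqrt ((r - Cmod x) ^ 2 + 1) + lsum (fun x => / sqrt ((r - Cmod x) ^ 2 + 1)) L)).
      apply derivable_pt_lim_plus; [|exact IH].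
      rewrite <- (Rmult_1_r (/ sqrt ((r - Cmod x) ^ 2 + 1))).
      apply (derivable_pt_lim_comp (fun r => r - Cmod x) arcsinh); [|apply derivable_pt_lim_arcsinh].
      replace 1 with (1 - 0) by ring. apply (derivable_pt_lim_minus id (fct_cte (Cmod x))).
      * apply derivable_pt_lim_id.
      * apply derivable_pt_lim_const.
  - exists r. split; auto. rewrite <- E. rewrite <- lsum_const.
    assert (U : lsum (fun x => arcsinh (b - Cmod x)) L <= lsum (fun x => arcsinh S) L).
    { apply lsum_le. intros x Hx. apply arcsinh_le. pose proof (Cmod_ge_0 x). lra. }
    assert (V : lsum (fun x => - arcsinh S) L <= lsum (fun x => arcsinh (a - Cmod x)) L).
    { apply lsum_le. intros x Hx. rewrite <- arcsinh_opp. apply arcsinh_le. pose proof (HL x Hx). lra. }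
    rewrite !lsum_const in *. lra.
Qed.

Lemma ln_le_Rpower (y s : R) : 0 < y -> 0 < s -> ln y <= Rpower y s / s.
Proof.
  intros Hy Hs. assert (P : 0 < Rpower y s) by apply exp_pos.
  pose proof (ln_le_minus1 _ P) as E. unfold Rpower at 1 in E. rewrite ln_exp in E.
  apply Rmult_le_reg_r with s; auto. replace (Rpower y s / s * s) with (Rpower y s) by (field; lra). lra.
Qed.

(** With [O(S^rho)] exceptional points, the selected radius of order [S] makes the smoothed sum [E]
    of size [O(S^(rho - 1) ln S)], which tends to 0. Each single term is then small as well, so
    every exceptional point is far from the circle, and moving by [d] at most doubles a term. *)
Lemma good_circle (Fs : list (C -> C)) (rho d eps M : R) :
  sparse_log_derivatives rho Fs -> 0 < rho < 1 -> 0 <= d -> 0 < eps ->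
  exists r, 0 < r /\ M < r /\ forall z, r - d <= Cmod z <= r + d -> forall F, In F Fs ->
    F z <> 0%C /\ Cmod (cd F z / F z)%C <= eps.
Proof.
  intros (K & S0 & HK & HS0 & H) Hrho Hd Heps.
  (* Then [S^rho X X = S] for [X = S^s]: one factor [X] absorbs the logarithm, the other provides
     the decay [1 / X]. *)
  set (s := (1 - rho) / 2). assert (Hs : 0 < s < 1) by (unfold s; lra).
  (* Here [192 = 32 * 6]: the interval of radii has length [S / 32], and [2 arcsinh S <= 6 X / s].
     The summand [K] takes care of the remainder [K S^rho / S]. *)
  set (D := 192 * K / s + K).
  assert (HD0 : 0 <= K / s) by (apply Rdiv_le_0_compat; lra).
  assert (HD : K <= D /\ 0 <= D) by (unfold D; unfold Rdiv in *; lra).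
  set (V := Rmax (S0 + 1) (Rmax (16 * d) (32 * Rabs M + 1))).
  assert (V1 : S0 + 1 <= V) by apply Rmax_l.
  assert (V2 : 16 * d <= V) by (eapply Rle_trans; [apply Rmax_l | apply Rmax_r]).
  assert (V3 : 32 * Rabs M + 1 <= V) by (eapply Rle_trans; [apply Rmax_r | apply Rmax_r]).
  (* The summands guarantee, in turn, that [S = X^(1/s)] is at least [V], that the exceptional
     points are far enough from the circle, and that the final bound [9 D / X] is at most [eps],
     where [9 = 4 * 2 + 1]. *)
  set (X := Rpower V s + D * (2 * d + 2) + 9 * D / eps).
  assert (X1 : 0 <= D * (2 * d + 2)) by (apply Rmult_le_pos; lra).
  assert (X2 : 0 <= 9 * D / eps) by (apply Rdiv_le_0_compat; lra).
  assert (X3 : 1 <= Rpower V s) by (apply Rpower_ge_1; lra).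
  assert (HX : 0 < X) by (unfold X; lra).
  set (S := Rpower X (/ s)).
  assert (ES : Rpower S s = X).
  { unfold S. rewrite Rpower_mult, Rinv_l, Rpower_1; lra. }
  assert (HS : V <= S).
  { replace V with (Rpower (Rpower V s) (/ s)).
    - apply Rle_Rpower_l; [left; apply Rinv_0_lt_compat; lra | unfold X; lra].
    - rewrite Rpower_mult, Rinv_r, Rpower_1; lra. }
  clearbody S.
  destruct (H S ltac:(lra)) as (L & NL & BL & DL).
  destruct (radius_selection L (S / 32) (S / 16) S) as (r & Hr & Sel); auto; try lra.
  set (E := lsum (fun x => / sqrt ((r - Cmod x) ^ 2 + 1)) L) in *.
  assert (Ppos : 0 < Rpower S rho) by apply exp_pos.
  assert (PS : Rpower S rho * X * X = S).
  { rewrite <- ES, <- !Rpower_plus. replace (rho + s + s) with 1 by (unfold s; field). apply Rpower_1. lra. }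
  assert (HX1 : 1 <= X) by (unfold X; lra).
  assert (PE : Rpower S rho * X / S = / X).
  { rewrite <- PS at 2. field. lra. }
  assert (PK : K * Rpower S rho / S <= D / X).
  { replace (K * Rpower S rho / S) with (K * (Rpower S rho * X / S) / X) by (field; lra). rewrite PE.
    unfold Rdiv. rewrite Rmult_assoc. apply Rmult_le_compat; [lra | | lra |].
    - apply Rmult_le_pos; left; apply Rinv_0_lt_compat; lra.
    - rewrite <- (Rmult_1_r (/ X)) at 3. apply Rmult_le_compat_l; [left; apply Rinv_0_lt_compat; lra|].
      rewrite <- Rinv_1. apply Rinv_le_contravar; lra. }
  (* The logarithm of [3 S] is at most [(3 S)^s / s], and [3^s <= 3]. *)
  assert (Lg : arcsinh S <= 3 * X / s).
  { eapply Rle_trans; [apply arcsinh_le_ln; lra|].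
    eapply Rle_trans; [apply (ln_le_Rpower (3 * S) s); lra|].
    unfold Rdiv. apply Rmult_le_compat_r; [left; apply Rinv_0_lt_compat; lra|].
    rewrite <- Rpower_mult_distr by lra. rewrite ES. apply Rmult_le_compat_r; [lra|].
    rewrite <- (Rpower_1 3) at 2 by lra. apply Rle_Rpower; lra. }
  assert (EB : E <= D / X).
  { assert (As : 0 <= arcsinh S) by (rewrite <- arcsinh_0; apply arcsinh_le; lra).
    assert (Q : E * (S / 16 - S / 32) <= K * Rpower S rho * (2 * (3 * X / s))).
    { eapply Rle_trans; [exact Sel|]. apply Rmult_le_compat; [apply pos_INR | lra | exact NL | lra]. }
    apply Rle_trans with (192 * K / s * (Rpower S rho * X / S)).
    - apply Rmult_le_reg_r with (S / 32); [lra|].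
      replace (192 * K / s * (Rpower S rho * X / S) * (S / 32)) with (K * Rpower S rho * (2 * (3 * X / s))) by (field; lra).
      lra.
    - rewrite PE. unfold Rdiv. apply Rmult_le_compat_r; [left; apply Rinv_0_lt_compat; lra|]. unfold D, Rdiv. lra. }
  assert (DX1 : D / X * (2 * d + 2) <= 1).
  { apply Rmult_le_reg_r with X; [lra|]. replace (D / X * (2 * d + 2) * X) with (D * (2 * d + 2)) by (field; lra). unfold X. lra. }
  assert (DX2 : 9 * (D / X) <= eps).
  { apply Rmult_le_reg_r with (X / eps); [apply Rdiv_lt_0_compat; lra|].
    replace (9 * (D / X) * (X / eps)) with (9 * D / eps) by (field; lra).
    replace (eps * (X / eps)) with X by (field; lra). unfold X. lra. }
  assert (Ipos : forall x, 0 < / sqrt ((r - Cmod x) ^ 2 + 1)).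
  { intros x. apply Rinv_0_lt_compat, sqrt_lt_R0. pose proof (pow2_ge_0 (r - Cmod x)). lra. }
  (* A single term [1 / q] is at most [E], which forces [q >= 2 d + 2]. As [|r - |x|| >= q - 1], a
     point [z] of the annulus satisfies [|z - x| >= q - 1 - d >= q / 2]. *)
  assert (Gap : forall x z, In x L -> r - d <= Cmod z <= r + d ->
     0 < Cmod (z - x)%C /\ / Cmod (z - x)%C <= 2 * / sqrt ((r - Cmod x) ^ 2 + 1)).
  { intros x z Hx Hz.
    assert (T : / sqrt ((r - Cmod x) ^ 2 + 1) <= E).
    { apply (lsum_term_le (fun x => / sqrt ((r - Cmod x) ^ 2 + 1))); auto. intros; left; apply Ipos. }
    specialize (Ipos x). set (q := sqrt ((r - Cmod x) ^ 2 + 1)) in *.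
    assert (Hq : 0 < q) by (rewrite <- (Rinv_inv q); now apply Rinv_0_lt_compat).
    assert (Q1 : 2 * d + 2 <= q).
    { assert (/ q * (2 * d + 2) <= 1) by (eapply Rle_trans; [apply Rmult_le_compat_r; [lra|]; eapply Rle_trans; [exact T | exact EB] | exact DX1]).
      apply Rmult_le_reg_l with (/ q); auto. rewrite Rinv_l; lra. }
    assert (Q2 : q <= Rabs (r - Cmod x) + 1).
    { unfold q. rewrite <- (sqrt_pow2 (Rabs (r - Cmod x) + 1)) by (pose proof (Rabs_pos (r - Cmod x)); lra).
      apply sqrt_le_1_alt. rewrite <- (pow2_abs (r - Cmod x)). pose proof (Rabs_pos (r - Cmod x)). nra. }
    assert (Q3 : Rabs (r - Cmod x) - d <= Cmod (z - x)%C).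
    { pose proof (Cmod_triangle (z - x) x) as T1. replace (z - x + x)%C with z in T1 by ring.
      pose proof (Cmod_triangle (- (z - x)) z) as T2. replace (- (z - x) + z)%C with x in T2 by ring.
      rewrite Cmod_opp in T2. unfold Rabs. destruct (Rcase_abs (r - Cmod x)); lra. }
    split; [lra|]. replace (2 * / q) with (/ (q / 2)) by (field; lra). apply Rinv_le_contravar; lra. }
  exists r. split; [lra|]. split; [pose proof (Rle_abs M); lra|].
  intros z Hz F HF.
  destruct (DL z ltac:(lra)) with (F := F) as [Nz Bd]; auto.
  { intros x Hx E'. subst x. destruct (Gap z z Hx Hz) as [G _].
    replace (z - z)%C with (RtoC 0) in G by ring. rewrite Cmod_0 in G. lra. }
  split; auto.
  assert (Sm : lsum (fun x => / Cmod (z - x)%C) L <= 2 * E).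
  { unfold E. rewrite <- lsum_scal. apply lsum_le. intros x Hx. now apply Gap. }
  lra.
Qed.

(** * Removable poles, common non-zeros and the shift *)

(** A zero of any multiplicity is a simple pole of [F' / F], so one zero of [q] cancels it. In the
    induction each entry of the list, repeated or not, contributes its own [q / (z - x)], which is
    entire by [entire_factor]. *)
Lemma log_derivative_extends (F q : C -> C) (z0 : C) (S : R) :
  entire F -> F z0 <> 0%C -> entire q -> (forall z, F z = 0%C -> q z = 0%C) -> 0 <= S ->
  exists psi, holo S psi /\
    forall z, Cmod z < S -> F z <> 0%C -> psi z = (q z * (cd F z / F z))%C.
Proof.
  intros HF N0 Hq Hz HS.
  destruct (zero_factorization F z0 S HF N0 HS) as (L & h & Hh & Fac & _ & NZ).
  assert (EF : F = fun z => (prod_roots L z * h z)%C) by (apply functional_extensionality; exact Fac).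
  assert (HL : forall x, In x L -> q x = 0%C).
  { intros x Hx. apply Hz. rewrite Fac, prod_roots_root by assumption. ring. }
  assert (A : exists psi, holo S psi /\ forall z, Cmod z < S -> (forall x, In x L -> z <> x) ->
    psi z = (q z * (cd (fun z => prod_roots L z * h z) z / (prod_roots L z * h z)))%C).
  { clear EF Fac. induction L as [|x L IH].
    - exists (fun z => q z * (cd h z / h z))%C. split.
      + intros z Hzs. destruct (holo_cd S h (entire_holo h S Hh) z Hzs) as [d Hd].
        eexists. apply cderiv_mult; [now apply entire_cd|].
        apply cderiv_mult; [exact Hd|]. apply cderiv_inv; [apply NZ; lra | now apply entire_cd].
      + intros z _ _.
        replace (fun z => prod_roots [] z * h z)%C with h by (apply functional_extensionality; intros; cbn; ring).
        replace (prod_roots [] z * h z)%C with (h z) by (cbn; ring). reflexivity.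
    - destruct IH as (psi & Hpsi & Epsi); [intros; apply HL; now right|].
      destruct (entire_factor q x Hq (HL x (or_introl eq_refl))) as (q1 & Hq1 & Eq1).
      exists (fun z => q1 z + psi z)%C. split.
      + intros z Hzs. destruct (Hpsi z Hzs) as [d Hd]. eexists. apply cderiv_plus; [now apply entire_cd | exact Hd].
      + intros z Hzs Hne. rewrite Epsi by (auto; intros; apply Hne; now right).
        set (f1 := fun z => (prod_roots L z * h z)%C).
        assert (E0 : forall z, (prod_roots (x :: L) z * h z)%C = ((- x + 1 * z) * f1 z)%C).
        { intros w. change (prod_roots (x :: L) w) with ((w - x) * prod_roots L w)%C. unfold f1. ring. }
        assert (Ef : (fun z => prod_roots (x :: L) z * h z)%C = (fun z => (- x + 1 * z) * f1 z)%C)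
          by (apply functional_extensionality; exact E0).
        assert (Nx : (- x + 1 * z)%C <> 0%C).
        { replace (- x + 1 * z)%C with (z - x)%C by ring. apply Cminus_neq_0, Hne. now left. }
        rewrite Ef, E0, log_derivative_mult; auto.
        * change (prod_roots L z * h z)%C with (f1 z). rewrite Eq1.
          replace (z - x)%C with (- x + 1 * z)%C by ring. change (fun z => prod_roots L z * h z)%C with f1.
          set (l := (cd f1 z / f1 z)%C). field. now rewrite Cmult_1_l in Nx.
        * now apply entire_prod_roots.
        * apply Cmult_neq_0; [|apply NZ; lra]. apply prod_roots_neq. intros; apply Hne; now right. }
  destruct A as (psi & Hpsi & Epsi). exists psi. split; auto.
  intros z Hzs Nz. rewrite Fac in Nz. rewrite EF. apply Epsi; auto.
  intros x Hx ->. apply Nz. rewrite prod_roots_root by assumption. ring.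
Qed.

Lemma cd_zero_constant (f : C -> C) : entire f -> (forall z, cd f z = 0%C) -> forall z, f z = f 0%C.
Proof.
  intros Hf H0 z.
  assert (D : forall s, rderiv (fun s => f (0 + RtoC s * z)%C) s 0%C).
  { intros s. pose proof (rderiv_along_line f (cd f) 0%C z s (entire_cd f _ Hf)) as D.
    now rewrite H0, Cmult_0_l in D. }
  assert (E : f (0 + RtoC 0 * z)%C = f (0 + RtoC 1 * z)%C).
  { apply injective_projections.
    - apply (eq_is_derive (V := R_NormedModule) (fun s => fst (f (0 + RtoC s * z)%C)) 0 1); [|lra].
      intros s _. apply (rderiv_fst_snd (fun s => f (0 + RtoC s * z)%C) s 0%C), D.
    - apply (eq_is_derive (V := R_NormedModule) (fun s => snd (f (0 + RtoC s * z)%C)) 0 1); [|lra].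
      intros s _. apply (rderiv_fst_snd (fun s => f (0 + RtoC s * z)%C) s 0%C), D. }
  replace (0 + RtoC 0 * z)%C with (RtoC 0) in E by ring.
  replace (0 + RtoC 1 * z)%C with z in E by ring. now symmetry.
Qed.

(** Each function has finitely many zeros in the unit disc, too few to cover all the points
    [1 / (n + 1)]. *)
Lemma common_nonzero (p q : C -> C) (z1 z2 : C) : entire p -> entire q -> p z1 <> 0%C -> q z2 <> 0%C ->
  exists z, p z <> 0%C /\ q z <> 0%C.
Proof.
  intros Hp Hq N1 N2.
  destruct (zero_factorization p z1 1 Hp N1 ltac:(lra)) as (L1 & h1 & _ & F1 & _ & Z1).
  destruct (zero_factorization q z2 1 Hq N2 ltac:(lra)) as (L2 & h2 & _ & F2 & _ & Z2).
  apply NNPP. intro N.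
  set (pt := fun n : nat => RtoC (/ (INR n + 1))).
  assert (Pn : forall n, 0 < INR n + 1) by (intros n; pose proof (pos_INR n); lra).
  assert (A : forall n, In (pt n) (L1 ++ L2)).
  { intros n. assert (B : Cmod (pt n) <= 1).
    { unfold pt. rewrite Cmod_R, Rabs_pos_eq by (left; now apply Rinv_0_lt_compat).
      rewrite <- Rinv_1. apply Rinv_le_contravar; [lra|]. pose proof (pos_INR n). lra. }
    apply NNPP. intro Ni. apply N. exists (pt n).
    rewrite F1, F2. split; apply Cmult_neq_0; auto; apply prod_roots_neq; intros x Hx <-;
      apply Ni, in_or_app; auto. }
  assert (ND : NoDup (map pt (seq 0 (length (L1 ++ L2) + 1)))).
  { apply Injective_map_NoDup; [|apply seq_NoDup].
    intros m n E. apply RtoC_inj in E. apply INR_eq.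
    assert (E' : INR m + 1 = INR n + 1) by (rewrite <- (Rinv_inv (INR m + 1)), E; apply Rinv_inv). lra. }
  assert (I : incl (map pt (seq 0 (length (L1 ++ L2) + 1))) (L1 ++ L2)).
  { intros x Hx. apply in_map_iff in Hx. destruct Hx as (n & <- & _). apply A. }
  pose proof (NoDup_incl_length ND I) as Len. rewrite length_map, length_seq in Len. lia.
Qed.

(** By the mean value theorem along the segment, [ln |f|] increases by at most [eps |eta| <= 1], so
    [|f|] grows at most by the factor [e], which is below 3. *)
Lemma shift_bound (f : C -> C) (w eta : C) (eps : R) : entire f ->
  (forall s, 0 <= s <= 1 -> f (w + RtoC s * eta)%C <> 0%C /\
     Cmod (cd f (w + RtoC s * eta) / f (w + RtoC s * eta))%C <= eps) ->
  eps * Cmod eta <= 1 -> Cmod (f (w + eta)%C) <= 3 * Cmod (f w).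
Proof.
  intros Hf H He.
  set (p := fun s => (w + RtoC s * eta)%C) in *.
  set (u := fun s => ln (Cmod (f (p s)))).
  assert (D : forall s, 0 <= s <= 1 -> is_derive u s (fst (cd f (p s) * eta / f (p s))%C)).
  { intros s Hs. apply (ln_Cmod_deriv (fun s => f (p s))); [now apply H|].
    apply (rderiv_along_line f (cd f)). now apply entire_cd. }
  destruct (MVT_gen u 0 1 (fun s => fst (cd f (p s) * eta / f (p s))%C)) as (s & Hs & E).
  - intros s Hs. rewrite Rmin_left, Rmax_right in Hs by lra. apply D. lra.
  - intros s Hs. rewrite Rmin_left, Rmax_right in Hs by lra.
    apply continuity_pt_filterlim. apply (ex_derive_continuous u s). eexists. apply D. lra.
  - rewrite Rmin_left, Rmax_right in Hs by lra.
    destruct (H s Hs) as [Ns Bs].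
    assert (B : fst (cd f (p s) * eta / f (p s))%C <= 1).
    { eapply Rle_trans; [apply Rle_abs|]. eapply Rle_trans; [apply fst_le_Cmod|].
      replace (cd f (p s) * eta / f (p s))%C with ((cd f (p s) / f (p s)) * eta)%C by (field; exact Ns).
      rewrite Cmod_mult. eapply Rle_trans; [|exact He]. apply Rmult_le_compat_r; [apply Cmod_ge_0 | exact Bs]. }
    destruct (H 0 ltac:(lra)) as [N0 _]. destruct (H 1 ltac:(lra)) as [N1 _].
    assert (P0 : p 0 = w) by (unfold p; ring). assert (P1 : p 1 = (w + eta)%C) by (unfold p; ring).
    assert (U : u 1 <= 1 + u 0) by lra.
    change (f (p 0) <> 0%C) in N0. change (f (p 1) <> 0%C) in N1.
    unfold u in U. rewrite P0 in U, N0. rewrite P1 in U, N1.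
    apply Cmod_gt_0 in N0, N1.
    rewrite <- (exp_ln (Cmod (f (w + eta)%C))) by exact N1.
    eapply Rle_trans; [apply exp_le_compat, U|]. rewrite exp_plus, exp_ln by exact N0.
    apply Rmult_le_compat_r; [lra | apply exp_le_3].
Qed.

Lemma entire_shift (f : C -> C) (c : C) : entire f -> entire (fun z => f z - c)%C.
Proof.
  intros Hf. apply entire_cderiv. intros z. eexists.
  apply cderiv_minus; [now apply entire_cd | apply cderiv_const].
Qed.

Lemma cd_shift (f : C -> C) (c z : C) : entire f -> cd (fun z => f z - c)%C z = cd f z.
Proof.
  intros Hf. transitivity (cd f z - 0)%C; [|ring]. apply cd_eq.
  apply cderiv_minus; [now apply entire_cd | apply cderiv_const].
Qed.

Lemma entire_minus_diff_op (f : C -> C) (eta : C) : entire f -> entire (fun z => f z - diff_op eta f z)%C.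
Proof.
  intros Hf. apply entire_cderiv. intros z.
  assert (D : cderiv (fun w => f (w + eta)%C) z (cd f (z + eta)%C)).
  { apply cderiv_eps. intros e He.
    destruct (proj1 (cderiv_eps f (z + eta)%C _) (entire_cd f (z + eta)%C Hf) e He) as (del & Hd & B).
    exists del. split; auto. intros w Hw.
    replace (w - z)%C with ((w + eta) - (z + eta))%C by ring. apply B.
    now replace ((w + eta) - (z + eta))%C with (w - z)%C by ring. }
  eexists. apply cderiv_minus; [now apply entire_cd|]. unfold diff_op.
  apply cderiv_minus; [exact D | now apply entire_cd].
Qed.

Lemma nonconstant_avoids (f : C -> C) (c : C) : (exists z1 z2, f z1 <> f z2) -> exists z, (f z - c)%C <> 0%C.
Proof.
  intros (z1 & z2 & N). apply NNPP. intro A.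
  assert (B : forall z, f z = c).
  { intros z. apply NNPP. intro Nz. apply A. exists z. now apply Cminus_neq_0. }
  apply N. now rewrite !B.
Qed.

(* [q (f' / (f - a) - f' / (f + a)) = (q / f) a (f' / (f - a) + f' / (f + a))]: the left side is
   holomorphic because [q = f - diff_op eta f] vanishes where [f = a] or [f = - a],
   the right side is small on suitable circles. *)
Lemma shared_values_product (f : C -> C) (eta a : C) :
  entire f -> (exists z1 z2 : C, f z1 <> f z2) -> Rbar_lt (order_entire f) (Finite 1) -> a <> 0%C ->
  share_IM f (diff_op eta f) a -> share_IM f (diff_op eta f) (- a)%C ->
  forall z, ((f z - diff_op eta f z) * cd f z)%C = 0%C.
Proof.
  intros Hf Nc Ho Ha S1 S2 z.
  set (q := fun z => (f z - diff_op eta f z)%C).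
  change ((q z * cd f z)%C = 0%C).
  assert (Hq : entire q) by now apply entire_minus_diff_op.
  assert (Q1 : forall w, (f w - a)%C = 0%C -> q w = 0%C).
  { intros w E. assert (Ew : f w = a) by (replace (f w) with (f w - a + a)%C by ring; rewrite E; ring).
    unfold q. rewrite (proj1 (S1 w) Ew), Ew. ring. }
  assert (Q2 : forall w, (f w - - a)%C = 0%C -> q w = 0%C).
  { intros w E. assert (Ew : f w = (- a)%C) by (replace (f w) with (f w - - a + - a)%C by ring; rewrite E; ring).
    unfold q. rewrite (proj1 (S2 w) Ew), Ew. ring. }
  (* At points where [f = a] or [f = - a] the factor [q] vanishes; elsewhere the denominators of
     [Phi] are nonzero. *)
  destruct (excluded_middle_informative ((f z - a)%C = 0%C)) as [E1|N1]; [rewrite (Q1 z E1); ring|].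
  destruct (excluded_middle_informative ((f z - - a)%C = 0%C)) as [E2|N2]; [rewrite (Q2 z E2); ring|].
  destruct (growth_of_order f Ho) as (rho & R0 & Hrho & Gr).
  assert (Sp : forall c, sparse_log_derivatives rho [fun z => f z - c]%C).
  { intros c. destruct (nonconstant_avoids f c Nc) as [z0 Nz0].
    assert (L0 : 0 <= ln (1 + Cmod c)).
    { rewrite <- ln_1. apply ln_le; [lra|]. pose proof (Cmod_ge_0 c). lra. }
    apply (sparse_of_growth _ z0 rho (ln (1 + Cmod c)) (Rmax R0 0)); auto.
    - now apply entire_shift.
    - intros r Hr. pose proof (Rmax_l R0 0). pose proof (Rmax_r R0 0).
      eapply Rle_trans; [apply prox_shift; [assumption|lra]|].
      apply Rplus_le_compat_r, Gr. lra. }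
  (* Writing [f] as [f - 0] lets [Sp] treat all three functions alike. *)
  set (Fs := [(fun z => f z - 0)%C; (fun z => f z - a)%C; (fun z => f z - - a)%C]).
  assert (SpF : sparse_log_derivatives rho Fs).
  { apply sparse_cons; [apply Sp|]. apply sparse_cons; [apply Sp|]. apply Sp. }
  set (Phi := fun w => (q w * (cd f w / (f w - a)) - q w * (cd f w / (f w - - a)))%C).
  assert (Small : forall eps, 0 < eps -> eps * Cmod eta <= 1 -> Cmod (Phi z) <= 40 * Cmod a * eps).
  { intros eps Heps Heta. pose proof (Cmod_ge_0 z).
    destruct (good_circle Fs rho (Cmod eta) eps (2 * Cmod z + 1) SpF Hrho (Cmod_ge_0 eta) Heps) as (r & Hr & Hrz & Good).
    destruct (nonconstant_avoids f a Nc) as [za Nza]. destruct (nonconstant_avoids f (- a)%C Nc) as [zb Nzb].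
    (* The two halves of [Phi] are extended across their poles separately. The difference of the
       extensions agrees with [Phi] at [z] and on the chosen circle, where [f - a] and [f + a] have
       no zeros. *)
    destruct (log_derivative_extends (fun z => f z - a)%C q za (r + 1)) as (p1 & Hp1 & E1); auto; [now apply entire_shift | lra|].
    destruct (log_derivative_extends (fun z => f z - - a)%C q zb (r + 1)) as (p2 & Hp2 & E2); auto; [now apply entire_shift | lra|].
    assert (EP : forall w, Cmod w < r + 1 -> (f w - a)%C <> 0%C -> (f w - - a)%C <> 0%C -> (p1 w - p2 w)%C = Phi w).
    { intros w Hw Na Nb. unfold Phi. rewrite E1, E2, !cd_shift by auto. reflexivity. }
    rewrite <- EP by (auto; lra).
    assert (Hp : holo (r + 1) (fun w => p1 w - p2 w)%C).
    { intros w Hw. destruct (Hp1 w Hw), (Hp2 w Hw). eexists. apply cderiv_minus; eassumption. }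
    eapply Rle_trans.
    (* On the circle [|q / f| <= 5] and the two logarithmic derivatives add up to at most [2 eps],
       which makes 10. The sup bound doubles this, and [r / (r - |z|) <= 2] because [r > 2 |z| + 1]:
       hence 40. *)
    { apply (cauchy_sup_bound (r + 1) r (10 * Cmod a * eps) _ z Hp); [lra | lra |].
      intros t _. set (w := circ r t).
      assert (Cw : Cmod w = r) by (apply Cmod_circ; lra).
      pose proof (Cmod_ge_0 eta).
      destruct (Good w ltac:(lra) (fun z => f z - 0)%C ltac:(left; reflexivity)) as [G0 B0].
      destruct (Good w ltac:(lra) (fun z => f z - a)%C ltac:(right; left; reflexivity)) as [Ga Ba].
      destruct (Good w ltac:(lra) (fun z => f z - - a)%C ltac:(right; right; left; reflexivity)) as [Gb Bb].
      cbv beta in *. rewrite cd_shift in B0, Ba, Bb by assumption.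
      rewrite EP by (auto; lra).
      replace (f w - 0)%C with (f w) in * by ring.
      assert (Sh : Cmod (f (w + eta)%C) <= 3 * Cmod (f w)).
      { apply (shift_bound f w eta eps); auto. intros s Hs.
        destruct (Good (w + RtoC s * eta)%C) with (F := (fun z => f z - 0)%C) as [G B]; [|left; reflexivity|].
        - assert (Bs : Cmod (RtoC s * eta)%C <= Cmod eta).
          { rewrite Cmod_mult, Cmod_R, Rabs_pos_eq by lra. nra. }
          pose proof (Cmod_triangle w (RtoC s * eta)) as T1.
          pose proof (Cmod_triangle (w + RtoC s * eta) (- (RtoC s * eta))) as T2. rewrite Cmod_opp in T2.
          replace (w + RtoC s * eta + - (RtoC s * eta))%C with w in T2 by ring. lra.
        - cbv beta in *. rewrite cd_shift in B by assumption.
          now replace (f (w + RtoC s * eta) - 0)%C with (f (w + RtoC s * eta)%C) in * by ring. }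
      (* The quotient [q / f] is [2 - f (w + eta) / f w], so its modulus is at most [2 + 3]. *)
      assert (Bq : Cmod (q w / f w)%C <= 5).
      { rewrite Cmod_div by assumption. apply Cmod_gt_0 in G0. apply Rmult_le_reg_r with (Cmod (f w)); auto.
        unfold Rdiv. rewrite Rmult_assoc, Rinv_l, Rmult_1_r by lra.
        unfold q, diff_op. replace (f w - (f (w + eta) - f w))%C with (2 * f w + - f (w + eta))%C by ring.
        eapply Rle_trans; [apply Cmod_triangle|]. rewrite Cmod_opp, Cmod_mult, Cmod_R, Rabs_pos_eq; lra. }
      replace (Phi w) with ((q w / f w) * (a * (cd f w / (f w - a) + cd f w / (f w - - a))))%C
        by (unfold Phi; field; auto).
      rewrite !Cmod_mult.
      pose proof (Cmod_triangle (cd f w / (f w - a)) (cd f w / (f w - - a))) as Tr.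
      pose proof (Cmod_ge_0 a). pose proof (Cmod_ge_0 (q w / f w)).
      apply Rle_trans with (5 * (Cmod a * (2 * eps))); [|lra].
      apply Rmult_le_compat; auto.
      - apply Rmult_le_pos; apply Cmod_ge_0.
      - apply Rmult_le_compat_l; lra. }
    apply Rmult_le_reg_r with (r - Cmod z); [lra|].
    replace (2 * (10 * Cmod a * eps) * r / (r - Cmod z) * (r - Cmod z)) with (Cmod a * eps * (20 * r)) by (field; lra).
    replace (40 * Cmod a * eps * (r - Cmod z)) with (Cmod a * eps * (40 * (r - Cmod z))) by ring.
    apply Rmult_le_compat_l; [|lra]. apply Rmult_le_pos; [apply Cmod_ge_0|lra]. }
  assert (Z : Phi z = 0%C).
  { apply Cmod_eq_0. apply Rle_antisym; [|apply Cmod_ge_0]. apply Rnot_lt_le. intro P.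
    pose proof (Cmod_ge_0 a). pose proof (Cmod_ge_0 eta).
    (* The bound [e1] secures the condition [eps |eta| <= 1], and [e2] makes [40 |a| eps] smaller
       than [|Phi z|]; adding 1 keeps the denominators positive. *)
    set (e1 := / (Cmod eta + 1)). set (e2 := Cmod (Phi z) / (80 * (Cmod a + 1))).
    assert (P1 : 0 < e1) by (apply Rinv_0_lt_compat; lra).
    assert (P2 : 0 < e2) by (apply Rdiv_lt_0_compat; lra).
    pose proof (Rmin_l e1 e2). pose proof (Rmin_r e1 e2).
    assert (P3 : 0 < Rmin e1 e2) by (apply Rmin_pos; lra).
    assert (B : Rmin e1 e2 * Cmod eta <= 1).
    { apply Rle_trans with (e1 * (Cmod eta + 1)); [apply Rmult_le_compat; lra|]. unfold e1. rewrite Rinv_l; lra. }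
    specialize (Small _ P3 B).
    assert (40 * Cmod a * Rmin e1 e2 <= 40 * Cmod a * e2) by (apply Rmult_le_compat_l; lra).
    assert (E : e2 * (80 * (Cmod a + 1)) = Cmod (Phi z)) by (unfold e2; field; lra).
    nra. }
  assert (NA : (2 * a)%C <> 0%C).
  { apply Cmult_neq_0; auto. intro E. apply RtoC_inj in E. lra. }
  (* Since [1 / (f - a) - 1 / (f + a) = 2 a / (f^2 - a^2)], the product is recovered from
     [Phi z]. *)
  replace (q z * cd f z)%C with (Phi z * ((f z - a) * (f z - - a)) / (2 * a))%C.
  - rewrite Z. unfold Cdiv. ring.
  - unfold Phi. field. auto.
Qed.

Theorem theorem10 (f : C -> C) (eta a : C) :
  entire f ->
  (exists z1 z2 : C, f z1 <> f z2) ->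
  Rbar_lt (order_entire f) (Finite 1) ->
  eta <> 0%C ->
  a <> 0%C ->
  share_IM f (diff_op eta f) a ->
  share_IM f (diff_op eta f) (- a)%C ->
  forall z : C, f z = diff_op eta f z.
Proof.
  intros Hf Nc Ho _ Ha S1 S2 z. apply NNPP. intro Nz.
  pose proof (shared_values_product f eta a Hf Nc Ho Ha S1 S2) as Z.
  assert (Ex : exists w, cd f w <> 0%C).
  { apply NNPP. intro N. destruct Nc as (z1 & z2 & Nf). apply Nf.
    assert (C0 : forall w, cd f w = 0%C) by (intros w; apply NNPP; eauto).
    now rewrite (cd_zero_constant f Hf C0 z1), (cd_zero_constant f Hf C0 z2). }
  destruct Ex as [w Nw].
  assert (Hcd : entire (cd f)) by (apply entire_holo_all; intros R; now apply holo_cd, entire_holo).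
  (* Two entire functions, neither identically zero, do not have an identically zero product: at a
     common non-zero [v] the product differs from 0. *)
  destruct (common_nonzero (fun z => f z - diff_op eta f z)%C (cd f) z w) as (v & V1 & V2); auto.
  - now apply entire_minus_diff_op.
  - now apply Cminus_neq_0.
  - apply (Cmult_neq_0 _ _ V1 V2), Z.
Qed.
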